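(* Let $\mathsf{k}$ be a field. For any $N\in\mathbb{N}$, there exist ladders $Y$ such that $|\mathfrak{S}_0(R_2(Y))| = 2^N$. In fact, infinitely many such ladders exist.
   Context: $\mathbb{N}$ denotes the nonnegative integers. A finitely generated module $C$ over a commutative noetherian ring $R$ is semidualizing if $\operatorname{Hom}_R(C,C)\cong R$ and $\operatorname{Ext}^i_R(C,C)=0$ for all $i\ge 1$; $\mathfrak{S}_0(R)$ is the set of isomorphism classes of semidualizing $R$-modules. A ladder is a subset $Y$ of an $m\times n$ matrix $X=(X_{ij})$ of indeterminates such that whenever $X_{ij},X_{pq}\in Y$ with $i\le p$ and $j\le q$, then $X_{iq},X_{pj}\in Y$. Throughout, $X$ is the smallest matrix containing $Y$ (every row and column of $X$ meets $Y$), every variable of $Y$ is part of a $2\times 2$ minor lying in $Y$, and $Y$ is 2-connected: there do not exist nonempty subladders $Z_1,Z_2\subseteq Y$ with $Z_1\cap Z_2=\varnothing$, $Z_1\cup Z_2=Y$, and every 2-minor of $Y$ contained in $Z_1$ or $Z_2$. The ladder determinantal ring is $R_2(Y)=\mathsf{k}[Y]/I_2(Y)$, where $I_2(Y)$ is the ideal generated by the $2\times2$ minors of $X$ lying entirely in $Y$. *)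

(* Defs.v *)
From HB Require Import structures.
From mathcomp Require Import all_boot all_algebra.
From mathcomp Require Import boolp classical_sets functions cardinality.
From mathcomp Require Import mpoly.

Set Implicit Arguments.
Unset Strict Implicit.
Unset Printing Implicit Defensive.

Import GRing.Theory.
Local Open Scope ring_scope.

Section Modules.
Variable R : comPzRingType.

Definition lmod_iso (M N : lmodType R) : Prop :=
  exists f : {linear M -> N}, bijective f.

Definition fin_gen (M : lmodType R) : Prop :=
  exists (n : nat) (g : 'I_n -> M),
    forall x : M, exists a : 'I_n -> R, x = \sum_i a i *: g i.

Section Hom.
Variables M N : lmodType R.

Definition linear_pred : {pred M -> N} := fun f => `[< linear f >].

Lemma linear_pred_submod : submod_closed linear_pred.
Proof.
split=> [|a f g /asboolP lf /asboolP lg]; apply/asboolP => b x y.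
  by rewrite scaler0 addr0.
by rewrite !fctE lf lg !scalerDr !scalerA (mulrC a) addrACA.
Qed.

HB.instance Definition _ :=
  GRing.isSubmodClosed.Build R (M -> N) linear_pred linear_pred_submod.

Record Hom := MkHom { hom_fun : M -> N; hom_linear : hom_fun \in linear_pred }.

HB.instance Definition _ := [isSub for hom_fun].
HB.instance Definition _ := [Choice of Hom by <:].
HB.instance Definition _ := [SubChoice_isSubLmodule of Hom by <:].

End Hom.

Definition projective (P : lmodType R) : Prop :=
  forall (A B : lmodType R) (g : {linear A -> B}) (f : {linear P -> B}),
    (forall b, exists a, g a = b) -> exists h : {linear P -> A}, g \o h =1 f.

(** [... -> res_obj 1 -> res_obj 0 -> M -> 0] *)
Record proj_resolution (M : lmodType R) := ProjResolution {
  res_obj : nat -> lmodType R;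
  res_diff : forall n, {linear res_obj n.+1 -> res_obj n};
  res_aug : {linear res_obj 0%N -> M};
  res_projective : forall n, projective (res_obj n);
  res_aug_surj : forall x, exists y, res_aug y = x;
  res_exact0 : forall y, res_aug y = 0 <-> exists z, res_diff 0%N z = y;
  res_exact : forall n y,
    res_diff n y = 0 <-> exists z, res_diff n.+1 z = y
}.

Section Ext.
Variables (M N : lmodType R) (P : proj_resolution M).

Definition cocycle (i : nat) (f : {linear res_obj P i -> N}) : Prop :=
  forall x, f (res_diff P i x) = 0.

Definition coboundary (i : nat) : {linear res_obj P i -> N} -> Prop :=
  match i with
  | 0 => fun f => forall x, f x = 0
  | j.+1 => fun f => exists g : {linear res_obj P j -> N},
                       forall x, f x = g (res_diff P j x)
  end.

End Ext.

(** [Ext^i(M, N) = 0], that is, [H^i(Hom(P, N)) = 0] for a projective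
    resolution [P] of [M]; the choice of [P] is immaterial. *)
Definition Ext_eq0 (i : nat) (M N : lmodType R) : Prop :=
  exists P : proj_resolution M,
    forall f : {linear res_obj P i -> N}, cocycle f -> coboundary f.

Definition semidualizing (C : lmodType R) : Prop :=
  [/\ fin_gen C,
      lmod_iso (Hom C C) R^o
    & forall i : nat, (1 <= i)%N -> Ext_eq0 i C C].

(** The members of [S0] are isomorphism classes of modules.  It is a bare
    predicate because [set] lives in too small a universe to hold a collection
    of [lmodType]s. *)
Definition S0 (K : lmodType R -> Prop) : Prop :=
  exists2 C, semidualizing C & K = lmod_iso C.

End Modules.

Definition has_card (T : Type) (A : T -> Prop) (n : nat) : Prop :=
  exists2 e : 'I_n -> T, injective e & forall x, A x <-> exists i, e i = x.

Definition ideal_gen (R : comNzRingType) (S : set R) : set R :=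
  [set x | exists (n : nat) (a g : 'I_n -> R),
     (forall i, S (g i)) /\ x = \sum_i a i * g i]%classic.

(** A set of positions [Y : {set 'I_m * 'I_n}] stands for the set of variables
    [X_ij], [(i, j) \in Y], of an [m] by [n] matrix of indeterminates. *)
Section Ladders.
Variables m n : nat.
Implicit Types Y Z : {set 'I_m * 'I_n}.

Definition ladder_closed Y : Prop :=
  forall (i p : 'I_m) (j q : 'I_n),
    (i, j) \in Y -> (p, q) \in Y -> (i <= p)%N -> (j <= q)%N ->
    (i, q) \in Y /\ (p, j) \in Y.

Definition minor_cells (i p : 'I_m) (j q : 'I_n) : {set 'I_m * 'I_n} :=
  [set (i, j); (i, q); (p, j); (p, q)].

Definition minor_in Y (i p : 'I_m) (j q : 'I_n) : Prop :=
  [/\ (i < p)%N, (j < q)%N & minor_cells i p j q \subset Y].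

Definition spanning Y : Prop :=
  (forall i, exists j, (i, j) \in Y) /\ (forall j, exists i, (i, j) \in Y).

Definition minor_covered Y : Prop :=
  forall x, x \in Y ->
    exists i p j q, minor_in Y i p j q /\ x \in minor_cells i p j q.

Definition two_connected Y : Prop :=
  ~ exists Z1 Z2,
      [/\ Z1 != finset.set0, Z2 != finset.set0, ladder_closed Z1 & ladder_closed Z2] /\
      [/\ [disjoint Z1 & Z2], Z1 :|: Z2 = Y
        & forall i p j q, minor_in Y i p j q ->
            minor_in Z1 i p j q \/ minor_in Z2 i p j q].

End Ladders.

(** A position set together with the dimensions of its ambient matrix. *)
Record grid := Grid {
  nrows : nat;
  ncols : nat;
  cells :> {set 'I_nrows * 'I_ncols}
}.

Definition is_ladder (Y : grid) : Prop :=
  [/\ ladder_closed Y, spanning Y, minor_covered Y & two_connected Y].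

Section LadderRing.
Variables (k : fieldType) (Y : grid).

(** [k[Y]] has one indeterminate ['X_a] per cell [enum_val a] of [Y].  The sum
    has one term if [x] is a cell of [Y]; otherwise it is [0], a junk value. *)
Definition ladder_var (x : 'I_(nrows Y) * 'I_(ncols Y)) : {mpoly k[#|Y|]} :=
  \sum_(a : 'I_#|Y| | enum_val a == x) 'X_a.

Definition minors2 : set {mpoly k[#|Y|]} :=
  [set f | exists i p j q, minor_in Y i p j q /\
     f = ladder_var (i, j) * ladder_var (p, q)
         - ladder_var (i, q) * ladder_var (p, j)]%classic.

Definition I2 : {pred {mpoly k[#|Y|]}} := fun f => `[< ideal_gen minors2 f >].

Lemma I2_idealr : idealr_closed I2.
Proof.
have var0 x : (ladder_var x).@[fun=> 0] = 0.
  by rewrite /ladder_var raddf_sum big1 // => a _; rewrite /= mevalXU.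
split.
- apply/asboolP; exists 0%N, (fun=> 0), (fun=> 0).
  by split=> [[]|] //; rewrite big_ord0.
- apply/asboolP => -[r [a [g [gS /(congr1 (meval (fun=> 0)))]]]].
  rewrite rmorph1 raddf_sum big1 => [/eqP|i _]; first by rewrite oner_eq0.
  have [i' [p [j [q [_ ->]]]]] := gS i.
  by rewrite /= mevalM mevalB !mevalM !var0 !mulr0 subr0 mulr0.
- move=> c u v /asboolP[r [a [g [gS ->]]]] /asboolP[s [b [h [hS ->]]]].
  apply/asboolP; exists (r + s)%N.
  exists (fun l => match fintype.split l with inl x => c * a x | inr y => b y end).
  exists (fun l => match fintype.split l with inl x => g x | inr y => h y end).
  split=> [l|]; first by case: fintype.split.
  rewrite big_split_ord /= mulr_sumr; congr (_ + _); apply: eq_bigr => x _.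
    by rewrite (unsplitK (inl x)) mulrA.
  by rewrite (unsplitK (inr x)).
Qed.

HB.instance Definition _ := isIdealr.Build _ I2 I2_idealr.

Definition R2 : comNzRingType := {ideal_quot I2}.

End LadderRing.

(* Main.v *)
(**
  The ladder of parameters [N] and [M] is a staircase of [N] blocks of size 2x3
  followed by [M + 1] blocks of size 2x2, consecutive blocks sharing a corner.
  Its ring [R] embeds into a polynomial ring [P] as the span of the monomials
  satisfying some linear inequalities, because the two rows of each block are
  proportional.  Over the polynomial subring [S] generated by the corners and by
  the differences along the diagonals of the blocks, [R] is a tower of free
  extensions, one per block, each with an explicit dual basis.  For a set [J] of
  2x3 blocks, coinducing at the blocks in [J] and inducing at the others gives a
  semidualizing module [C_J] inside [P]; the 2x2 blocks contribute nothing as they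
  are self-dual, and [C_J] is the canonical module when [J] contains all blocks.

  Conversely let [C] be semidualizing.  The Ext conditions make [C] reflexive of
  rank one and the parameters of [S] a regular sequence on [C], so [C] is isomorphic
  to a monomial fractional ideal [I], and every minimal generator [w^e] (with
  [e] a set of 2x3 blocks) of the canonical module is a product of a generator [g e]
  of [I] and a monomial [h] such that [h I] lies in the canonical module.  Comparing
  exponents, [g e = g 0 w^(e cap J)] for some set [J], and [I = g 0 C_J].
  Since the [C_J] are pairwise non-isomorphic there are [2^N] classes, whatever [M].
*)
From HB Require Import structures.
From mathcomp Require Import all_boot all_order all_algebra.
From mathcomp Require Import boolp classical_sets cardinality.
From mathcomp Require Import mpoly ring zify.
Require Import Defs.

Set Implicit Arguments.
Unset Strict Implicit.
Unset Printing Implicit Defensive.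

Import Order.TTheory GRing.Theory Num.Theory.
Local Open Scope ring_scope.

(** * Unique factorization *)

(** [R2] is not local, and neither quotient modules nor localizations are ever formed. A statement
    about [C] modulo the first [j] parameters becomes membership in [pspan]; a prime ideal is a
    predicate on [R]; the local ring at the origin is replaced by constant terms, denominators being
    cleared by a determinant of constant term 1. The passage to monomials relies on [P] being
    factorial: a gcd normalizes the embedding of [C], and complete integral closedness turns a
    multiplier of the dual of [C] into an element of [P], then of [R]. In a staircase of blocks
    sharing only corners each 2-minor lies in one block, which decouples the relations. A 2x3 block
    is the least non-Gorenstein one: its canonical module has the two generators 1 and [w i], and
    inducing or coinducing there is a binary choice. A 2x2 block is Gorenstein, so appending more of
    them gives new ladders without new classes; having at least one keeps a minor in the ladder when
    [N = 0]. *)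

Section Divisibility.
Variable D : comNzRingType.
Implicit Types a b c p u : D.

Definition divs a b := exists c, b = c * a.

Lemma divs_refl a : divs a a. Proof. by exists 1; rewrite mul1r. Qed.
Lemma divs_mull a b c : divs a b -> divs a (c * b).
Proof. by case=> d ->; exists (c * d); rewrite mulrA. Qed.
Lemma divs_mulr a b c : divs a b -> divs a (b * c).
Proof. by rewrite mulrC; apply: divs_mull. Qed.
Lemma divs_trans b a c : divs a b -> divs b c -> divs a c.
Proof. by move=> [x ->] [y ->]; exists (y * x); rewrite mulrA. Qed.
Lemma divs_add a b c : divs a b -> divs a c -> divs a (b + c).
Proof. by move=> [x ->] [y ->]; exists (x + y); rewrite mulrDl. Qed.

Definition prime_elt p :=
  [/\ p != 0, ~ divs p 1 &
      forall a b, divs p (a * b) -> divs p a \/ divs p b].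

(** Factors are primes rather than irreducibles: in a domain the existence of such factorizations
    entails their uniqueness, so it can define factoriality. *)
Inductive factorizes : D -> Prop :=
| Factorizes_unit u : divs u 1 -> factorizes u
| Factorizes_mul p a : prime_elt p -> factorizes a -> factorizes (p * a).

Definition factorial_ring := forall a, a != 0 -> factorizes a.

Lemma factorizesM a b : factorizes a -> factorizes b -> factorizes (a * b).
Proof.
move=> fa fb; elim: fa => [u [v uv]|p c pp _ IH]; last first.
  by rewrite -mulrA; apply: Factorizes_mul.
elim: fb => [w [x wx]|p c pp _ IH].
  by apply: Factorizes_unit; exists (x * v); rewrite {1}uv {1}(mulrC u) mulrACA -wx mul1r.
by rewrite mulrCA; apply: Factorizes_mul.
Qed.

End Divisibility.

Lemma divs_cancel (D : idomainType) (p a b : D) : p != 0 -> divs (p * a) (p * b) -> divs a b.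
Proof.
by move=> p0 [c]; rewrite mulrCA => /(mulfI p0) ->; exists c.
Qed.

Section Factorial.
Variable D : idomainType.
Hypothesis fD : factorial_ring D.
Implicit Types a b c p u : D.

(** Peel the primes off [b]: each divides [a * h i] for some [h i] that it does not divide, hence
    divides [a] and cancels. *)
Lemma coprime_family_divs (I : Type) (h : I -> D) :
  (forall p, prime_elt p -> exists i, ~ divs p (h i)) ->
  forall a b, b != 0 -> (forall i, divs b (a * h i)) -> divs b a.
Proof.
move=> Ph a b b0; move: (fD b0) a => {b0}; elim=> {b} [u [v uv] a _|p b pp _ IH a ab].
  by exists (a * v); rewrite -mulrA -uv mulr1.
have [i Ni] := Ph _ pp; case: (pp) => p0 _ pP.
have pa : divs p (a * h i) by apply: divs_trans (ab i); exists b; rewrite mulrC.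
case: (pP _ _ pa) => // -[a' e].
have [|c ec] := IH a'.
  by move=> j; apply: (divs_cancel p0); rewrite mulrA [p * a']mulrC -e.
by exists c; rewrite e ec -mulrA [b * p]mulrC.
Qed.

(** A gcd of a family, finite or not, found by stripping common primes; only the primes of the
    nonzero member [g i0] can occur. The last clause is coprimality of the cofactors in the form
    used later. *)
Lemma gcd_family (I : Type) (g : I -> D) i0 : g i0 != 0 ->
  exists d (h : I -> D), [/\ d != 0, forall i, g i = d * h i
   & forall a b, b != 0 -> (forall i, divs b (a * h i)) -> divs b a].
Proof.
move=> g0.
(* In [g i0 = x * y] the primes of [x] are still to be tried, and each prime of [y] is known to miss
   some member. *)
suff key x : factorizes x -> forall y (g : I -> D), g i0 = x * y -> g i0 != 0 ->
    (forall p, prime_elt p -> divs p y -> exists i, ~ divs p (g i)) ->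
    exists d (h : I -> D), [/\ d != 0, forall i, g i = d * h i
     & forall a b, b != 0 -> (forall i, divs b (a * h i)) -> divs b a].
  by apply: (key _ (fD g0) 1); rewrite ?mulr1 // => p [].
elim=> {x g g0} [u [v uv]|p x pp _ IH] y g e g0 Hy.
  exists 1, g; split=> [|i|a b]; rewrite ?oner_neq0 ?mul1r //.
  apply: coprime_family_divs => p pp; apply: contrapT => /forallNP N.
  have {}N i : divs p (g i) by apply: contrapT; apply: N.
  have [] := Hy _ pp; last by move=> i; case.
  rewrite -[y]mul1r uv -mulrA; apply: divs_mull; rewrite -e; exact: N.
have [p0 pu pP] := pp.
have [pg|/existsNP[i1 Npg]] := pselect (forall i, divs p (g i)).
  have [g' eg] := choice pg.
  have g'0 : g' i0 != 0 by apply: contra g0; rewrite eg => /eqP ->; rewrite mul0r.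
  have [|q qp qy|d [h [d0 e1 H]]] := IH y g' _ g'0.
  - by apply: (mulfI p0); rewrite mulrA -e eg mulrC.
  - have [i Ni] := Hy _ qp qy; exists i => qg; apply: Ni.
    by rewrite eg; apply: divs_mulr.
  exists (p * d), h; split=> //; first by rewrite mulf_neq0.
  by move=> i; rewrite eg e1; ring.
apply: (IH (p * y) g) => //; first by rewrite mulrA (mulrC x).
move=> q qp qpy; have [q0 qu qP] := qp.
have [[c ec]|] := qP _ _ qpy; last exact: Hy.
exists i1 => qg; apply: Npg; apply: divs_trans qg.
have [|[c' ec']|//] := pP c q; first by rewrite -ec; apply: divs_refl.
case: qu; exists c'; apply: (mulfI p0).
by rewrite mulr1 {1}ec ec' mulrAC mulrC.
Qed.

(** Gauss: in each factor take the least index whose coefficient is not a multiple of [p]; modulo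
    [p], the coefficient of the product at the sum of the two indices is the product of these two
    coefficients. *)
Lemma prime_polyC p : prime_elt p -> prime_elt (p%:P : {poly D}).
Proof.
move=> [p0 pu pP].
have divsP (f : {poly D}) : divs p%:P f <-> forall i, divs p f`_i.
  split=> [[c -> i]|H]; first by exists c`_i; rewrite coefMC.
  have [c ec] := choice H.
  exists (\poly_(i < size f) c i); apply/polyP=> i; rewrite coefMC coef_poly.
  by case: ltnP => // ?; rewrite mul0r nth_default.
split; first by rewrite polyC_eq0.
  by move/divsP/(_ 0%N); rewrite coef1.
move=> f g /divsP fg; apply: contrapT => /not_orP[/divsP/existsNP Nf /divsP/existsNP Ng].
have [i /asboolP Ni mi] : exists2 i, `[< ~ divs p f`_i >]
    & forall j, `[< ~ divs p f`_j >] -> (i <= j)%N.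
  have Nf' : exists i, `[< ~ divs p f`_i >] by case: Nf => i ?; exists i; apply/asboolP.
  by case: (ex_minnP Nf') => i ? ?; exists i.
have [j /asboolP Nj mj] : exists2 i, `[< ~ divs p g`_i >]
    & forall j, `[< ~ divs p g`_j >] -> (i <= j)%N.
  have Ng' : exists i, `[< ~ divs p g`_i >] by case: Ng => l ?; exists l; apply/asboolP.
  by case: (ex_minnP Ng') => l ? ?; exists l.
have ltf l : (l < i)%N -> divs p f`_l.
  by move=> li; apply: contrapT => N; have := mi l (asboolT N); rewrite leqNgt li.
have ltg l : (l < j)%N -> divs p g`_l.
  by move=> li; apply: contrapT => N; have := mj l (asboolT N); rewrite leqNgt li.
have := fg (i + j)%N; rewrite coefM.
have il : (i < (i + j).+1)%N by rewrite ltnS leq_addr.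
rewrite (bigD1 (Ordinal il)) //= addKn => -[c].
set s := \sum_(_ | _) _ => e.
have [c' ec'] : divs p s.
  apply: (big_ind (divs p)); first by exists 0; rewrite mul0r.
    exact: divs_add.
  move=> l; rewrite -val_eqE /= neq_ltn => /orP[li|li].
    by apply/divs_mulr/ltf.
  by apply/divs_mull/ltg; have := ltn_ord l; lia.
have : divs p (f`_i * g`_j).
  by exists (c - c'); rewrite mulrBl -ec' -e addrK.
by case/pP.
Qed.

Definition primitive_poly (f : {poly D}) := forall p, prime_elt p -> ~ divs p%:P f.

Lemma primitive_divs_cancel (f g : {poly D}) c : primitive_poly f -> c != 0 ->
  divs c%:P (f * g) -> divs c%:P g.
Proof.
move=> pf c0; elim: (fD c0) g => {c c0} [u [v uv] g _|p c pp _ IH g].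
  by exists (g * v%:P); rewrite -mulrA -polyCM -uv mulr1.
rewrite polyCM => pfg.
have : divs p%:P (f * g) by apply: divs_trans pfg; exists c%:P; rewrite mulrC.
have [p0 _ pP] := prime_polyC pp.
case/pP=> [/pf//|[g' e]].
have [|h eh] := IH g'; first by apply: (divs_cancel p0); rewrite mulrCA [p%:P * g']mulrC -e.
by exists h; rewrite e eh -mulrA; congr (_ * _); rewrite mulrC.
Qed.

(** Pseudo-division factors only a constant multiple of [f]. Each prime of the constant stays prime
    in [{poly D}], so it divides one of the factors and can be removed without changing degrees. *)
Lemma factor_unscale c (f d e : {poly D}) : c != 0 -> c%:P * f = d * e ->
  exists d' e', [/\ f = d' * e', size d' = size d & size e' = size e].
Proof.
move=> c0; elim: (fD c0) d e => {c c0} [u [v uv] d e E|p c pp _ IH d e].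
  have u0 : v != 0.
    by apply: contra (oner_neq0 D) => /eqP v0; rewrite uv v0 mul0r.
  exists (v%:P * d), e; split=> //; last by rewrite mul_polyC size_scale.
  by rewrite -mulrA -E mulrA -polyCM -uv mul1r.
have [p0 _ pP] := prime_polyC pp.
have sz (x : {poly D}) : size (x * p%:P) = size x.
  by rewrite mulrC mul_polyC size_scale //; case: pp.
rewrite polyCM -mulrA => E.
have : divs p%:P (d * e) by rewrite -E; apply/divs_mulr/divs_refl.
case/pP=> -[x ex].
  have [|d' [e' [E1 E2 E3]]] := IH x e.
    by apply: (mulfI p0); rewrite E ex; ring.
  by exists d', e'; rewrite ex sz E2 E3.
have [|d' [e' [E1 E2 E3]]] := IH d x.
  by apply: (mulfI p0); rewrite E ex; ring.
by exists d', e'; rewrite ex sz E2 E3.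
Qed.

End Factorial.

Section FactorialPoly.
Variable D : idomainType.
Hypothesis fD : factorial_ring D.

Lemma factorizes_polyC (a : D) : factorizes a -> factorizes (a%:P : {poly D}).
Proof.
elim=> [u [v uv]|p c pp _ IH]; last first.
  by rewrite polyCM; apply: Factorizes_mul => //; apply: prime_polyC.
by apply: Factorizes_unit; exists v%:P; rewrite -polyCM -uv.
Qed.

Lemma poly_content (f : {poly D}) : f != 0 ->
  exists d (h : {poly D}), [/\ d != 0, f = d%:P * h & primitive_poly h].
Proof.
move=> f0.
have l0 : f`_(size f).-1 != 0 by rewrite -[_`__]/(lead_coef f) lead_coef_eq0.
have [d [h [d0 eh H]]] := gcd_family fD (g := fun i => f`_i) l0.
exists d, (\poly_(i < size f) h i).
have hE i : (\poly_(i < size f) h i)`_i = h i.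
  rewrite coef_poly; case: ltnP => // si.
  by apply/esym/(mulfI d0); rewrite -eh mulr0 nth_default.
split=> //; first by apply/polyP=> i; rewrite coefCM hE eh.
move=> p [p0 pu _] [c e]; case: pu; apply: (H 1) => // i.
by rewrite mul1r -hE e coefMC; exists c`_i.
Qed.

(** Gauss's theorem by induction on the degree, without the fraction field: a primitive polynomial
    that does not split into smaller sizes is shown to be prime by means of the pseudo-gcd. *)
Lemma factorial_poly : factorial_ring {poly D}.
Proof.
move=> f; move: {2}(size f) (leqnn (size f)) => n; elim: n f => [|n IH] f.
  by rewrite leqn0 size_poly_eq0 => /eqP ->; rewrite eqxx.
move=> sf f0; have [d [h [d0 e ph]]] := poly_content f0.
rewrite e; apply: factorizesM; first exact/factorizes_polyC/fD.
have sh : (size h <= n.+1)%N by move: sf; rewrite e mul_polyC size_scale.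
have h0 : h != 0 by apply: contra f0 => /eqP h0; rewrite e h0 mulr0.
have [s1|s1] := leqP (size h) 1.
  move: (size1_polyC s1) h0 => ->; rewrite polyC_eq0 => c0.
  exact/factorizes_polyC/fD.
have [[a [b [eab sa sb]]]|irr] :=
    pselect (exists a b, [/\ h = a * b, (size a < size h)%N & (size b < size h)%N]).
  have [a0 b0] : a != 0 /\ b != 0 by apply/andP; rewrite -negb_or -mulf_eq0 -eab.
  by rewrite eab; apply: factorizesM; apply: IH => //; rewrite -ltnS; apply: leq_trans sh.
rewrite -[h]mulr1; apply: Factorizes_mul; last by apply: Factorizes_unit; exact: divs_refl.
split=> // [[c ec]|a b [q eq]].
  have c0 : c != 0 by apply: contra_eq_neq ec => ->; rewrite mul0r oner_neq0.
  have := size_poly1 D; rewrite ec size_mul //.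
  move: c0 s1; rewrite -size_poly_gt0; case: (size c) => // m _.
  move=> s1; rewrite addSn /= => es.
  by have := leq_trans s1 (leq_addl m _); rewrite es.
have ha : gcdp h a %| h by apply: dvdp_gcdl.
have [[c g] /= c0 E] := Pdiv.WeakIdomain.dvdpP _ _ ha.
rewrite -mul_polyC in E.
have [g' [h' [eh sg sh']]] := factor_unscale fD c0 E.
have [g'0 h'0] : g' != 0 /\ h' != 0 by apply/andP; rewrite -negb_or -mulf_eq0 -eh.
have szh := size_mul g'0 h'0; rewrite -eh in szh.
have [sg'|sg'] := ltnP (size g') (size h); last first.
  (* The cofactor of the gcd has full degree, so the gcd is constant and a Bezout relation makes [h]
     divide a constant multiple of [b]. *)
  have : size h' == 1%N by rewrite eqn_leq size_poly_gt0 h'0 andbT; lia.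
  rewrite sh' -coprimep_def => /Bezout_coprimepP[[u v] /= /eqpP[[c1 c2] /= /andP[c10 c20]]].
  rewrite alg_polyC => uv; right.
  have [|w ew] := @primitive_divs_cancel _ fD h (c1%:P * (u * b + v * q)) c2 ph c20.
    exists b; rewrite -uv -mul_polyC.
    transitivity (c1%:P * (u * b * h + v * (q * h))); first by ring.
    by rewrite -eq; ring.
  exists w; apply: (@mulfI _ c2%:P); rewrite ?polyC_eq0 // [RHS]mulrA [_ * w]mulrC -ew -uv -mul_polyC.

  transitivity (c1%:P * (u * b * h + v * (a * b))); first by ring.
  by rewrite eq; ring.
(* Irreducibility now forces the gcd to have full degree: [g] is constant, [h] divides a constant
   multiple of [a], and primitivity removes the constant. *)
left; have sg1 : (size g <= 1)%N.
  rewrite -sg leqNgt; apply/negP => sg1; apply: irr; exists g', h'; split=> //.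
  by move: szh sg1; lia.
have gE := size1_polyC sg1; set g0 := g`_0 in gE.
have g00 : g0 != 0 by rewrite -polyC_eq0 -gE -size_poly_gt0 -sg size_poly_gt0.
have [[c2 g2] /= c20 E2] := Pdiv.WeakIdomain.dvdpP _ _ (dvdp_gcdr h a).
rewrite -mul_polyC in E2.
have c20' : g0 * c2 != 0 by rewrite mulf_neq0.
have Ea : (g0 * c2)%:P * a = h * (g2 * c%:P).
  rewrite polyCM -mulrA E2 mulrCA -gE -E; ring.
have [|w ew] := @primitive_divs_cancel _ fD h (g2 * c%:P) (g0 * c2) ph c20'.
  by exists a; rewrite -Ea mulrC.
exists w; apply: (@mulfI _ (g0 * c2)%:P); rewrite ?polyC_eq0 // Ea ew; ring.
Qed.
End FactorialPoly.

Section FactorialPowers.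
Variable D : idomainType.
Hypothesis fD : factorial_ring D.
Implicit Types a h p z : D.

Lemma prime_divs_exp p a h n : prime_elt p -> ~ divs p a ->
  divs (p ^+ n) (a * h) -> divs (p ^+ n) h.
Proof.
move=> [p0 pu pP] pa; elim: n h => [|n IH] h; first by exists h; rewrite mulr1.
move=> H; have : divs p (a * h).
  by apply: divs_trans H; exists (p ^+ n); rewrite exprSr.
case/pP=> // -[h' e]; have [|c ec] := IH h'.
  apply: (divs_cancel p0); rewrite -exprS; move: H; rewrite e.
  by congr divs; ring.
by exists c; rewrite e ec exprSr mulrA.
Qed.

Lemma prime_divs_exp_bounded p h : prime_elt p -> h != 0 ->
  exists n, ~ divs (p ^+ n) h.
Proof.
move=> pp h0; elim: (fD h0) => {h h0} [u uu|q h pq _ [n Hn]].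
  by exists 1%N; rewrite expr1 => pu; have [_ + _] := pp; apply; exact: divs_trans pu uu.
exists n.+1 => H; have [p0 pu pP] := pp; have [q0 qu qP] := pq.
have [[c e]|pNq] := pselect (divs p q); last first.
  apply/Hn/(divs_trans _ (prime_divs_exp pp pNq H)).
  by exists p; rewrite exprS.
have [|[d ed]|[d ed]] := qP c p; first by rewrite -e; exact: divs_refl.
  case: pu; exists d; apply: (mulfI q0); rewrite mulr1 {1}e ed; ring.
have cu : divs c 1.
  by exists d; apply: (mulfI p0); rewrite mulr1 {1}ed e; ring.
have [d' ed'] := cu; apply: Hn.
have [x ex] : divs (p ^+ n) (c * h).
  by apply: (divs_cancel p0); rewrite -exprS; move: H; rewrite e; congr divs; ring.
by exists (d' * x); rewrite -mulrA -ex mulrA -ed' mul1r.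
Qed.

(** Complete integral closedness: [h] is a common denominator of all powers of [a / z]. A prime of
    [z] not dividing [a] would have all its powers dividing [h]. *)
Lemma divs_of_exp a h z : h != 0 -> z != 0 ->
  (forall n, divs (z ^+ n) (a ^+ n * h)) -> divs z a.
Proof.
move=> h0 z0; elim: (fD z0) a => {z z0} [u [v uv] a _|p z pp _ IH a H].
  by exists (a * v); rewrite -mulrA -uv mulr1.
have [p0 _ _] := pp.
have [[a' e]|pNa] := pselect (divs p a).
  have [n|c ec] := IH a'; last by exists c; rewrite e ec; ring.
  apply: (@divs_cancel _ (p ^+ n)); first by rewrite expf_neq0.
  by have := H n; rewrite e !exprMn; congr divs; ring.
have [n []] := prime_divs_exp_bounded pp h0.
have {H} : divs (p ^+ n) (a ^+ n * h).
  by apply: divs_trans (H n); exists (z ^+ n); rewrite exprMn mulrC.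
move: {2}n => m; elim: m => [|m IHm]; first by rewrite mul1r.
rewrite exprS -mulrA => H; apply: IHm.
exact: prime_divs_exp H.
Qed.

End FactorialPowers.

Lemma factorial_ring_iso (D E : idomainType) (f : {rmorphism D -> E}) :
  bijective f -> factorial_ring D -> factorial_ring E.
Proof.
move=> bf fD; have [g gK fK] := bf.
have fdivs a b : divs (f a) (f b) <-> divs a b.
  split=> [[c]|[c ->]]; last by exists (f c); rewrite rmorphM.
  by rewrite -[c]fK -rmorphM => /(can_inj gK) ->; exists (g c).
have finj := can_inj gK.
move=> a a0; rewrite -[a]fK.
have : g a != 0 by apply: contra a0 => /eqP e; rewrite -[a]fK e rmorph0.
move/fD; elim=> [u uu|p b [p0 pu pP] _ IH].
  by apply: Factorizes_unit; rewrite -(rmorph1 f) fdivs.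
rewrite rmorphM; apply: Factorizes_mul => //; split.
- by rewrite -(rmorph0 f) (inj_eq finj).
- by rewrite -(rmorph1 f) fdivs.
move=> x y; rewrite -[x]fK -[y]fK -rmorphM !fdivs; exact: pP.
Qed.

(** * Polynomial rings in several variables, one variable at a time *)

Section MpolyUni.
Variables (R : comNzRingType) (n : nat).

Definition of_uni (p : {poly {mpoly R[n]}}) : {mpoly R[n.+1]} :=
  (map_poly (@mwiden n R) p).['X_ord_max].

Lemma of_uni_is_additive : additive of_uni.
Proof. by move=> p q; rewrite /of_uni rmorphB hornerD hornerN. Qed.
Lemma of_uni_is_multiplicative : multiplicative of_uni.
Proof.
by split=> [p q|]; rewrite /of_uni ?rmorphM ?hornerM // rmorph1 hornerC.
Qed.
HB.instance Definition _ := GRing.isAdditive.Build _ _ of_uni of_uni_is_additive.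
HB.instance Definition _ :=
  GRing.isMultiplicative.Build _ _ of_uni of_uni_is_multiplicative.

Lemma of_uniC p : of_uni p%:P = mwiden p.
Proof. by rewrite /of_uni map_polyC hornerC. Qed.
Lemma of_uniX : of_uni 'X = 'X_ord_max.
Proof. by rewrite /of_uni map_polyX hornerX. Qed.

End MpolyUni.

Lemma mpoly_rmorph_eq (R : comNzRingType) n (S : comNzRingType)
    (f g : {rmorphism {mpoly R[n]} -> S}) :
  (forall c, f c%:MP = g c%:MP) -> (forall i, f 'X_i = g 'X_i) -> f =1 g.
Proof.
move=> HC HX p; elim/mpolyind: p => [|c m p _ _ IH]; first by rewrite !rmorph0.
rewrite !rmorphD IH /= -mul_mpolyC !rmorphM HC mpolyXE_id !rmorph_prod.
by congr (_ * _ + _); apply: eq_bigr => i _; rewrite !rmorphXn HX.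
Qed.

Lemma muniX (R : comNzRingType) n (i : 'I_n.+1) :
  muni ('X_i : {mpoly R[n.+1]}) =
  if unlift ord_max i is Some j then ('X_j)%:P else 'X.
Proof.
rewrite muniE msuppX big_seq1 mcoeffX eqxx scale1r.
case: unliftP => [j ->|->]; last first.
  rewrite mnm1E eqxx; suff -> : [multinom (U_(ord_max) (widen_ord (leqnSn n) j0))%MM | j0 < n] = 0%MM.
    by rewrite mpolyX0 scale1r.
  by apply/mnmP=> j; rewrite mnmE mnm1E mnm0E -val_eqE /= gtn_eqF.
rewrite mnm1E [_ == ord_max]eq_sym (negbTE (neq_lift _ _)) expr0.
rewrite -mul_polyC mulr1; congr (_%:P); congr ('X_[_]); apply/mnmP=> l.
by rewrite mnmE !mnm1E -!val_eqE /= /bump leqNgt ltn_ord.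
Qed.

Lemma mwidenXi (R : comNzRingType) n (i : 'I_n) :
  mwiden ('X_i : {mpoly R[n]}) = 'X_(widen_ord (leqnSn n) i).
Proof. by rewrite mwidenX mnmwiden1. Qed.

Lemma muniK (R : comNzRingType) n : cancel (@muni n R) (@of_uni R n).
Proof.
move=> p; apply: (@mpoly_rmorph_eq R _ _ (@of_uni R n \o @muni n R) idfun) => [c|i] /=.
  by rewrite muniC of_uniC mwidenC.
rewrite muniX; case: unliftP => [j ->|->]; last exact: of_uniX.
rewrite of_uniC mwidenXi; congr 'X__; apply/val_inj => /=.
by rewrite /bump leqNgt ltn_ord.
Qed.

Lemma of_uniK (R : comNzRingType) n : cancel (@of_uni R n) (@muni n R).
Proof.
have muniw q : muni (mwiden q) = q%:P :> {poly {mpoly R[n]}}.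
  apply: (@mpoly_rmorph_eq R _ _ (@muni n R \o @mwiden n R) polyC) => [c|i] /=.
    by rewrite mwidenC muniC.
  rewrite mwidenXi muniX; case: unliftP => [j|] /(congr1 val) /=.
    by rewrite /bump leqNgt ltn_ord => /val_inj ->.
  by move=> e; have := ltn_ord i; rewrite e ltnn.
elim/poly_ind=> [|p c IH]; first by rewrite !rmorph0.
by rewrite !rmorphD !rmorphM /= IH of_uniC of_uniX muniw muniX unlift_none.
Qed.

Lemma factorial_field (k : fieldType) : factorial_ring k.
Proof. by move=> a a0; apply: Factorizes_unit; exists a^-1; rewrite mulVf. Qed.

Lemma mpoly0C (R : comNzRingType) (p : {mpoly R[0]}) : p = (p@_0%MM)%:MP.
Proof.
apply/mpolyP=> m; suff -> : m = 0%MM by rewrite mcoeffC eqxx mulr1.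
by apply/mnmP; case.
Qed.

Lemma factorial_mpoly (k : fieldType) n : factorial_ring {mpoly k[n]}.
Proof.
elim: n => [|n IH].
  apply: (@factorial_ring_iso k _ (@mpolyC 0 k)); last exact: factorial_field.
  exists (mcoeff 0%MM) => p; first by rewrite mcoeffC eqxx mulr1.
  by rewrite [RHS]mpoly0C.
apply: (factorial_ring_iso _ (factorial_poly IH)).
by exists (@muni n k); [exact: of_uniK|exact: muniK].
Qed.

(** * Noetherian modules *)

Lemma choice_on (T U : Type) (P : T -> Prop) (Q : T -> U -> Prop) (u0 : U) :
  (forall x, P x -> exists y, Q x y) -> exists f, forall x, P x -> Q x (f x).
Proof.
move=> H; have [|f fP] := @choice _ _ (fun x y => P x -> Q x y); last by exists f.
by move=> x; have [/H[y ?]|nP] := pselect (P x); [exists y|exists u0].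
Qed.

Section Submodules.
Variables (R : comNzRingType) (M : lmodType R).
Implicit Types (A B : M -> Prop) (s t : seq M).

Definition submod A :=
  [/\ A 0, forall x y, A x -> A y -> A (x + y) & forall a x, A x -> A (a *: x)].

Lemma submodB A x y : submod A -> A x -> A y -> A (x - y).
Proof. by move=> [_ aD aZ] Ax Ay; rewrite -scaleN1r; apply/aD/aZ. Qed.

Lemma submod_sum A (I : Type) (r : seq I) (P : pred I) (F : I -> M) :
  submod A -> (forall i, P i -> A (F i)) -> A (\sum_(i <- r | P i) F i).
Proof. by move=> [a0 aD _] AF; apply: (big_ind A). Qed.

Definition span s x := forall B, submod B -> {in s, forall y, B y} -> B x.

Lemma span_submod s : submod (span s).
Proof.
split=> [B [] //|x y sx sy B sB Bs|a x sx B sB Bs]; case: (sB) => _ bD bZ.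
  by apply: bD; [exact: sx|exact: sy].
by apply: bZ; exact: sx.
Qed.

Lemma mem_span s x : x \in s -> span s x.
Proof. by move=> xs B _; apply. Qed.

Lemma span_trans s t x : {in s, forall y, span t y} -> span s x -> span t x.
Proof. by move=> st sx; apply: (sx (span t)) => //; apply: span_submod. Qed.

Lemma span_mono s t x : {subset s <= t} -> span s x -> span t x.
Proof. by move=> st; apply: span_trans => y /st; apply: mem_span. Qed.

Lemma spanE s x : span s x -> exists c : nat -> R, x = \sum_(i < size s) c i *: s`_i.
Proof.
move=> /(_ (fun x => exists c : nat -> R, x = \sum_(i < size s) c i *: s`_i)).
apply; last first.
  move=> y ys; exists (fun i => (i == index y s)%:R).
  have iy : (index y s < size s)%N by rewrite index_mem.
  rewrite (bigD1 (Ordinal iy)) //= eqxx scale1r nth_index // big1 ?addr0 // => i.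
  by rewrite -val_eqE /= => /negbTE ->; rewrite scale0r.
split=> [|x1 x2 [c1 ->] [c2 ->]|a y [c ->]].
- by exists (fun=> 0); rewrite big1 // => i _; rewrite scale0r.
- by exists (fun i => c1 i + c2 i); rewrite -big_split; apply: eq_bigr => i _; rewrite scalerDl.
- by exists (fun i => a * c i); rewrite scaler_sumr; apply: eq_bigr => i _; rewrite scalerA.
Qed.

Definition finitely_spanned A :=
  exists s, {in s, forall x, A x} /\ forall x, A x -> span s x.

Definition noetherian_module := forall A, submod A -> finitely_spanned A.

(** The spans of the initial segments increase, and a finite spanning set of their union already
    lies in one of them. *)
Lemma noetherian_chain : noetherian_module ->
  forall l : nat -> M, exists n, span (mkseq l n) (l n).
Proof.
move=> nM l; pose B x := exists n, span (mkseq l n) x.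
have mono m n x : (m <= n)%N -> span (mkseq l m) x -> span (mkseq l n) x.
  move=> mn; apply: span_mono => y /mapP[i]; rewrite mem_iota => im ->.
  by apply: map_f; rewrite mem_iota; lia.
have sB : submod B.
  split=> [|x y [m hm] [n hn]|a x [n hn]].
  - by exists 0%N; case: (span_submod (mkseq l 0)).
  - exists (m + n)%N; have [_ + _] := span_submod (mkseq l (m + n)); apply.
      by apply: mono hm; rewrite leq_addr.
    by apply: mono hn; rewrite leq_addl.
  - by exists n; have [_ _] := span_submod (mkseq l n); apply.
have [t [tB Bt]] := nM _ sB.
have [n hn] : exists n, {in t, forall x, span (mkseq l n) x}.
  elim: t tB {Bt} => [|x t IH] tB; first by exists 0%N.
  have [|n hn] := IH; first by move=> y yt; apply: tB; rewrite inE yt orbT.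
  have [m hm] := tB x (mem_head _ _).
  exists (m + n)%N => y; rewrite inE => /predU1P[->|yt].
    by apply: mono hm; rewrite leq_addr.
  by apply: (mono n) (hn _ yt); rewrite leq_addl.
exists n; apply: (span_trans hn); apply: Bt; exists n.+1; apply: mem_span.
by apply: map_f; rewrite mem_iota; lia.
Qed.

(** Dependent choice over the list of earlier terms, so that [Q] may refer to all of them. *)
Lemma not_finitely_spanned_chain A (Q : seq M -> M -> Prop) :
  (forall s, {in s, forall x, A x} -> exists2 x, A x & Q s x) ->
  exists l : nat -> M, forall n, A (l n) /\ Q (mkseq l n) (l n).
Proof.
move=> H.
have [|F FP] := @choice_on _ _ (fun s => {in s, forall x, A x}) (fun s y => A y /\ Q s y) 0.
  by move=> s /H[x Ax Qx]; exists x.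
pose fix L n := if n is n'.+1 then rcons (L n') (F (L n')) else [::].
have LE n : L n = mkseq (fun i => F (L i)) n.
  by elim: n => //= n IH; rewrite {1}IH mkseqS.
have AL n : {in L n, forall x, A x}.
  elim: n => //= n IH x; rewrite mem_rcons inE => /predU1P[->|]; last exact: IH.
  by case: (FP _ IH).
by exists (fun n => F (L n)) => n; rewrite -LE; apply: FP.
Qed.

End Submodules.

Definition noetherian (R : comNzRingType) := noetherian_module R^o.

Section Noetherian.

Lemma noetherian_field (k : fieldType) : noetherian k.
Proof.
move=> A [a0 _ aZ]; have [[x [Ax x0]]|N] := pselect (exists x, A x /\ x != 0).
  exists [:: x]; split=> [y|y Ay]; first by rewrite inE => /eqP ->.
  have [_ _ sZ] := span_submod [:: x].
  have -> : y = (y / x) *: x by rewrite /GRing.scale /= divfK.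
  by apply: sZ; apply: mem_span; rewrite inE.
exists [::]; split=> // y Ay; suff -> : y = 0 by case: (@span_submod k k^o [::]).
by apply/eqP; apply: contrapT => /negP y0; apply: N; exists y.
Qed.

Lemma noetherian_surj (R S : comNzRingType) (f : {rmorphism R -> S}) :
  (forall y, exists x, f x = y) -> noetherian R -> noetherian S.
Proof.
move=> fs nR A [a0 aD aZ].
have [|s [sA As]] := nR (fun x => A (f x)).
  split=> [|x y Ax Ay|b x Ax]; first by rewrite rmorph0.
    by rewrite rmorphD; apply: aD.
  by rewrite [b *: x]/(b * x) rmorphM; apply: aZ.
exists (map f s); split=> [y /mapP[x xs ->]|y Ay]; first exact: sA.
have [x ex] := fs y; rewrite -ex in Ay *.
apply: (As _ Ay (fun x => @span S S^o (map f s) (f x))); last first.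
  move=> z zs B sB; apply. exact: map_f zs.
have [s0 sD sZ] := @span_submod S S^o (map f s).
split=> [|u v su sv|b u su]; first by rewrite rmorph0.
  by rewrite rmorphD; apply: sD.
by rewrite [b *: u]/(b * u) rmorphM; apply: sZ.
Qed.

Lemma hilbert_basis (R : comNzRingType) : noetherian R -> noetherian {poly R}.
Proof.
move=> nR A sA; apply: contrapT => nA; have [a0 aD aZ] := sA.
have [s As|f fP] := @not_finitely_spanned_chain _ {poly R}^o A
   (fun s f => ~ span s f /\ forall g, A g -> ~ span s g -> (size (f : {poly R}) <= size (g : {poly R}))%N).
  have ex : exists n, `[< exists f : {poly R}, [/\ A f, ~ @span _ {poly R}^o s f & size f = n] >].
    apply: contrapT => N; apply: nA; exists s; split=> // f Af.
    by apply: contrapT => Nf; apply: N; exists (size f); apply/asboolP; exists f.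
  have [n /asboolP[f [Af Nf <-]] mn] := ex_minnP ex.
  exists f => //; split=> // g Ag Ng; apply: mn; apply/asboolP; by exists g.
have [n] := noetherian_chain nR (fun i => lead_coef (f i)).
move=> /spanE[c]; rewrite size_mkseq => ec.
have [Af [Nf mf]] := fP n.
have szf (i : 'I_n) : (size (f i : {poly R}) <= size (f n : {poly R}))%N.
  have [_ [_ mi]] := fP i; apply: mi => // si; apply: Nf; apply: span_mono si.
  by move=> y /mapP[j]; rewrite mem_iota => ji ->; apply: map_f; rewrite mem_iota; have := ltn_ord i; lia.
(* [h] lies in the span of the earlier terms and has the size and leading coefficient of [f n]; the
   difference contradicts the minimality of the size of [f n]. *)
pose h : {poly R} := \sum_(i < n) (c i *: 'X^(size (f n : {poly R}) - size (f i : {poly R}))) * f i.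
pose S := @span {poly R} {poly R}^o (mkseq f n).
have SS : submod S by exact: span_submod.
have [S0 SD SZ] := SS.
have hs : S h.
  apply: (@submod_sum {poly R} {poly R}^o) => // i _.
  by apply: SZ; apply: mem_span; apply/mapP; exists (i : nat) => //; rewrite mem_iota /=.
have fn0 : (f n : {poly R}) != 0.
  by apply/eqP => e; apply: Nf; rewrite e.
have Ah : A h.
  by apply: (@submod_sum {poly R} {poly R}^o) => // i _; apply: aZ; case: (fP i).
have szg : (size ((f n : {poly R}) - h)%R < size (f n : {poly R}))%N.
  rewrite [X in (_ < X)%N]polySpred // ltnS; apply/leq_sizeP => j.
  rewrite leq_eqVlt => /predU1P[<-|].
    rewrite coefB coef_sum -[(f n)`_ _]/(lead_coef (f n)) ec.
    apply/eqP; rewrite subr_eq0; apply/eqP/eq_bigr => i _.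
    rewrite -scalerAl coefZ coefXnM nth_mkseq // /GRing.scale /=; congr (_ * _).
    have [fi0|] := eqVneq (f i : {poly R}) 0.
      by rewrite fi0 lead_coef0 coef0 if_same.
    rewrite -size_poly_gt0 => fi0; have := szf i => szi.
    have aux a b : (0 < a)%N -> (a <= b)%N ->
      (b.-1 < b - a)%N = false /\ (b.-1 - (b - a))%N = a.-1 by lia.
    by have [-> ->] := aux _ _ fi0 szi.
  move=> ltj; rewrite coefB coef_sum nth_default ?sub0r; last first.
    by apply: leq_trans ltj; rewrite leqSpred.
  apply/eqP; rewrite oppr_eq0; apply/eqP/big1 => i _.
  rewrite -scalerAl coefZ coefXnM; case: ifP => //; first by rewrite mulr0.
  move=> _; rewrite nth_default ?mulr0 //.
  have aux : forall a b l : nat, (b.-1 < l)%N -> (a <= b)%N -> (a <= l - (b - a))%N by lia.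
  exact: aux ltj (szf i).
have : ~ S ((f n : {poly R}) - h).
  by move=> sg; apply: Nf; rewrite -[f n](subrK h); apply: SD.
by move/(mf _ (submodB sA Af Ah)); rewrite leqNgt szg.
Qed.

Lemma noetherian_mpoly (k : fieldType) n : noetherian {mpoly k[n]}.
Proof.
elim: n => [|n IH].
  apply: (@noetherian_surj k _ (@mpolyC 0 k)); last exact: noetherian_field.
  by move=> p; exists p@_0%MM; rewrite [RHS]mpoly0C.
pose f : {rmorphism {poly {mpoly k[n]}} -> {mpoly k[n.+1]}} := @of_uni k n.
have fs y : exists x, f x = y by exists (muni y); apply: muniK.
exact: noetherian_surj fs (hilbert_basis IH).
Qed.

(** Induction on the number of coordinates that may be nonzero: the values of the last one form an
    ideal, and the vectors where it vanishes fall under the induction hypothesis. *)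
Lemma noetherian_rV (R : comNzRingType) n : noetherian R ->
  noetherian_module 'rV[R]_n.
Proof.
move=> nR.
suff key j (A : 'rV[R]_n -> Prop) : submod A ->
    (forall v, A v -> forall i : 'I_n, (j <= i)%N -> v 0 i = 0) -> finitely_spanned A.
  by move=> A sA; apply: (key n A sA) => v _ i; rewrite leqNgt ltn_ord.
elim: j A => [|j IH] A sA Aj; have [a0 aD aZ] := sA.
  exists [::]; split=> // v Av; suff -> : v = 0 by case: (@span_submod R 'rV[R]_n [::]).
  by apply/rowP=> i; rewrite mxE (Aj v).
have [jn|nj] := ltnP j n; last first.
  by apply: IH => // v Av i ji; have := ltn_ord i; lia.
pose ij := Ordinal jn.
have [||s [sA2 As2]] := IH (fun v => A v /\ v 0 ij = 0).
- split=> [|x y [Ax ex] [Ay ey]|a x [Ax ex]]; rewrite !mxE //.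
    by rewrite ex ey addr0; split=> //; apply: aD.
  by rewrite ex mulr0; split=> //; apply: aZ.
- move=> v [Av e] i; rewrite leq_eqVlt => /predU1P[e'|]; last exact: Aj.
  by rewrite -e; congr (v 0 _); apply/val_inj.
have [|t [tA At]] := nR (fun x => exists2 v, A v & v 0 ij = x).
  split=> [|x y [v Av <-] [w Aw <-]|a x [v Av <-]].
  - by exists 0; rewrite ?mxE.
  - by exists (v + w); rewrite ?mxE //; apply: aD.
  - by exists (a *: v); rewrite ?mxE //; apply: aZ.
have [|F FP] := @choice_on _ _ (fun x => x \in t) (fun x (v : 'rV_n) => A v /\ v 0 ij = x) 0.
  by move=> x /tA[v Av e]; exists v.
pose s1 := map F t.
have As1 : {in s1, forall x, A x} by move=> _ /mapP[x /FP[] Ax _ ->].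
exists (s1 ++ s); split=> [x|v Av].
  by rewrite mem_cat => /orP[/As1//|/sA2[]].
have [w [sw Aw ew]] : exists w, [/\ span s1 w, A w & w 0 ij = v 0 ij].
  have : @span R R^o t (v 0 ij) by apply: At; exists v.
  move=> /(_ (fun x => exists w, [/\ span s1 w, A w & w 0 ij = x])); apply; last first.
    move=> x xt; have [AF eF] := FP _ xt; exists (F x); split=> //.
    by apply: mem_span; apply: map_f.
  have [s0 sD sZ] := @span_submod R 'rV[R]_n s1.
  split=> [|_ _ [w [sw Aw <-]] [u [su Au <-]]|a _ [w [sw Aw <-]]].
  - by exists 0; rewrite mxE.
  - by exists (w + u); rewrite mxE; split=> //; [apply: sD|apply: aD].
  - by exists (a *: w); rewrite mxE; split=> //; [apply: sZ|apply: aZ].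
have [_ sD _] := @span_submod R 'rV[R]_n (s1 ++ s).
rewrite -[v](subrK w); apply: sD.
  apply: (@span_mono _ _ s); first by move=> x xs; rewrite mem_cat xs orbT.
  by apply: As2; rewrite !mxE ew subrr; split=> //; apply: submodB.
by apply: span_mono sw => x xs; rewrite mem_cat xs.
Qed.

(** If the annihilator of [v] modulo [K] were not prime for any multiple of
    [v], splitting off factors would give a strictly increasing chain of
    annihilators. *)
Lemma exists_prime_annihilator (R : comNzRingType) (M : lmodType R)
    (K : M -> Prop) v : noetherian R -> submod K -> ~ K v ->
  exists r, ~ K (r *: v) /\
    forall a b, K ((a * b * r) *: v) -> K ((a * r) *: v) \/ K ((b * r) *: v).
Proof.
move=> nR [k0 kD kZ] nKv; apply: contrapT => N.
have {}N r : exists ab : R * R, ~ K (r *: v) -> [/\ K ((ab.1 * ab.2 * r) *: v),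
    ~ K ((ab.1 * r) *: v) & ~ K ((ab.2 * r) *: v)].
  have [Kr|nKr] := pselect (K (r *: v)); first by exists (0, 0).
  apply: contrapT => /forallNP H; apply: N; exists r; split=> // a b Kab.
  apply: contrapT => /not_orP[Ka Kb]; by apply: (H (a, b)).
have {N} [F FP] := choice N.
pose fix r n := if n is n'.+1 then (F (r n')).1 * r n' else 1.
have rK n : ~ K (r n *: v).
  by elim: n => [|n IH] /=; [rewrite scale1r|case: (FP _ IH)].
have [n] := noetherian_chain nR (fun i => (F (r i)).2).
move=> /spanE[c]; rewrite size_mkseq => ec.
have [_ _] := FP _ (rK n); apply; rewrite ec mulr_suml scaler_suml.
apply: (big_ind K) => // i _; rewrite nth_mkseq // /GRing.scale /= -/(GRing.scale _ _).
have [Ki _ _] := FP _ (rK i).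
have [x ->] : exists x, r n = x * ((F (r i)).1 * r i).
  have := ltn_ord i; elim: n {ec i Ki} (i : nat) => // n IH j; rewrite ltnS leq_eqVlt.
  case/predU1P=> [->|/IH[x e]]; first by exists 1; rewrite mul1r.
  by exists ((F (r n)).1 * x); rewrite -mulrA -e.
have -> : c i * (F (r i)).2 * (x * ((F (r i)).1 * r i)) =
   (c i * x) * ((F (r i)).1 * (F (r i)).2 * r i) by ring.
by rewrite -scalerA; apply: kZ.
Qed.

End Noetherian.

(** * Submodules and projective resolutions *)

Definition mk_linear (R : comNzRingType) (M N : lmodType R) (f : M -> N)
    (lf : linear f) : {linear M -> N} :=
  HB.pack f (GRing.isLinear.Build R M N *:%R f lf).

Section SubmoduleType.
Variables (R : comNzRingType) (M : lmodType R).

(** The closure proof is an argument of the predicate, so that the submodule structure can be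
    inferred from it. *)
Definition submodule_pred (A : M -> Prop) (sA : submod A) : {pred M} :=
  fun x => `[< A x >].

Variables (A : M -> Prop) (sA : submod A).

Lemma submodule_pred_closed : submod_closed (submodule_pred sA).
Proof.
case: (sA) => a0 aD aZ; split; first exact/asboolP.
by move=> a x y /asboolP Ax /asboolP Ay; apply/asboolP/aD => //; apply: aZ.
Qed.

HB.instance Definition _ :=
  GRing.isSubmodClosed.Build R M (submodule_pred sA) submodule_pred_closed.

Record submodule := Submodule
  { submodule_val : M; submodule_valP : submodule_val \in submodule_pred sA }.

HB.instance Definition _ := [isSub for submodule_val].
HB.instance Definition _ := [Choice of submodule by <:].
HB.instance Definition _ := [SubChoice_isSubLmodule of submodule by <:].

Definition to_submodule x (Ax : A x) : submodule := Submodule (asboolT Ax : x \in submodule_pred sA).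

Lemma submodule_prop (x : submodule) : A (val x).
Proof. exact/asboolP/(submodule_valP x). Qed.

Lemma submodule_val_linear : linear submodule_val.
Proof. by []. Qed.

End SubmoduleType.

(** [projective] speaks of surjections only; the codomain is first cut down to the image of [d]. *)
Lemma projective_lift (R : comNzRingType) (P A B : lmodType R)
    (d : {linear A -> B}) (f : {linear P -> B}) : projective P ->
  (forall x, exists y, d y = f x) -> exists h : {linear P -> A}, forall x, d (h x) = f x.
Proof.
move=> pP df; pose I y := exists x, d x = y.
have sI : submod I.
  split=> [|_ _ [x <-] [y <-]|a _ [x <-]]; first by exists 0; rewrite linear0.
    by exists (x + y); rewrite linearD.
  by exists (a *: x); rewrite linearZ.
have Id x : I (d x) by exists x.
have d'l : linear (fun x => to_submodule sI (Id x)).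
  by move=> a x y; apply: val_inj; rewrite /= linearP.
have f'l : linear (fun x => to_submodule sI (df x)).
  by move=> a x y; apply: val_inj; rewrite /= linearP.
have [|h hE] := pP _ _ (mk_linear d'l) (mk_linear f'l).
  by move=> y; have [x e] := submodule_prop y; exists x; apply: val_inj.
by exists h => x; have /(congr1 val) := hE x.
Qed.

Section Comparison.
Variables (R : comNzRingType) (M : lmodType R).
Implicit Types P Q : proj_resolution M.

Definition cycle_at P n : res_obj P n -> Prop :=
  match n with
  | 0 => fun x => res_aug P x = 0
  | m.+1 => fun x => res_diff P m x = 0
  end.

Lemma cycle_atP P n x : cycle_at x <-> exists y, res_diff P n y = x.
Proof. case: n x => [|n] x; [exact: res_exact0|exact: res_exact]. Qed.

Lemma res_diff_cycle P n x : cycle_at (res_diff P n x).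
Proof. by apply/cycle_atP; exists x. Qed.

Lemma cycle_lift P n (L : lmodType R) (f : {linear L -> res_obj P n}) :
  projective L -> (forall x, cycle_at (f x)) ->
  exists h : {linear L -> res_obj P n.+1}, forall x, res_diff P n (h x) = f x.
Proof. by move=> pL fc; apply: projective_lift => // x; apply/cycle_atP. Qed.

Definition chain_map P Q (a : forall n, {linear res_obj P n -> res_obj Q n}) :=
  (forall x, res_aug Q (a 0%N x) = res_aug P x) /\
  forall n x, res_diff Q n (a n.+1 x) = a n (res_diff P n x).

Lemma exists_chain_map P Q : exists a, @chain_map P Q a.
Proof.
pose T n := {a : {linear res_obj P n -> res_obj Q n} |
  forall x, cycle_at x -> cycle_at (a x)}.
have step n (a : T n) : exists b : T n.+1,
    forall x, res_diff Q n (sval b x) = sval a (res_diff P n x).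
  have [|b eb] := @cycle_lift Q n _ (sval a \o res_diff P n)%FUN (@res_projective R M P n.+1).
    by move=> x; apply: (svalP a); apply: res_diff_cycle.
  have bc x : cycle_at x -> cycle_at (b x).
    by move=> /= zx; rewrite eb /= zx linear0.
  by exists (exist _ b bc).
have [a0 ea0] : exists a : {linear res_obj P 0 -> res_obj Q 0},
    forall x, res_aug Q (a x) = res_aug P x.
  apply: projective_lift; first exact: res_projective.
  by move=> x; apply: res_aug_surj.
have a0c x : cycle_at x -> cycle_at (a0 x) by rewrite /= ea0.
pose fix a n : T n := if n is m.+1 then sval (cid (step m (a m))) else exist _ a0 a0c.
exists (fun n => sval (a n)); split=> // n x.
by rewrite /= (svalP (cid (step n (a n)))).
Qed.

(** A homotopy is recorded one degree at a time: its defect is a cycle, which lifts to the next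
    degree and which a cocycle kills. *)
Lemma null_homotopy P (c : forall n, {linear res_obj P n -> res_obj P n}) :
  (forall x, res_aug P (c 0%N x) = 0) ->
  (forall n x, res_diff P n (c n.+1 x) = c n (res_diff P n x)) ->
  forall n, exists s : {linear res_obj P n -> res_obj P n.+1},
    forall x, cycle_at (c n.+1 x - s (res_diff P n x)).
Proof.
move=> c0 cS; elim=> [|n [s es]].
  have [|s es] := @cycle_lift P 0 _ (c 0%N) (@res_projective R M P 0) => //.
  by exists s => x; rewrite /= linearB cS es subrr.
have [//|t et] := @cycle_lift P n.+1 _ (c n.+1 \- (s \o res_diff P n)%FUN) (@res_projective R M P n.+1).
exists t => x; rewrite /= linearB cS et /= [res_diff P n _](res_diff_cycle x) linear0.
by rewrite oppr0 addr0 subrr.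
Qed.

(** [Ext_eq0] may use a different resolution in each degree, whereas the arguments below run through
    all degrees of a single one. The comparison maps compose to the identity of [Q] up to
    homotopy. *)
Lemma ext_vanishing_transfer P Q (N : lmodType R) i :
  (forall f : {linear res_obj P i.+1 -> N}, cocycle f -> coboundary f) ->
  forall f : {linear res_obj Q i.+1 -> N}, cocycle f -> coboundary f.
Proof.
move=> HP f cf.
have [a [a0 aS]] := exists_chain_map Q P; have [b [b0 bS]] := exists_chain_map P Q.
have [|g eg] := HP (f \o b i.+1)%FUN; first by move=> x; rewrite /= -bS; exact: cf.
have [||s es] := @null_homotopy Q (fun n => idfun \- (b n \o a n)%FUN) _ _ i.
- by move=> x; rewrite /= linearB b0 a0 subrr.
- by move=> n x; rewrite /= linearB bS aS.
exists ((g \o a i)%FUN \+ (f \o s)%FUN) => x /=.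
have [y ey] := (cycle_atP _).1 (es x); rewrite /= in ey.
rewrite -aS -[g _]eg /=; apply/eqP; rewrite -subr_eq0 opprD addrA -!linearB -ey.
by apply/eqP; exact: cf.
Qed.

End Comparison.

(** * Regular sequences on semidualizing modules *)

(** Gaussian elimination over the residue field of the prime [p], without forming
    quotients. *)
Lemma relations_dichotomy (R : comNzRingType) (p : R -> Prop)
    (pD : forall x y, p x -> p y -> p (x + y)) (p0 : p 0) (p1 : ~ p 1)
    (pP : forall x y, p (x * y) -> p x \/ p y) n (U : (nat -> R) -> Prop)
    (U0 : U (fun=> 0)) (UD : forall u v, U u -> U v -> U (fun i => u i + v i))
    (UZ : forall a u, U u -> U (fun i => a * u i)) :
  (exists l : nat -> R, (exists2 i, (i < n)%N & ~ p (l i)) /\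
     forall u, U u -> p (\sum_(i < n) u i * l i)) \/
  (exists s, ~ p s /\ forall i, (i < n)%N ->
     exists2 u, U u & forall j, (j < n)%N -> u j = s * (j == i)%:R).
Proof.
elim: n U U0 UD UZ => [|n IH] U U0 UD UZ; first by right; exists 1.
have [pn|/existsNP[u0 /not_implyP[Uu0 pu0]]] := pselect (forall u, U u -> p (u n)).
  left; exists (fun i => (i == n)%:R); split; first by exists n; rewrite ?eqxx.
  move=> u /pn; rewrite big_ord_recr /= eqxx mulr1 big1 ?add0r // => i _.
  by rewrite ltn_eqF ?mulr0.
pose t := u0 n.
have [|||[l [[i li pli] Ul]]|[s [ps Us]]] := IH (fun u => U u /\ u n = 0).
- by split.
- by move=> u v [Uu un] [Uv vn]; rewrite un vn addr0; split=> //; apply: UD.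
- by move=> a u [Uu un]; rewrite un mulr0; split=> //; apply: UZ.
(* The functional found on the relations with vanishing last coordinate is scaled by the pivot [t];
   its last coefficient is chosen to kill the pivot relation [u0]. *)
- left; exists (fun i => if (i < n)%N then t * l i else - \sum_(j < n) u0 j * l j).
  split; first by exists i; rewrite ?li ?(leq_trans li) // => /pP[].
  move=> u Uu; rewrite big_ord_recr /= ltnn.
  have /Ul H : U (fun i => t * u i + (- u n) * u0 i) /\ t * u n + (- u n) * u0 n = 0.
    split; first by apply: (UD (fun i => t * u i)); apply: UZ.
    by rewrite /t; ring.
  move: H => /=; under eq_bigr do rewrite mulrDl -[- u n * _ * _]mulrA.
  rewrite big_split -mulr_sumr /= mulNr -mulrN; congr (p (_ + _)).
  by apply: eq_bigr => j _; rewrite ltn_ord; ring.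
right; exists (s * t); split; first by case/pP.
have [w wP] := @choice_on _ _ (fun i => (i < n)%N) (fun i u => [/\ U u, u n = 0 &
    forall j, (j < n)%N -> u j = s * (j == i)%:R]) (fun=> 0) 
    (fun i li => let: ex_intro2 u (conj a b) c := Us i li in ex_intro _ u (And3 a b c)).
move=> i; rewrite ltnS leq_eqVlt => /predU1P[->|li]; last first.
  have [Uw wn wj] := wP i li.
  exists (fun j => t * w i j); first exact: UZ.
  move=> j; rewrite ltnS leq_eqVlt => /predU1P[->|lj]; last by rewrite wj //; ring.
  by rewrite wn gtn_eqF // !mulr0.
(* The pivot relation, with its other coordinates cleared by the relations [w l]; its last
   coordinate is [s * t]. *)
exists (fun j => s * u0 j + (-1) * \sum_(l < n) u0 l * w l j).
  apply: (UD (fun j => s * u0 j)); first exact: UZ.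
  apply: (UZ _ (fun j => \sum_(l < n) u0 l * w l j)).
  have : forall l, (l < n)%N -> U (w l) by move=> l /wP[].
  elim: (n) => [|m IHm] Uw.
    by rewrite (_ : (fun=> _) = fun=> 0) //; apply/funext => j; rewrite big_ord0.
  rewrite (_ : (fun=> _) = fun j => \sum_(l < m) u0 l * w l j + u0 m * w m j); last first.
    by apply/funext => j; rewrite big_ord_recr.
  apply: UD; last by apply/UZ/Uw.
  by apply: IHm => l lm; apply/Uw/ltnW.
move=> j; rewrite ltnS leq_eqVlt => /predU1P[->|lj].
  rewrite eqxx mulr1 big1 ?mulr0 ?addr0 // => l _.
  by have [_ -> _] := wP _ (ltn_ord l); rewrite mulr0.
rewrite (bigD1 (Ordinal lj)) //= big1 ?addr0.
  have [_ _ wj] := wP _ lj; rewrite /= wj // eqxx (ltn_eqF lj) mulr0 mulr1; ring.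
move=> l; rewrite -val_eqE /= eq_sym => /negbTE e.
by have [_ _ ->] := wP _ (ltn_ord l); rewrite // e !mulr0.
Qed.

Section PartialSpan.
Variables (R : comNzRingType) (z : nat -> R).

Definition pspan j (M : lmodType R) (x : M) : Prop :=
  exists h : nat -> M, x = \sum_(i < j) z i *: h i.

Lemma pspan_submod j (M : lmodType R) : submod (@pspan j M).
Proof.
split=> [|_ _ [h ->] [g ->]|a _ [h ->]].
- by exists (fun=> 0); rewrite big1 // => i _; rewrite scaler0.
- exists (fun i => h i + g i); rewrite -big_split; apply: eq_bigr => i _.
  by rewrite scalerDr.
- exists (fun i => a *: h i); rewrite scaler_sumr; apply: eq_bigr => i _.
  by rewrite !scalerA mulrC.
Qed.

Lemma pspan0 (M : lmodType R) (x : M) : pspan 0 x <-> x = 0.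
Proof.
by split=> [[h ->]|->]; [rewrite big_ord0|exists (fun=> 0); rewrite big_ord0].
Qed.

Lemma pspanS j (M : lmodType R) (x : M) :
  pspan j.+1 x <-> exists y, pspan j (x - z j *: y).
Proof.
split=> [[h ->]|[y [h e]]].
  by exists (h j); exists h; rewrite big_ord_recr /= addrK.
exists (fun i => if (i < j)%N then h i else y); rewrite big_ord_recr /= ltnn.
rewrite -[LHS](subrK (z j *: y)) e; congr (_ + _).
by apply: eq_bigr => i _; rewrite ltn_ord.
Qed.

Lemma pspan_scale j (M : lmodType R) (a : R) (x : M) :
  pspan j (a : R^o) -> pspan j (a *: x).
Proof.
move=> [h ->]; exists (fun i => (h i : R) *: x); rewrite scaler_suml.
by apply: eq_bigr => i _; rewrite scalerA.
Qed.

(** Lift [f] along the map [h |-> \sum_i z i *: h i] from a power of [M]; [g] is the last component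
    of the lift. *)
Lemma projective_lift_pspan j (M P : lmodType R) (f : {linear P -> M}) :
  projective P -> (forall x, pspan j.+1 (f x)) ->
  exists g : {linear P -> M}, forall x, pspan j (f x - z j *: g x).
Proof.
move=> pP fK.
have dl : linear (fun h : {ffun 'I_j.+1 -> M} => \sum_(i < j.+1) z i *: h i).
  move=> a u v; rewrite scaler_sumr -big_split; apply: eq_bigr => i _.
  by rewrite !ffunE scalerDr !scalerA mulrC.
have [|h eh] := projective_lift (d := mk_linear dl) (f := f) pP.
  move=> x; have [h e] := fK x; exists [ffun i : 'I_j.+1 => h i] => /=.
  by rewrite e; apply: eq_bigr => i _; rewrite ffunE.
have gl : linear (fun x => h x ord_max).
  by move=> a x y; rewrite linearP !ffunE.
exists (mk_linear gl) => x /=; rewrite -eh /= big_ord_recr /= addrK.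
exists (fun i => h x (inord i)); apply: eq_bigr => i _.
congr (_ *: h x _); apply/val_inj; rewrite /= inordK //.
by rewrite ltnS ltnW.
Qed.

End PartialSpan.

Section Semidualizing.
Variables (R : comNzRingType) (C : lmodType R) (P : proj_resolution C).
Variables (z : nat -> R).
Hypothesis nR : noetherian R.
Hypothesis fgC : fin_gen C.
Hypothesis endC : forall h : {linear C -> C}, exists a, forall c, h c = a *: c.
Hypothesis faithC : forall a : R, (forall c : C, a *: c = 0) -> a = 0.
Hypothesis extC : forall i (f : {linear res_obj P i.+1 -> C}), cocycle f -> coboundary f.

Local Notation K j := (@pspan R z j C).
Local Notation KR j := (@pspan R z j R^o).
Local Notation d := (res_diff P).

(** The exact sequences [0 -> C/K_j -> C/K_j -> C/K_(j+1) -> 0], given by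
    multiplication by [z j], propagate these properties of the pair
    [(C, C/K_j)]; quotients are avoided by computing modulo [K_j]. *)
Record reduces j : Prop := Reduces {
  reduces_ext : forall i (f : {linear res_obj P i.+1 -> C}),
    (forall x, K j (f (d i.+1 x))) ->
    exists g : {linear res_obj P i -> C}, forall x, K j (f x - g (d i x));
  reduces_hom : forall f : {linear res_obj P 0 -> C},
    (forall x, K j (f (d 0 x))) -> exists a : R, forall x, K j (f x - a *: res_aug P x);
  reduces_faithful : forall a : R, (forall c, K j (a *: c)) -> KR j a
}.

Lemma reduces0 : reduces 0.
Proof.
split.
- move=> i f H; have [|g eg] := extC (f := f).
    by move=> x; have /pspan0 := H x.
  by exists g => x; apply/pspan0; rewrite eg subrr.
- move=> f H.
  have fP x y : res_aug P x = res_aug P y -> f x = f y.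
    move=> /eqP; rewrite -subr_eq0 -linearB => /eqP /res_exact0[w ew].
    by apply/eqP; rewrite -subr_eq0 -linearB -ew; apply/eqP/pspan0.
  have [s es] := choice (fun c => @res_aug_surj _ _ P c).
  have hl : linear (fun c => f (s c)).
    by move=> a x y; rewrite -linearP; apply: fP; rewrite linearP !es.
  have [a ea] := endC (mk_linear hl); exists a => x; apply/pspan0.
  by rewrite -[a *: _]ea /= (fP (s (res_aug P x)) x) ?subrr.
- by move=> a H; apply/pspan0/faithC => c; apply/pspan0/H.
Qed.

(** Zero divisors on [C / K_j] are thereby zero divisors on [R / K_j]. Let [p] be a prime
    annihilator, modulo [K j], of a multiple [w] of [v]. Faithfulness and finite generation give a
    functional [l] on [C] that is nonzero modulo [p]; then [c |-> l(c) w] is a homomorphism from [C]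
    to [C / K_j], hence multiplication by some [a], and what kills [v] kills [a]. *)
Lemma pspan_associated j v : reduces j -> ~ K j v ->
  exists a : R, ~ KR j a /\ forall b : R, K j (b *: v) -> KR j (b * a : R).
Proof.
move=> [_ Hhom Hfaith] nKv; have sK := pspan_submod z j C; have [K0 KD KZ] := sK.
have [r [nKr prime_r]] := exists_prime_annihilator nR sK nKv.
pose w := r *: v; pose p (a : R) := K j (a *: w).
have [n [g gen]] := fgC.
pose g' i := if insub i is Some i' then g i' else 0.
have g'E (i : 'I_n) : g' i = g i by rewrite /g' valK.
pose U (u : nat -> R) := \sum_(i < n) u i *: g i = 0.
have [|||||||[l [[i0 i0n pl] Ul]]|[s [ps Us]]] := @relations_dichotomy R p _ _ _ _ n U.
- by move=> x y px py; rewrite /p scalerDl; apply: KD.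
- by rewrite /p scale0r.
- by rewrite /p scale1r.
- by move=> x y; rewrite /p /w !scalerA => /prime_r.
- by rewrite /U big1 // => i _; rewrite scale0r.
- move=> u1 u2; rewrite /U => e1 e2; under eq_bigr do rewrite scalerDl.
  by rewrite big_split /= e1 e2 addr0.
- move=> a u; rewrite /U => e; under eq_bigr do rewrite -scalerA.
  by rewrite -scaler_sumr e scaler0.
- have dl : linear (fun u : 'rV[R]_n => \sum_i u 0 i *: g i).
    move=> a u1 u2; rewrite scaler_sumr -big_split; apply: eq_bigr => i _.
    by rewrite !mxE scalerDl scalerA.
  have [|rho erho] := projective_lift (d := mk_linear dl) (f := res_aug P) (@res_projective _ _ P 0).
    move=> x; have [a ea] := gen (res_aug P x); exists (\row_i a i).
    by rewrite /= ea; apply: eq_bigr => i _; rewrite mxE.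
  rewrite /= in erho.
  have fl : linear (fun x => (\sum_i rho x 0 i * l i) *: w).
    move=> a x y; rewrite scalerA -scalerDl mulr_sumr -big_split; congr (_ *: _).
    by apply: eq_bigr => i _; rewrite linearP !mxE mulrDl mulrA.
  have relp (u : 'rV[R]_n) : \sum_i u 0 i *: g i = 0 -> p (\sum_i u 0 i * l i).
    move=> e; pose u' i := if insub i is Some i' then u 0 i' else 0.
    have u'E (i : 'I_n) : u' i = u 0 i by rewrite /u' valK.
    rewrite (eq_bigr (fun i : 'I_n => u' i * l i)) => [|i _]; last by rewrite u'E.
    by apply: Ul; rewrite /U -[RHS]e; apply: eq_bigr => i _; rewrite u'E.
  have [|a Ka] := Hhom (mk_linear fl).
    move=> x /=; apply: relp; rewrite erho; exact: (res_diff_cycle x).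
  exists a; split.
    move=> Ia; apply: pl; have [x ex] := @res_aug_surj _ _ P (g (Ordinal i0n)).
    have fx : K j ((\sum_i rho x 0 i * l i) *: w).
      by have /= := KD _ _ (Ka x) (pspan_scale (res_aug P x) Ia); rewrite subrK.
    have : p (\sum_i (rho x - delta_mx 0 (Ordinal i0n)) 0 i * l i).
      apply: relp; under eq_bigr do rewrite mxE scalerDl.
      rewrite big_split /= erho ex (bigD1 (Ordinal i0n)) //= !mxE !eqxx.
      rewrite big1 ?addr0 ?scaleN1r ?subrr // => i ne.
      by rewrite !mxE eqxx (negbTE ne) oppr0 scale0r.
    rewrite /p; under eq_bigr do rewrite mxE mulrDl.
    rewrite big_split /= scalerDl [X in _ + X *: _](bigD1 (Ordinal i0n)) //= !mxE !eqxx.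
    rewrite [X in _ * l i0 + X]big1 ?addr0 => [H|i ne]; last first.
      by rewrite !mxE eqxx (negbTE ne) oppr0 mul0r.
    by have := submodB sK fx H; rewrite opprD addrA subrr sub0r mulN1r scaleNr opprK.
  move=> b Kb; apply: Hfaith => c.
  have [x <-] := @res_aug_surj _ _ P c.
  have H := KZ b _ (Ka x); rewrite /= scalerBr in H.
  have H2 : K j (b *: ((\sum_i rho x 0 i * l i) *: w)).
    rewrite /w; set S := \sum_i _; rewrite (_ : b *: _ = (S * r) *: (b *: v)); first exact: KZ.
    by rewrite !scalerA; congr (_ *: _); ring.
  by have := submodB sK H2 H; rewrite opprB addrCA subrr addr0 scalerA.
(* In the other case of the dichotomy [s] kills every generator of [C], so [s = 0] by faithfulness,
   while 0 belongs to [p]. *)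
case: ps; rewrite /p.
suff -> : s = 0 by rewrite scale0r.
apply: faithC => c; have [a ->] := gen c.
rewrite scaler_sumr big1 // => i _.
have [u Uu eu] := Us i (ltn_ord i).
rewrite scalerA mulrC -scalerA (_ : s *: g i = 0) ?scaler0 // -Uu.
rewrite (bigD1 i) //= eu // eqxx mulr1 big1 ?addr0 // => l ne.
by rewrite eu // val_eqE (negbTE ne) mulr0 scale0r.
Qed.

Lemma pspan_regular j v : reduces j ->
  (forall r : R, KR j (z j * r : R) -> KR j r) -> K j (z j *: v) -> K j v.
Proof.
move=> Hj reg Kzv; apply: contrapT => /(pspan_associated Hj)[a [nKa]].
by move=> /(_ _ Kzv) /reg.
Qed.

Lemma reducesS j : reduces j -> (forall r : R, KR j (z j * r : R) -> KR j r) ->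
  reduces j.+1.
Proof.
move=> Hj reg; have sK := pspan_submod z j C; have [K0 KD KZ] := sK.
have regC v := @pspan_regular j v Hj reg.
have [Hext Hhom Hfaith] := Hj.
(* The connecting homomorphism: [f \o d i] is [z j] times some [g] modulo [K j], and regularity of
   [z j] makes [g] a cocycle modulo [K j], hence a coboundary. Subtracting [z j] times its primitive
   corrects [f]. *)
have key i (f : {linear res_obj P i -> C}) : (forall x, K j.+1 (f (d i x))) ->
    exists g : {linear res_obj P i -> C}, forall x, K j (f (d i x) - z j *: g (d i x)).
  move=> Hf.
  have [|g Hg] := projective_lift_pspan (f := (f \o d i)%FUN) _ Hf; first exact: res_projective.
  have [|g' Hg'] := Hext i g.
    move=> x; apply: regC; have := Hg (d i.+1 x).
    rewrite /= (_ : d i _ = 0); last exact: (res_diff_cycle x).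
    by rewrite linear0 sub0r => H; rewrite -[_ *: _]opprK -scaleN1r; apply: KZ.
  exists g' => x; have := KD _ _ (Hg x) (KZ (z j) _ (Hg' x)).
  by rewrite /= scalerBr addrA subrK.
split.
- move=> i f /key[g Hg].
  have [|g' Hg'] := Hext i (f \- (z j \*: g))%FUN; first exact: Hg.
  exists g' => x; apply/pspanS; exists (g x); have := Hg' x.
  by rewrite /= addrAC.
- move=> f /key[g Hg].
  have [|a Ha] := Hhom (f \- (z j \*: g))%FUN; first exact: Hg.
  by exists a => x; apply/pspanS; exists (g x); have := Ha x; rewrite /= addrAC.
move=> a Ha; apply/pspanS.
(* If [a] multiplies [C] into [K j.+1], then modulo [K j] it acts as [z j] times multiplication by
   some [b]; faithfulness at level [j] applies to [a - z j * b]. *)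
have [|g Hg] := @projective_lift_pspan R z j C _ (a \*: res_aug P)%FUN (@res_projective _ _ P 0).
  by move=> x; apply: Ha.
have [|b Hb] := Hhom g.
  move=> x; apply: regC; have := Hg (d 0 x).
  rewrite /= (_ : res_aug P _ = 0); last exact: (res_diff_cycle x).
  by rewrite scaler0 sub0r => H; rewrite -[_ *: _]opprK -scaleN1r; apply: KZ.
exists (b : R^o); apply: Hfaith => c; have [x <-] := @res_aug_surj _ _ P c.
have := KD _ _ (Hg x) (KZ (z j) _ (Hb x)).
by rewrite /= scalerBr addrA subrK scalerA -scalerBl.
Qed.

Lemma regular_reduces n :
  (forall j, (j < n)%N -> forall r : R, KR j (z j * r : R) -> KR j r) ->
  forall j, (j <= n)%N -> reduces j.
Proof.
move=> reg; elim=> [_|j IH jn]; first exact: reduces0.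
by apply: reducesS; [apply/IH/ltnW|apply: reg].
Qed.

End Semidualizing.

(** An abstract isomorphism of [Hom C C] with [R] has to be turned into the statement that
    endomorphisms are homotheties, and the vanishing of all Ext has to be read on one resolution. *)
Lemma semidualizing_reduction_data (R : comNzRingType) (C : lmodType R) :
  semidualizing C -> exists P : proj_resolution C,
  [/\ fin_gen C, forall h : {linear C -> C}, exists a, forall c, h c = a *: c,
      forall a : R, (forall c : C, a *: c = 0) -> a = 0
    & forall i (f : {linear res_obj P i.+1 -> C}), cocycle f -> coboundary f].
Proof.
move=> [fgC [f [g gK fK]] extC].
have [P HP] := extC 1%N (leqnn _).
exists P.
have lin (h : C -> C) : linear h -> h \in @linear_pred R C C by move=> lh; apply/asboolP.
(* [e] generates [Hom C C]. Writing the identity as [a e] and [e \o e] as [b e] gives [a * b = 1],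
   so the identity generates as well. *)
pose e := g 1; have fe : f e = 1 by rewrite fK.
have genE (h : Hom C C) : h = f h *: e.
  by rewrite -[LHS]gK; apply: (can_inj gK); rewrite fK linearZ fe /= [_ *: _]mulr1.
have linE (h : Hom C C) : linear (hom_fun h) by apply/asboolP; apply: hom_linear.
have eeP : linear (fun c => hom_fun e (hom_fun e c)).
  by move=> r x y; rewrite !linE.
have idP : linear (fun c : C => c) by [].
pose ee := MkHom (lin _ eeP); pose id1 := MkHom (lin _ idP).
pose a := f id1; pose b := f ee.
have ea c : c = a *: hom_fun e c.
  by have /(congr1 (fun h => hom_fun h c)) := genE id1.
have eb c : hom_fun e (hom_fun e c) = b *: hom_fun e c.
  by have /(congr1 (fun h => hom_fun h c)) := genE ee.
have eZ r c : hom_fun e (r *: c) = r *: hom_fun e c.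
  have e0 : hom_fun e 0 = 0 by exact: (raddf0 (mk_linear (linE e))).
  by have := linE e r c 0; rewrite e0 !addr0.
have ab : a * b = 1.
  have : (1 - a * b) *: e = 0.
    apply: val_inj; apply/funext => c /=.
    rewrite [LHS](_ : _ = (1 - a * b) *: hom_fun e c) //.
    by rewrite scalerBl scale1r -scalerA -eb -eZ -ea subrr.
  move/(congr1 f); rewrite linearZ linear0 fe /= [_ *: _]mulr1 => /eqP.
  by rewrite subr_eq0 => /eqP.
split=> //.
- move=> h; have hl : linear h by exact: linearP.
  exists (f (MkHom (lin _ hl)) * b) => c.
  have /(congr1 (fun h => hom_fun h c)) := genE (MkHom (lin _ hl)).
  rewrite -[LHS]/(h c) => ->; rewrite {2}(ea c) scalerA -mulrA [b * a]mulrC ab mulr1.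
  by [].
- move=> r rC; have : r *: id1 = 0 by apply: val_inj; apply/funext => c; exact: rC.
  move/(congr1 f); rewrite linearZ linear0 /= -/a => ra.
  by rewrite -[r]mulr1 -ab mulrA [r * a]ra mul0r.
- move=> i; have [Q HQ] := extC i.+1 isT.
  exact: ext_vanishing_transfer HQ.
Qed.

(** * Polynomials modulo their first variables *)

Section Kill.
Variables (k : fieldType) (d : nat).
Local Notation S := {mpoly k[d]}.

(** Indexed by [nat], with value 0 out of range, to serve as a sequence for [pspan]. *)
Definition mvar (i : nat) : S := if insub i is Some i' then 'X_i' else 0.

Lemma mvarE (i : 'I_d) : mvar i = 'X_i.
Proof. by rewrite /mvar valK. Qed.

(** A retraction onto the polynomials in the remaining variables. Its kernel is the ideal of the
    first [j] variables, so the quotient ring is realized inside [S]. *)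
Definition kill j : S -> S :=
  mmap (@mpolyC d k) (fun i : 'I_d => if (i < j)%N then 0 else 'X_i).

Lemma kill_is_additive j : additive (kill j).
Proof. exact: mmap_is_additive. Qed.
Lemma kill_is_multiplicative j : multiplicative (kill j).
Proof. exact: mmap_is_multiplicative. Qed.
HB.instance Definition _ j := GRing.isAdditive.Build S S (kill j) (kill_is_additive j).
HB.instance Definition _ j :=
  GRing.isMultiplicative.Build S S (kill j) (kill_is_multiplicative j).

Lemma killC j c : kill j c%:MP = c%:MP.
Proof. by rewrite /kill mmapC. Qed.

Lemma kill_var j i : kill j (mvar i) = if (i < j)%N then 0 else mvar i.
Proof.
rewrite /mvar; case: insubP => [i' _ <-|_]; last by rewrite rmorph0 if_same.
by rewrite /kill mmapX mmap1U.
Qed.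

Lemma killX j (i : 'I_d) : kill j 'X_i = if (i < j)%N then 0 else 'X_i.
Proof. by rewrite -mvarE kill_var. Qed.

Lemma kill_kill j s : kill j (kill j s) = kill j s.
Proof.
apply: (mpoly_rmorph_eq (f := kill j \o kill j) (g := kill j)) => [c|i] /=.
  by rewrite !killC.
by rewrite killX; case: ifP => e; rewrite ?rmorph0 // killX e.
Qed.

Lemma kill0 s : kill 0 s = s.
Proof.
apply: (mpoly_rmorph_eq (f := kill 0) (g := idfun)) => [c|i] /=; first by rewrite killC.
by rewrite killX.
Qed.

Lemma kill_all s : kill d s = (s@_0%MM)%:MP.
Proof.
apply: (mpoly_rmorph_eq (f := kill d) (g := @mpolyC d k \o mcoeff 0%MM)) => [c|i] /=.
  by rewrite killC mcoeffC eqxx mulr1.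
by rewrite killX ltn_ord mcoeffX mnm1_eq0 mpolyC0.
Qed.

Lemma kill_pspan j (s : S) : pspan mvar j (s : S^o) -> kill j s = 0.
Proof.
move=> [h ->]; rewrite raddf_sum big1 // => i _.
by rewrite /= [kill j _]rmorphM /= kill_var ltn_ord mul0r.
Qed.

Lemma sub_kill_pspan j (s : S) : pspan mvar j (s - kill j s : S^o).
Proof.
pose Q (s : S) := @pspan S mvar j S^o (s - kill j s).
have [p0 pD0 pZ0] := pspan_submod mvar j S^o.
have pD (x y : S) : @pspan S mvar j S^o x -> @pspan S mvar j S^o y -> @pspan S mvar j S^o (x + y).
  exact: pD0.
have pZ (x y : S) : @pspan S mvar j S^o y -> @pspan S mvar j S^o (x * y) by exact: pZ0.
have Q0 s1 : kill j s1 = s1 -> Q s1 by move=> e; rewrite /Q e subrr.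
have QD s1 s2 : Q s1 -> Q s2 -> Q (s1 + s2).
  by move=> H1 H2; rewrite /Q [kill j _]rmorphD /= opprD addrACA; apply: pD.
have QM s1 s2 : Q s1 -> Q s2 -> Q (s1 * s2).
  move=> H1 H2; rewrite /Q [kill j _]rmorphM /=.
  have -> : s1 * s2 - kill j s1 * kill j s2 = s2 * (s1 - kill j s1) + kill j s1 * (s2 - kill j s2) by ring.
  by apply: pD; apply: pZ.
have QX i : Q 'X_i.
  have [ij|ij] := ltnP i j; last by apply: Q0; rewrite killX ltnNge ij.
  rewrite /Q killX ij subr0; exists (fun l : nat => (l == i :> nat)%:R : S).
  rewrite (bigD1 (Ordinal ij)) //= eqxx mvarE [_ *: 1]mulr1 big1 ?addr0 // => l.
  by rewrite -val_eqE /= => /negbTE ->; rewrite scaler0.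
rewrite -/(Q s); elim/mpolyind: s => [|c m s _ _ IH]; first by apply: Q0; rewrite [LHS]rmorph0.
apply: (QD _ _ _ IH); rewrite -mul_mpolyC; apply: (QM); first by apply: Q0; rewrite killC.
have Q1 : Q 1 by apply: Q0; rewrite [LHS]rmorph1.
rewrite mpolyXE_id; apply: (big_ind Q Q1 (QM)) => i _; elim: (m i) => [|n IHn]; first exact: Q1.
by rewrite exprS; apply: QM (QX i) IHn.
Qed.

Lemma kill_divs j (s : S) : kill j s = s -> kill j.+1 s = 0 ->
  exists g, s = mvar j * g.
Proof.
move=> sj sj1; have [h e] := sub_kill_pspan j.+1 s; rewrite sj1 subr0 in e.
exists (kill j (h j)); rewrite -[LHS]sj e raddf_sum big_ord_recr /= big1 ?add0r => [|i _].
  by rewrite /= [kill j _]rmorphM /= kill_var ltnn.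
by rewrite /= [kill j _]rmorphM /= kill_var ltn_ord mul0r.
Qed.

End Kill.

(** * Freeness over the parameters near the origin *)

Section LocalFreeness.
Variables (k : fieldType) (d : nat) (R : comNzRingType).
Local Notation S := {mpoly k[d]}.
Variable phi : {rmorphism S -> R}.
Variables (I : finType) (b : I -> R).
Hypothesis genR : forall r, exists f : I -> S, r = \sum_i phi (f i) * b i.
Variable C : lmodType R.
Hypothesis fgC : fin_gen C.

Definition zvar i := phi (mvar k d i).
Local Notation K j := (@pspan R zvar j C).

Hypothesis regC : forall j, (j < d)%N -> forall v, K j (zvar j *: v) -> K j v.

Lemma pspan_phi j (s : S) (c : C) : pspan (@mvar k d) j (s : S^o) -> K j (phi s *: c).
Proof.
move=> [h ->]; exists (fun i => phi (h i) *: c); rewrite rmorph_sum scaler_suml.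
by apply: eq_bigr => i _; rewrite rmorphM scalerA.
Qed.

Lemma locally_generated : exists n (x : 'I_n -> C),
  forall c, exists f : 'I_n -> S, c = \sum_i phi (f i) *: x i.
Proof.
have [n [g gen]] := fgC.
exists #|{: I * 'I_n}|, (fun l => let ij := enum_val l in b ij.1 *: g ij.2) => c.
have [a ->] := gen c.
have [f ef] := choice (fun i => genR (a i)).
exists (fun l => let ij := enum_val l in f ij.2 ij.1).
rewrite (reindex_onto enum_rank enum_val) => [|l _]; last exact: enum_valK.
rewrite (eq_bigl xpredT) => [|l]; last by rewrite enum_rankK eqxx.
under [RHS]eq_bigr do rewrite /= enum_rankK.
rewrite -(pair_bigA _ (fun i j => phi (f j i) *: (b i *: g j))) /= exchange_big /=.
  apply: eq_bigr => j _; rewrite ef scaler_suml; apply: eq_bigr => i _.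
  by rewrite scalerA.
Qed.


Lemma pspan_sub_const (s : S) (c : C) : K d (phi s *: c - phi (s@_0%MM)%:MP *: c).
Proof.
by rewrite -scalerBl -rmorphB -kill_all; apply/pspan_phi/sub_kill_pspan.
Qed.

(** A largest subset [D] of the generators that is independent over [k] modulo all parameters: a
    basis of the fibre of [C] at the origin. *)
Lemma residue_basis n (x : 'I_n -> C) : exists D : {set 'I_n},
  (forall c : 'I_n -> k, (forall l, l \notin D -> c l = 0) ->
     K d (\sum_l phi (c l)%:MP *: x l) -> forall l, c l = 0) /\
  (forall l, exists c : 'I_n -> k, (forall l, l \notin D -> c l = 0) /\
     K d (x l - \sum_m phi (c m)%:MP *: x m)).
Proof.
pose indep (D : {set 'I_n}) := forall c : 'I_n -> k, (forall l, l \notin D -> c l = 0) ->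
     K d (\sum_l phi (c l)%:MP *: x l) -> forall l, c l = 0.
have [K0 KD KZ] := pspan_submod zvar d C.
have i0 : `[< indep finset.set0 >].
  by apply/asboolP => c H _ l; apply: H; rewrite inE.
case: (@arg_maxnP _ finset.set0 (fun D => `[< indep D >]) (fun D => #|D|) i0).
move=> D /asboolP iD maxD; exists D; split=> // l.
have [lD|lD] := boolP (l \in D).
  exists (fun m => (m == l)%:R); split.
    by move=> m mD; case: eqP mD => [->|//]; rewrite lD.
  rewrite (bigD1 l) //= eqxx mpolyC1 rmorph1 scale1r big1 ?addr0 ?subrr // => m /negbTE ->.
  by rewrite mpolyC0 rmorph0 scale0r.
have : ~ indep (l |: D).
  move=> H; have := maxD (l |: D) (asboolT H).
  by rewrite cardsU1 lD add1n /= ltnn.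
move=> /existsNP[c /not_implyP[cD /not_implyP[Kc /existsNP[m cm]]]].
have cl : c l != 0.
  apply/eqP => cl; apply: cm; apply: iD => // m' m'D.
  by have [->//|ne] := eqVneq m' l; apply: cD; rewrite !inE negb_or ne.
exists (fun m => if m == l then 0 else - (c m / c l)); split.
  by move=> m' m'D; case: eqP => // /eqP ne; rewrite cD ?mul0r ?oppr0 // !inE negb_or ne.
have := KZ (phi (c l)^-1%:MP) _ Kc; congr (K d _).
rewrite scaler_sumr (bigD1 l) //= [X in _ - X](bigD1 l) //= eqxx mpolyC0 rmorph0 scale0r add0r.
rewrite scalerA -rmorphM -mpolyCM mulVf // mpolyC1 rmorph1 scale1r; congr (_ + _).
rewrite -sumrN; apply: eq_bigr => i /negbTE ->.
by rewrite mpolyCN rmorphN scaleNr opprK scalerA -rmorphM -mpolyCM mulrC.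
Qed.

Lemma pspan_coordinates n (x : 'I_n -> C) :
  (forall c, exists f : 'I_n -> S, c = \sum_i phi (f i) *: x i) ->
  forall c, K d c -> exists f : 'I_n -> S, c = \sum_i phi (f i) *: x i /\
    forall i, (f i)@_0%MM = 0.
Proof.
move=> gen c [h ->]; have [f ef] := choice gen.
exists (fun i => \sum_(l < d) mvar k d l * f (h l) i); split; last first.
  move=> i; rewrite raddf_sum big1 // => l _.
  by rewrite mvarE /= [LHS]rmorphM /= mcoeffX mnm1_eq0 mul0r.
under [RHS]eq_bigr do rewrite rmorph_sum scaler_suml.
rewrite exchange_big; apply: eq_bigr => l _ /=.
rewrite {1}(ef (h l)) scaler_sumr; apply: eq_bigr => i _.
by rewrite rmorphM scalerA.
Qed.

(** Induction on the number of parameters no longer divided out: the coefficients vanish modulo the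
    first [i.+1] variables, so modulo the first [i] they are multiples of variable [i], which
    regularity cancels. Each cancellation lowers the sizes, so the process ends. *)
Lemma residue_independent n (x : 'I_n -> C) (D : {set 'I_n}) :
  (forall c : 'I_n -> k, (forall l, l \notin D -> c l = 0) ->
     K d (\sum_l phi (c l)%:MP *: x l) -> forall l, c l = 0) ->
  forall f : 'I_n -> S, (forall l, l \notin D -> f l = 0) ->
    \sum_l phi (f l) *: x l = 0 -> forall l, f l = 0.
Proof.
move=> iD.
suff key j : (j <= d)%N -> forall f : 'I_n -> S, (forall l, l \notin D -> f l = 0) ->
    K (d - j)%N (\sum_l phi (f l) *: x l) -> forall l, kill (d - j) (f l) = 0.
  move=> f fD e l; rewrite -[f l]kill0 -(subnn d); apply: key => //.
  by rewrite e; case: (pspan_submod zvar (d - d) C).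
elim: j => [|j IH] jd f fD Kf l.
  rewrite subn0 in Kf *; rewrite kill_all.
  rewrite (iD (fun l => (f l)@_0%MM)) ?mpolyC0 // => [l' l'D|].
    by rewrite fD // mcoeff0.
  have [_ KD KZ] := pspan_submod zvar d C.
  have H : K d (\sum_l (phi (f l) *: x l - phi ((f l)@_0%MM)%:MP *: x l)).
    by apply: submod_sum; [exact: pspan_submod|move=> i _; exact: pspan_sub_const].
  have := submodB (pspan_submod zvar d C) Kf H.
  by rewrite -sumrB; under eq_bigr do rewrite opprB addrCA subrr addr0.
have {}IH := IH (ltnW jd); set i := (d - j.+1)%N in Kf *.
have ij : (d - j)%N = i.+1 by rewrite /i; lia.
have id : (i < d)%N by rewrite /i; lia.
rewrite ij in IH.
have sK := pspan_submod zvar i C.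
have [N fN] : exists N, forall l, (msize (kill i (f l)) <= N)%N.
  by exists (\max_l msize (kill i (f l))) => l'; apply: leq_bigmax.
elim: N f fD Kf fN l => [|N IHN] f fD Kf fN l.
  by apply/eqP; rewrite -msize_poly_eq0 -leqn0.
pose f' l := kill i (f l).
have Kf' : K i (\sum_l phi (f' l) *: x l).
  have H : K i (\sum_l (phi (f l) *: x l - phi (f' l) *: x l)).
    apply: submod_sum => // l' _; rewrite -scalerBl -rmorphB; apply: pspan_phi.
    exact: sub_kill_pspan.
  have := submodB sK Kf H.
  by rewrite -sumrB; under eq_bigr do rewrite opprB addrCA subrr addr0.
have f'D l' : l' \notin D -> f' l' = 0 by move=> /fD; rewrite /f' => ->; rewrite [LHS]rmorph0.
have f'0 l' : kill i.+1 (f' l') = 0.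
  apply: IH => //; apply/pspanS; exists 0; by rewrite scaler0 subr0.
have [g eg] := choice (fun l' => kill_divs (kill_kill i (f l')) (f'0 l')).
have vi0 : mvar k d i != 0.
  rewrite -[i]/(nat_of_ord (Ordinal id)) mvarE -msize_poly_eq0.
  by rewrite msizeX.
have gk l' : kill i (g l') = g l'.
  apply: (mulfI vi0); rewrite -eg -[in RHS]kill_kill [in RHS]eg [in RHS]rmorphM /=.
  by rewrite kill_var ltnn.
suff g0 l' : kill i (g l') = 0 by rewrite -/(f' l) [f' l]eg -gk g0 mulr0.
apply: IHN => {l'} [l' l'D||l'].
- by apply: (mulfI vi0); rewrite -eg mulr0; exact: f'D.
- apply: regC => //; rewrite scaler_sumr; move: Kf'; congr (K i _).
  by apply: eq_bigr => l' _; rewrite /f' eg rmorphM scalerA.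
rewrite gk; have [->|gn0] := eqVneq (g l') 0; first by rewrite msize0.
have := fN l'; rewrite eg msizeM // -[i]/(nat_of_ord (Ordinal id)) mvarE msizeX mdeg1.
by [].
Qed.

(** Nakayama's lemma by determinants: some [s] with constant term 1 multiplies [C] into the free
    module on [D], and [lam c] is a coordinate of [phi s *: c]. As [x] is not in [K d], some
    coordinate of [phi s *: x] has nonzero constant term. *)
Lemma exists_residue_functional x : ~ K d x -> exists lam : C -> S,
  [/\ forall c1 c2, lam (c1 + c2) = lam c1 + lam c2,
      forall s c, lam (phi s *: c) = s * lam c & (lam x)@_0%MM != 0].
Proof.
move=> nKx; have [n [y gen]] := locally_generated.
have [D [iD sD]] := residue_basis y.
have indD := residue_independent iD.
have [c cP] := choice sD.
have A1 l : exists f : 'I_n -> S, y l - \sum_m phi (c l m)%:MP *: y m = \sum_i phi (f i) *: y i /\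
    forall i, (f i)@_0%MM = 0 by apply: pspan_coordinates => //; case: (cP l).
have [A AP] := choice A1.
(* With [y] the column of generators, [B y = c y] where [c] has its nonzero columns in [D]. The
   entries of [A] have no constant term, so [\det B] has constant term 1. *)
pose B : 'M[S]_n := 1%:M - \matrix_(l, m) A l m.
pose s := \det B.
have s0 : s@_0%MM = 1.
  rewrite /s -det_map_mx (_ : map_mx _ B = 1%:M) ?det1 //.
  apply/matrixP=> l m; rewrite !mxE raddfB /=; have [_ ->] := AP l.
  rewrite subr0; case: eqP => _; [exact: rmorph1|exact: rmorph0].
have sy l : exists f : 'I_n -> S, (forall m, m \notin D -> f m = 0) /\ phi s *: y l = \sum_m phi (f m) *: y m.
  exists (fun m => \sum_i \adj B l i * (c i m)%:MP); split.
    move=> m mD; rewrite big1 // => i _.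
    by have [cD _] := cP i; rewrite cD // mpolyC0 mulr0.
  have eB i : \sum_m phi (B i m) *: y m = \sum_m phi (c i m)%:MP *: y m.
    have [e _] := AP i.
    transitivity (y i - \sum_m phi (A i m) *: y m).
      rewrite /B; under eq_bigr do rewrite !mxE rmorphB scalerBl.
      rewrite sumrB (bigD1 i) //= eqxx rmorph1 scale1r big1 ?addr0 // => m.
      by rewrite eq_sym => /negbTE ->; rewrite rmorph0 scale0r.
    by rewrite -e opprB addrCA subrr addr0.
  have eAB m : \sum_i \adj B l i * B i m = s * (l == m)%:R.
    by have /matrixP/(_ l m) := mul_adj_mx B; rewrite !mxE => ->; rewrite mulr_natr.
  transitivity (\sum_i phi (\adj B l i) *: (\sum_m phi (B i m) *: y m)).
    under [RHS]eq_bigr do rewrite scaler_sumr.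
    rewrite exchange_big /= (bigD1 l) //= [X in _ + X]big1 => [|m ne].
      by under eq_bigr do rewrite scalerA -rmorphM; rewrite -scaler_suml -rmorph_sum eAB eqxx mulr1 addr0.
    under eq_bigr do rewrite scalerA -rmorphM; rewrite -scaler_suml -rmorph_sum eAB.
    by rewrite eq_sym (negbTE ne) mulr0 rmorph0 scale0r.
  under eq_bigr do rewrite eB scaler_sumr.
  rewrite exchange_big /=; apply: eq_bigr => m _.
  by rewrite rmorph_sum scaler_suml; apply: eq_bigr => i _; rewrite rmorphM scalerA.
have sC z : exists f : 'I_n -> S, (forall m, m \notin D -> f m = 0) /\ phi s *: z = \sum_m phi (f m) *: y m.
  have [g eg] := choice sy; have [h ->] := gen z.
  exists (fun m => \sum_i h i * g i m); split.
    by move=> m mD; rewrite big1 // => i _; have [-> //] := eg i; rewrite mulr0.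
  rewrite scaler_sumr.
  under eq_bigr => i _.
    rewrite scalerA [phi s * _]mulrC -scalerA; have [_ ->] := eg i; rewrite scaler_sumr; over.
  rewrite exchange_big; apply: eq_bigr => m _ /=.
  by rewrite rmorph_sum scaler_suml; apply: eq_bigr => i _; rewrite rmorphM scalerA.
have [co coP] := choice sC.
have co_uniq z f : (forall m, m \notin D -> f m = 0) -> phi s *: z = \sum_m phi (f m) *: y m -> co z =1 f.
  move=> fD ef m; have [cD ec] := coP z; apply/eqP; rewrite -subr_eq0; apply/eqP.
  apply: (indD (fun m => co z m - f m)) => [m' m'D|]; first by rewrite cD // fD // subrr.
  under eq_bigr do rewrite rmorphB scalerBl.
  by rewrite sumrB -ef -ec subrr.
have [m cm] : exists m, (co x m)@_0%MM != 0.
  apply: contrapT => /forallNP N; apply: nKx.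
  have [cD ec] := coP x; have sK := pspan_submod zvar d C.
  have H1 : K d (phi s *: x).
    rewrite ec; apply: submod_sum => // m _.
    have := pspan_sub_const (co x m) (y m).
    have -> : (co x m)@_0%MM = 0 by apply/eqP; apply: contrapT => /negP /N.
    by rewrite mpolyC0 rmorph0 scale0r subr0.
  have := submodB sK H1 (pspan_sub_const s x); rewrite s0 mpolyC1 rmorph1 scale1r.
  by rewrite opprB addrCA subrr addr0.
exists (fun z => co z m); split=> // [z1 z2|t z].
  have [D1 e1] := coP z1; have [D2 e2] := coP z2.
  apply: (co_uniq _ (fun m => co z1 m + co z2 m)) => [m' m'D|]; first by rewrite D1 // D2 // addr0.
  rewrite scalerDr e1 e2 -big_split; apply: eq_bigr => i _.
  by rewrite rmorphD scalerDl.
have [D1 e1] := coP z.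
apply: (co_uniq _ (fun m => t * co z m)) => [m' m'D|]; first by rewrite D1 // mulr0.
rewrite scalerA [phi s * _]mulrC -scalerA e1 scaler_sumr; apply: eq_bigr => i _.
by rewrite rmorphM scalerA.
Qed.

End LocalFreeness.

(** * Monomial presentations *)

Section Weights.
Variables (k : fieldType) (d : nat).
Local Notation P := {mpoly k[d]}.
Variable w : 'X_{1..d} -> int.
Hypothesis wD : forall m1 m2, w (m1 + m2)%MM = w m1 + w m2.

Lemma lowest_weight_part (f : P) : f != 0 -> exists v (f1 f2 : P),
  [/\ f = f1 + f2, f1 != 0, forall m, m \in msupp f1 -> m \in msupp f /\ w m = v
    & forall m, m \in msupp f2 -> (v < w m)%R] /\ forall m, m \in msupp f -> (v <= w m)%R.
Proof.
move=> f0; have [m0 m0f] : exists m, m \in msupp f.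
  by exists (mlead f); apply: mlead_supp.
have [m1 m1f m1min] : exists2 m1, m1 \in msupp f & forall m, m \in msupp f -> (w m1 <= w m)%R.
  elim: (msupp f) m0 m0f => // a [|b s] IH m0 _.
    by exists a; rewrite ?mem_head // => m; rewrite inE => /eqP ->.
  have [m1 m1s m1min] := IH b (mem_head _ _).
  have [le|le] := lerP (w a) (w m1).
    exists a; rewrite ?mem_head // => m; rewrite inE => /predU1P[->//|/m1min].
    exact: le_trans.
  exists m1; first by rewrite inE m1s orbT.
  by move=> m; rewrite inE => /predU1P[->|/m1min//]; apply: ltW.
pose part (Q : pred int) : P := \sum_(m <- msupp f | Q (w m)) f@_m *: 'X_[m].
have partE Q m : (part Q)@_m = if Q (w m) then f@_m else 0.
  rewrite /part raddf_sum /= big_mkcond /=.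
  have [mf|mf] := boolP (m \in msupp f).
    rewrite (bigD1_seq m) ?msupp_uniq //= mcoeffZ mcoeffX eqxx mulr1.
    rewrite big1 ?addr0 // => i ne; rewrite mcoeffZ mcoeffX (negbTE ne) mulr0 if_same //.
  rewrite big1_seq ?(memN_msupp_eq0 mf) ?if_same // => i /andP[_ ifs].
  have ne : i != m by apply: contra mf => /eqP <-.
  by rewrite mcoeffZ mcoeffX (negbTE ne) mulr0 if_same.
exists (w m1), (part (pred1 (w m1))), (part (predC1 (w m1))); split=> //; split.
- apply/mpolyP => m; rewrite mcoeffD !partE /=; case: eqP => _ /=; rewrite ?addr0 ?add0r //.
- by apply/eqP => /mpolyP/(_ m1); rewrite partE /= eqxx mcoeff0; apply/eqP; rewrite -mcoeff_msupp.
- move=> m; rewrite mcoeff_msupp partE /=; case: ifP => [/eqP e ?|]; last by rewrite eqxx.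
  by rewrite mcoeff_msupp.
- move=> m; rewrite mcoeff_msupp partE /=; case: ifP => [ne mf|]; last by rewrite eqxx.
  by rewrite lt_neqAle eq_sym ne m1min // mcoeff_msupp.
Qed.

(** The parts of lowest weight have a nonzero product, so least weights add. *)
Lemma weight_mul (f g : P) : f != 0 -> g != 0 -> exists m1 m2,
  [/\ m1 \in msupp f, m2 \in msupp g, forall m, m \in msupp f -> (w m1 <= w m)%R,
      forall m, m \in msupp g -> (w m2 <= w m)%R & (m1 + m2)%MM \in msupp (f * g)].
Proof.
move=> /lowest_weight_part[v [f1 [f2 [[ef f10 f1w f2w] fv]]]].
move=> /lowest_weight_part[u [g1 [g2 [[eg g10 g1w g2w] gu]]]].
have fg0 : f1 * g1 != 0 by rewrite mulf_neq0.
have /mlead_supp lfg := fg0.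
have /allpairsP[[m1 m2] /= [m1f m2g em]] := msuppM_le lfg.
have [m1f' w1] := f1w _ m1f; have [m2g' w2] := g1w _ m2g.
exists m1, m2; split=> // [m|m|]; rewrite ?w1 ?w2; [exact: fv|exact: gu|].
have wm : w (m1 + m2)%MM = v + u by rewrite wD w1 w2.
have ne (a b : P) : (forall l1 l2, l1 \in msupp a -> l2 \in msupp b -> (v + u < w l1 + w l2)%R) ->
    (a * b)@_(m1 + m2)%MM = 0.
  move=> H; apply/eqP; rewrite mcoeff_eq0; apply/negP => /msuppM_le/allpairsP[[l1 l2] /= [la lb e]].
  by have := H _ _ la lb; rewrite -wD -e wm ltxx.
rewrite ef eg mulrDl !mulrDr mcoeff_msupp !mcoeffD.
rewrite [(f1 * g2)@_ _]ne ?[(f2 * g1)@_ _]ne ?[(f2 * g2)@_ _]ne ?addr0; first by rewrite -em -mcoeff_msupp.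
- by move=> l1 l2 /f2w h1 /g2w h2; apply: ltrD.
- by move=> l1 l2 /f2w h1 /g1w[_ ->]; rewrite ltrD2r.
- by move=> l1 l2 /f1w[_ ->] /g2w h; rewrite ltrD2l.
Qed.

Lemma weight_monomial_factor (f g : P) m : g != 0 ->
  (forall l, l \in msupp (f * g) -> (0 <= w l)%R) -> m \in msupp g ->
  forall l, l \in msupp (f * 'X_[m]) -> (0 <= w l)%R.
Proof.
have [->|f0 g0] := eqVneq f 0; first by move=> _ _ _ l; rewrite mul0r msupp0.
have [m1 [m2 [m1f m2g min1 min2 m12]]] := weight_mul f0 g0.
move=> fg mg l /msuppM_le/allpairsP[[l1 l2] /= [l1f]].
rewrite msuppX inE => /eqP -> ->; have := fg _ m12; rewrite !wD => H.
by apply: (le_trans H); apply: lerD; [apply: min1|apply: min2].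
Qed.

(** A negative least weight of [f], multiplied by [n], would eventually outweigh that of [g]. *)
Lemma weight_power_bounded (f g : P) : g != 0 ->
  (forall n l, l \in msupp (f ^+ n * g) -> (0 <= w l)%R) ->
  forall l, l \in msupp f -> (0 <= w l)%R.
Proof.
have [->|f0 g0 H] := eqVneq f 0; first by rewrite msupp0.
have [m1 [m2 [m1f _ min1 _ _]]] := weight_mul f0 f0.
have [_ [m0 [_ m0g _ _ _]]] := weight_mul f0 g0.
suff key n : exists2 m, m \in msupp (f ^+ n * g) & (w m <= w m1 *+ n + w m0)%R.
  move=> l /min1; apply: le_trans; rewrite leNgt; apply/negP => neg.
  have [m ms] := key `|w m0|.+1; have := H _ _ ms => /le_trans h /h; apply/negP.
  rewrite -ltNge -mulr_natr natz; nia.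
elim: n => [|n [m mf le]]; first by exists m0; rewrite ?mul1r // mulr0n add0r.
have fg0 : f ^+ n * g != 0 by rewrite mulf_neq0 ?expf_neq0.
have [a1 [a2 [a1f a2g min1' min2 a12]]] := weight_mul f0 fg0.
exists (a1 + a2)%MM; first by rewrite exprS -mulrA.
rewrite wD mulrS -addrA; apply: lerD; first exact: min1'.
by apply: le_trans le; apply: min2.
Qed.

End Weights.

Section MonomialModule.
Variables (k : fieldType) (d : nat) (R : comNzRingType).
Local Notation P := {mpoly k[d]}.
Variable psi : {rmorphism R -> P}.
Hypothesis psi_inj : injective psi.
Hypothesis nR : noetherian R.
Variables (T : Type) (w : T -> 'X_{1..d} -> int).
Hypothesis wD : forall t m1 m2, w t (m1 + m2)%MM = w t m1 + w t m2.
Hypothesis imageP : forall f, (exists r, psi r = f) <->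
  forall m, m \in msupp f -> forall t, (0 <= w t m)%R.

Variables (C : lmodType R) (Q : proj_resolution C).
Hypothesis fgC : fin_gen C.
Hypothesis endC : forall h : {linear C -> C}, exists a, forall c, h c = a *: c.
Hypothesis faithC : forall a : R, (forall c : C, a *: c = 0) -> a = 0.
Hypothesis extC : forall i (f : {linear res_obj Q i.+1 -> C}), cocycle f -> coboundary f.

Let integral (x y : R) : x * y = 0 -> x = 0 \/ y = 0.
Proof.
move=> /(congr1 psi); rewrite rmorphM rmorph0 => /eqP; rewrite mulf_eq0.
by case/orP => /eqP e; [left|right]; apply: psi_inj; rewrite rmorph0.
Qed.

(** By the case of no parameter, with the dummy sequence [fun=> 0], an annihilator of a nonzero [c]
    also annihilates a nonzero element of the domain [R]. *)
Lemma torsion_free (a : R) (c : C) : a *: c = 0 -> a = 0 \/ c = 0.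
Proof.
move=> ac; have [->|/eqP c0] := eqVneq c 0; [by right|left].
have r0 := reduces0 (fun=> 0) endC faithC extC.
have [|b [nb H]] := pspan_associated nR fgC faithC (v := c) r0; first by move/pspan0.
have /pspan0 := H a ((pspan0 _ _).2 ac).
by case/integral=> // b0; case: nb; apply/pspan0.
Qed.

(** The dichotomy at the zero ideal, which is prime since [R] embeds in [P]: a functional vanishing
    on the relations of the generators descends to [C]. *)
Lemma exists_functional (c1 : C) : c1 != 0 ->
  exists2 phi : C -> R, linear (phi : C -> R^o) & exists c, phi c != 0.
Proof.
move=> c10; have [n [g gen]] := fgC.
pose g' i := if insub i is Some i' then g i' else 0.
have g'E (i : 'I_n) : g' i = g i by rewrite /g' valK.
pose U (u : nat -> R) := \sum_(i < n) u i *: g i = 0.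
have [|||||||[l [[i0 i0n pl] Ul]]|[s [ps Us]]] :=
    @relations_dichotomy R (fun x => x = 0) _ _ _ _ n U.
- by move=> x y -> ->; rewrite addr0.
- by [].
- by apply/eqP; rewrite oner_eq0.
- exact: integral.
- by rewrite /U big1 // => i _; rewrite scale0r.
- move=> u1 u2; rewrite /U => e1 e2; under eq_bigr do rewrite scalerDl.
  by rewrite big_split /= e1 e2 addr0.
- move=> a u; rewrite /U => e; under eq_bigr do rewrite -scalerA.
  by rewrite -scaler_sumr e scaler0.
- have [co coP] := choice gen.
  have phiE (u : 'I_n -> R) c : c = \sum_i u i *: g i ->
      \sum_i co c i * l i = \sum_i u i * l i.
    move=> ec; pose x i := if insub i is Some i' then co c i' - u i' else 0.
    have xE (i : 'I_n) : x i = co c i - u i by rewrite /x valK.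
    have : \sum_(i < n) x i * l i = 0.
      apply: Ul; rewrite /U; under eq_bigr do rewrite xE scalerBl.
      by rewrite sumrB -ec -coP subrr.
    under eq_bigr do rewrite xE mulrBl.
    by rewrite sumrB => /eqP; rewrite subr_eq0 => /eqP.
  exists (fun c => \sum_i co c i * l i).
    move=> a x y; rewrite (phiE (fun i => a * co x i + co y i)); last first.
      rewrite {1}(coP x) {1}(coP y) scaler_sumr -big_split; apply: eq_bigr => i _.
      by rewrite scalerDl scalerA.
    rewrite /GRing.scale /= mulr_sumr -big_split; apply: eq_bigr => i _.
    by rewrite mulrDl mulrA.
  exists (g (Ordinal i0n)).
  rewrite (phiE (fun i => (i == Ordinal i0n)%:R)); last first.
    by rewrite (bigD1 (Ordinal i0n)) //= eqxx scale1r big1 ?addr0 // => i /negbTE ->; rewrite scale0r.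
  rewrite (bigD1 (Ordinal i0n)) //= eqxx mul1r big1 ?addr0 //; first exact/eqP.
  by move=> i /negbTE ->; rewrite mul0r.
case: ps; apply: faithC => c; have [a ->] := gen c.
rewrite scaler_sumr big1 // => i _.
have [u Uu eu] := Us i (ltn_ord i).
rewrite scalerA mulrC -scalerA (_ : s *: g i = 0) ?scaler0 // -Uu.
rewrite (bigD1 i) //= eu // eqxx mulr1 big1 ?addr0 // => l ne.
by rewrite eu // val_eqE (negbTE ne) mulr0 scale0r.
Qed.

Lemma module_nontrivial : exists c : C, c != 0.
Proof.
apply: contrapT => /forallNP N; have /eqP := oner_neq0 R; apply.
apply: faithC => c; rewrite scale1r; apply/eqP; apply: contrapT => /negP; exact: N.
Qed.

(** Rank one: [u |-> phi u *: c0] is the homothety of some [a]. If [phi c = 0] with [c] nonzero,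
    torsion-freeness gives [a = 0], which fails at [c0], where [phi c0] is nonzero. *)
Lemma exists_injective_functional :
  exists2 phi : C -> R, linear (phi : C -> R^o) & forall c, phi c = 0 -> c = 0.
Proof.
have [c1 c10] := module_nontrivial.
have [phi lphi [c0 pc0]] := exists_functional c10; exists phi => // c pc.
apply: contrapT => /eqP cn0.
have lf (x : C) : linear (fun u => (phi u : R) *: x).
  by move=> a u v; rewrite lphi scalerDl scalerA.
have [a ea] := endC (mk_linear (lf c0)).
have a0 : a = 0.
  by have := ea c; rewrite /= pc scale0r => /esym/torsion_free[|/eqP] //; rewrite (negbTE cn0).
have := ea c0; rewrite /= a0 scale0r => /torsion_free[|] e; first by rewrite e eqxx in pc0.
by move: pc0; rewrite e; have /= := raddf0 (mk_linear lphi) => ->; rewrite eqxx.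
Qed.

(** [iota] presents [C] as a fractional ideal.  It is reflexive by the Ext
    condition, and the monomial hull of a fractional ideal lies in its
    reflexive hull, since [psi R] is cut out by weights. *)
Theorem monomial_presentation : exists iota : C -> P,
  [/\ forall c1 c2, iota (c1 + c2) = iota c1 + iota c2,
      forall r c, iota (r *: c) = psi r * iota c,
      forall c, iota c = 0 -> c = 0,
      exists2 d0, d0 != 0 & forall c, exists r, psi r = d0 * iota c
    & forall c m, m \in msupp (iota c) -> exists c', iota c' = 'X_[m]].
Proof.
have [phi lphi phi_inj] := exists_injective_functional.
have phiD c1 c2 : phi (c1 + c2) = phi c1 + phi c2 by have := raddfD (mk_linear lphi) c1 c2.
have phiZ r c : phi (r *: c) = r * phi c by have := linearZ_LR (mk_linear lphi) r c.
have [n [g gen]] := fgC.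
have [i0 gi0] : exists i0, psi (phi (g i0)) != 0.
  apply: contrapT => /forallNP N; have [c c0] := module_nontrivial.
  have [a ea] := gen c; case/eqP: c0; rewrite ea big1 // => i _.
  rewrite (phi_inj (g i)) ?scaler0 //; apply: psi_inj; rewrite rmorph0.
  by apply/eqP; apply: contrapT => /negP; apply: N.
(* Dividing by the gcd of the generators makes the fractional ideal coprime in [P]: a fraction that
   multiplies it into [P] lies in [P]. *)
have [d0 [h [d00 eh gcdh]]] := gcd_family (@factorial_mpoly k d) (g := fun i => psi (phi (g i))) gi0.
have iotaE c : exists f, psi (phi c) = d0 * f.
  have [a ->] := gen c; exists (\sum_i psi (a i) * h i).
  rewrite (big_morph phi phiD (id1 := 0)); last by have /= := raddf0 (mk_linear lphi).
  rewrite rmorph_sum mulr_sumr; apply: eq_bigr => i _.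
  by rewrite phiZ rmorphM eh mulrCA.
have [iota iE] := choice iotaE.
have iD c1 c2 : iota (c1 + c2) = iota c1 + iota c2.
  by apply: (mulfI d00); rewrite -iE phiD rmorphD !iE mulrDr.
have iZ r c : iota (r *: c) = psi r * iota c.
  by apply: (mulfI d00); rewrite -iE phiZ rmorphM iE mulrCA.
have i_inj c : iota c = 0 -> c = 0.
  by move=> e; apply: phi_inj; apply: psi_inj; rewrite iE e mulr0 rmorph0.
have i_inj2 c1 c2 : iota c1 = iota c2 -> c1 = c2.
  move=> e; apply/eqP; rewrite -subr_eq0; apply/eqP/i_inj.
  by rewrite iD e -scaleN1r iZ rmorphN1 mulN1r subrr.
have ig i : iota (g i) = h i by apply: (mulfI d00); rewrite -iE eh.
have gcdi a b : b != 0 -> (forall c, divs b (a * iota c)) -> divs b a.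
  by move=> b0 H; apply: gcdh => // i; rewrite -ig.
exists iota; split=> //; first by exists d0 => // c; exists (phi c).
move=> c m mc.
have ic0 : iota c != 0 by apply: contraTneq mc => ->; rewrite msupp0.
(* [J] is the dual of the fractional ideal [iota C]. By weights it also multiplies each monomial of
   an [iota c] into the image of [R]. *)
pose J f := forall c, exists r, psi r = f * iota c.
have Jd0 : J d0 by move=> c'; exists (phi c').
have JX f c' : J f -> forall l, l \in msupp (iota c') -> exists r, psi r = f * 'X_[l].
  move=> Jf l lc'; apply/imageP => l' l'f t.
  have i0' : iota c' != 0 by apply: contraTneq lc' => ->; rewrite msupp0.
  apply: (weight_monomial_factor (wD t) i0') l'f => // l2.
  by have /imageP H := Jf c'; move=> /H.
pose z := phi c; have ez : psi z = d0 * iota c by rewrite iE.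
have z0 : psi z != 0 by rewrite ez mulf_neq0.
have [r0 er0] := JX _ _ Jd0 _ mc.
(* The image of [c1] is [psi z * 'X_[m]], so it remains to divide [c1] by [z] inside [C]. *)
pose c1 := r0 *: c.
have ec1 : iota c1 = psi z * 'X_[m] by rewrite iZ er0 ez mulrAC.
have red1 : reduces Q (fun=> z) 1.
  apply: (reducesS nR fgC faithC (reduces0 (fun=> z) endC faithC extC)) => r /pspan0 /integral[e|].
    by move: z0; rewrite e rmorph0 eqxx.
  by move=> ->; apply/pspan0.
have pspan1 (M : lmodType R) (x : M) : pspan (fun=> z) 1 x <-> exists y, x = z *: y.
  split=> [[y]|[y ->]]; first by rewrite big_ord1 => ->; exists (y 0%N).
  by exists (fun=> y); rewrite big_ord1.
suff [y ey] : exists y, c1 = z *: y.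
  by exists y; apply: (mulfI z0); rewrite -ec1 ey iZ.
apply/pspan1; apply: contrapT => /(pspan_associated nR fgC faithC red1)[a [na Ha]]; apply: na.
(* Multiplication by [a / z] preserves [J]. Hence the powers of [a / z] have the common denominator
   [d0], which puts [a / z] into [P], and then into [psi R] by weights. *)
have step f : J f -> exists2 f', J f' & psi a * f = f' * psi z.
  move=> Jf.
  have H c' : exists e, psi a * (f * iota c') = psi e * psi z.
    have [b eb] := Jf c'.
    have Kb : pspan (fun=> z) 1 (b *: c1).
      have [r' er'] := JX _ _ Jf _ mc.
      apply/pspan1; exists (r' *: c'); apply: i_inj2.
      by rewrite iZ ec1 eb [iota (z *: _)]iZ [iota (r' *: _)]iZ er'; ring.
    have /pspan1[e ee] := Ha b Kb; exists e.
    by rewrite -eb -!rmorphM mulrC ee mulrC.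
  have [f' ef'] : divs (psi z) (psi a * f).
    by apply: gcdi => // c'; have [e ee] := H c'; exists (psi e); rewrite -mulrA ee.
  exists f' => // c'; have [e ee] := H c'; exists e.
  by apply: (mulIf z0); rewrite -ee mulrA ef' mulrAC.
have pow n' : exists2 f', J f' & psi a ^+ n' * d0 = f' * psi z ^+ n'.
  elim: n' => [|n' [f' Jf' ef']]; first by exists d0; rewrite ?mulr1 ?mul1r.
  have [f2 Jf2 ef2] := step _ Jf'; exists f2 => //.
  by rewrite exprS -mulrA ef' mulrA ef2 exprS; ring.
have [f ef] : divs (psi z) (psi a).
  apply: (divs_of_exp (@factorial_mpoly k d) d00 z0) => n'.
  by have [f' _ e] := pow n'; exists f'.
have [r er] : exists r, psi r = f.
  apply/imageP => l lf t; apply: (weight_power_bounded (wD t) (g := d0 * iota c)) lf.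
    by rewrite mulf_neq0.
  move=> n' l' l'f; have [f' Jf' ef'] := pow n'.
  have : f' = f ^+ n' * d0.
    apply: (mulIf (expf_neq0 n' z0)); rewrite -ef' ef exprMn; ring.
  have /imageP Hl := Jf' c; move=> e; apply: Hl.
  by rewrite e -mulrA.
apply/pspan1; exists r; apply: psi_inj; rewrite [LHS]ef -er.
by rewrite [z *: _]/(z * _) rmorphM mulrC.
Qed.

End MonomialModule.

(** * Dual bases *)

Section FreeResolution.
Variable R : comNzRingType.

(** As in the dual basis lemma: [M] is a direct summand of a free module of rank [n]. *)
Definition has_coordinates (M : lmodType R) := exists n (e : 'I_n -> M) (co : M -> 'I_n -> R),
  [/\ forall x, x = \sum_i co x i *: e i, forall x y i, co (x + y) i = co x i + co y i
    & forall a x i, co (a *: x) i = a * co x i].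

Lemma rV_coordinates n : has_coordinates 'rV[R]_n.
Proof.
exists n, (fun i => delta_mx 0 i), (fun (x : 'rV[R]_n) i => x 0 i).
by split=> [x|x y i|a x i]; rewrite ?mxE // -row_sum_delta.
Qed.

Lemma rV_projective n : projective 'rV[R]_n.
Proof.
move=> A B g f gs; have [h eh] := choice (fun i : 'I_n => gs (f (delta_mx 0 i))).
have hl : linear (fun v : 'rV[R]_n => \sum_i v 0 i *: h i).
  move=> a u v; rewrite scaler_sumr -big_split; apply: eq_bigr => i _.
  by rewrite !mxE scalerDl scalerA.
exists (mk_linear hl) => v; rewrite /= linear_sum [in RHS](row_sum_delta v) linear_sum.
by apply: eq_bigr => i _; rewrite !linearZ eh.
Qed.

Hypothesis nR : noetherian R.

Lemma kernel_matrix n (M : lmodType R) (f : {linear 'rV[R]_n -> M}) :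
  exists w : {p & 'M[R]_(p, n)}, forall y, f y = 0 <-> exists z, z *m projT2 w = y.
Proof.
have [|s [s0 ker]] := noetherian_rV nR (A := fun y => f y = 0).
  split=> [|x y ex ey|a x ex]; first exact: linear0.
    by rewrite linearD ex ey addr0.
  by rewrite linearZ ex /= scaler0.
have rowE z : z *m (\matrix_(i < size s) s`_i) = \sum_i z 0 i *: s`_i.
  by rewrite mulmx_sum_row; apply: eq_bigr => i _; rewrite rowK.
exists (existT _ (size s) (\matrix_(i < size s) s`_i)) => y; split=> [/ker/spanE[c e]|[z <-]] /=.
  by exists (\row_i c i); rewrite rowE e; apply: eq_bigr => i _; rewrite mxE.
rewrite rowE linear_sum big1 // => i _; rewrite linearZ /= s0 ?scaler0 //.
exact: mem_nth.
Qed.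

Lemma exists_free_resolution (C : lmodType R) : fin_gen C ->
  exists P : proj_resolution C, forall n, has_coordinates (res_obj P n).
Proof.
move=> [n0 [g gen]].
have augl : linear (fun v : 'rV[R]_n0 => \sum_i v 0 i *: g i).
  move=> a u v; rewrite scaler_sumr -big_split; apply: eq_bigr => i _.
  by rewrite !mxE scalerDl scalerA.
(* A stage of the resolution carries its matrix together with the sizes, so that the recursion has a
   fixed type. *)
pose T := {m : nat & {n : nat & 'M[R]_(m, n)}}.
have mulr m n (A : 'M[R]_(m, n)) : linear (fun x : 'rV[R]_m => x *m A).
  by move=> a x y; rewrite mulmxDl scalemxAl.
pose ker (t : T) := cid (kernel_matrix (mk_linear (mulr _ _ (projT2 (projT2 t))))).
pose nxt (t : T) : T := existT _ (projT1 (sval (ker t))) (existT _ (projT1 t) (projT2 (sval (ker t)))).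
pose w0 := cid (kernel_matrix (mk_linear augl)).
pose fix s i : T := if i is j.+1 then nxt (s j)
  else existT _ (projT1 (sval w0)) (existT _ n0 (projT2 (sval w0))).
pose obj i : lmodType R := 'rV[R]_(projT1 (projT2 (s i))).
pose dif i : {linear obj i.+1 -> obj i} := mk_linear (mulr _ _ (projT2 (projT2 (s i)))).
unshelve eexists (@ProjResolution _ C obj dif (mk_linear augl) _ _ _ _).
- by move=> n; apply: rV_projective.
- move=> x; have [a ->] := gen x; exists (\row_i a i).
  by apply: eq_bigr => i _; rewrite mxE.
- exact: (svalP w0).
- by move=> n y; apply: (svalP (ker (s n))).
by move=> n; apply: rV_coordinates.
Qed.

End FreeResolution.

Section DualBases.
Variables (R : comNzRingType) (C : lmodType R) (I : finType).
Variables (E : R -> Prop) (b : I -> R) (c : I -> C) (tau : C -> R).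
Hypothesis nR : noetherian R.
Hypothesis E_tau : forall x, E (tau x).
Hypothesis tauD : forall x y, tau (x + y) = tau x + tau y.
Hypothesis tauZ : forall e x, E e -> tau (e *: x) = e * tau x.
Hypothesis expand_ring : forall r, r = \sum_i tau (r *: c i) * b i.
Hypothesis expand_module : forall x, x = \sum_i tau (b i *: x) *: c i.
Hypothesis tau_dual : forall i j, tau (b i *: c j) = (i == j)%:R.

Let tau0 : tau 0 = 0.
Proof. by apply: (addrI (tau 0)); rewrite -tauD !addr0. Qed.

Let tau_sum (J : finType) (F : J -> C) : tau (\sum_j F j) = \sum_j tau (F j).
Proof. exact: (big_morph tau tauD tau0). Qed.

Definition partially_linear (M N : lmodType R) (f : M -> N) :=
  (forall x y, f (x + y) = f x + f y) /\ forall e x, E e -> f (e *: x) = e *: f x.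

Lemma partially_linear_sum (M N : lmodType R) (f : M -> N) (J : finType) (F : J -> M) :
  partially_linear f -> f (\sum_j F j) = \sum_j f (F j).
Proof.
move=> [fD _]; apply: (big_morph f fD).
by apply: (addrI (f 0)); rewrite -fD !addr0.
Qed.

(** Over [E] the elements [b i *: e j] span [M], with coordinates read off by [tau]; preimages are
    chosen for these. *)
Lemma partially_linear_lift (M N B : lmodType R) (u : M -> B) (d : {linear N -> B}) :
  has_coordinates M -> partially_linear u -> (forall x, exists y, d y = u x) ->
  exists2 s : M -> N, partially_linear s & forall x, d (s x) = u x.
Proof.
move=> [n [e [co [coE coD coZ]]]] lu ud; have [uD uZ] := lu.
have [p ep] := choice (fun ij : 'I_n * I => ud (b ij.2 *: e ij.1)).
exists (fun x => \sum_j \sum_i tau (co x j *: c i) *: p (j, i)).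
  split=> [x y|a x Ea].
    rewrite -big_split; apply: eq_bigr => j _; rewrite -big_split; apply: eq_bigr => i _.
    by rewrite coD scalerDl tauD scalerDl.
  rewrite scaler_sumr; apply: eq_bigr => j _; rewrite scaler_sumr; apply: eq_bigr => i _.
  by rewrite coZ -scalerA tauZ // scalerA.
move=> x; rewrite [in RHS](coE x) (partially_linear_sum _ lu) linear_sum.
apply: eq_bigr => j _; rewrite linear_sum [in RHS](expand_ring (co x j)) scaler_suml.
rewrite (partially_linear_sum _ lu); apply: eq_bigr => i _.
by rewrite linearZ /= ep -scalerA [RHS]uZ.
Qed.

(** Over the subring [E] the module [C] and the resolution are free, so the
    resolution splits. *)
Lemma partial_splitting (P : proj_resolution C) :
  (forall n, has_coordinates (res_obj P n)) -> forall n,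
  exists2 s : res_obj P n -> res_obj P n.+1, partially_linear s
    & forall x, res_diff P n (s (res_diff P n x)) = res_diff P n x.
Proof.
move=> free; elim=> [|n [s [sD sZ] ds]].
  have [p ep] := choice (fun i => @res_aug_surj _ _ P (c i)).
  pose s0 x : res_obj P 0 := \sum_i tau (b i *: x) *: p i.
  have s0D x y : s0 (x + y) = s0 x + s0 y.
    rewrite -big_split; apply: eq_bigr => i _.
    by rewrite scalerDr tauD scalerDl.
  have s0Z e x : E e -> s0 (e *: x) = e *: s0 x.
    move=> Ee; rewrite scaler_sumr; apply: eq_bigr => i _.
    by rewrite scalerA mulrC -scalerA tauZ // scalerA.
  have as0 x : res_aug P (s0 x) = x.
    by rewrite linear_sum [RHS]expand_module; apply: eq_bigr => i _; rewrite linearZ /= ep.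
  have [||s ls es] := @partially_linear_lift _ _ _ (fun x => x - s0 (res_aug P x)) (res_diff P 0) (free 0%N).
  - split=> [x y|e x Ee]; first by rewrite linearD s0D opprD addrACA.
    by rewrite linearZ s0Z // scalerBr.
  - by move=> x; apply/res_exact0; rewrite linearB /= as0 subrr.
  exists s => // x; rewrite es [res_aug P _](res_diff_cycle x).
  suff -> : s0 0 = 0 by rewrite subr0.
  by rewrite /s0 big1 // => i _; rewrite scaler0 tau0 scale0r.
have s0 : s 0 = 0 by apply: (addrI (s 0)); rewrite -sD !addr0.
have [||s' ls es] := @partially_linear_lift _ _ _ (fun x => x - s (res_diff P n x)) (res_diff P n.+1) (free n.+1).
- split=> [x y|e x Ee]; first by rewrite linearD sD opprD addrACA.
  by rewrite linearZ sZ // scalerBr.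
- by move=> x; apply/res_exact; rewrite linearB /= ds subrr.
by exists s' => // x; rewrite es [res_diff P n _](res_diff_cycle x) s0 subr0.
Qed.

(** The adjunction between [E]-linear maps [M -> E] and [R]-linear maps [M -> C], where [C] plays
    the part of [Hom_E(R, E)]. *)
Lemma expand_partially_linear (M : lmodType R) (f : M -> R^o) : partially_linear f ->
  (forall x, E (f x)) -> linear (fun x => \sum_j (f (b j *: x) : R) *: c j).
Proof.
move=> lf Ef; have [fD fZ] := lf.
have tau_expand x l : tau (b l *: (\sum_j (f (b j *: x) : R) *: c j)) = f (b l *: x).
  rewrite scaler_sumr tau_sum (bigD1 l) //= big1 ?addr0 => [|m ne].
    by rewrite scalerA mulrC -scalerA tauZ // tau_dual eqxx mulr1.
  by rewrite scalerA mulrC -scalerA tauZ // tau_dual eq_sym (negbTE ne) mulr0.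
move=> r x y.
have -> : \sum_j (f (b j *: (r *: x + y)) : R) *: c j =
    \sum_j (f (b j *: (r *: x)) : R) *: c j + \sum_j (f (b j *: y) : R) *: c j.
  by rewrite -big_split; apply: eq_bigr => j _; rewrite scalerDr fD scalerDl.
congr (_ + _); rewrite [RHS]expand_module; apply: eq_bigr => j _; congr (_ *: _).
rewrite !scalerA (expand_ring (b j * r)) !scaler_suml (partially_linear_sum _ lf) tau_sum.
by apply: eq_bigr => l _; rewrite -!scalerA fZ // tauZ // tau_expand.
Qed.

(** [C] is [Hom_E(R, E)], and [R] and [C] are free over [E]. By adjunction
    [Hom_R(C, C) = Hom_E(C, E) = R], and a cocycle with values in [C] corresponds to one with values
    in [E], where the resolution splits. *)
Theorem dual_bases_semidualizing : semidualizing C.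
Proof.
have fgC : fin_gen C.
  exists #|I|, (fun l => c (enum_val l)) => x.
  exists (fun l => tau (b (enum_val l) *: x)).
  rewrite [LHS]expand_module (reindex_onto enum_val enum_rank) => [|i _]; last exact: enum_rankK.
  by apply: eq_bigl => l; rewrite enum_valK eqxx.
split=> // [|[//|i] _].
- have smulP r : (fun x : C => r *: x) \in @linear_pred R C C.
    by apply/asboolP => a x y; rewrite scalerDr !scalerA mulrC.
  have hl (h : Hom C C) : linear (hom_fun h) by apply/asboolP; apply: hom_linear.
  pose F (h : Hom C C) : R := \sum_i tau (hom_fun h (c i)) * b i.
  have hE (h : Hom C C) x : hom_fun h x = F h *: x.
    pose h' := mk_linear (hl h).
    have h'E y : hom_fun h y = h' y by [].
    rewrite [LHS]expand_module [RHS]expand_module; apply: eq_bigr => j _; congr (_ *: _).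
    rewrite h'E -linearZ /= [X in tau X = _](_ : _ = \sum_i tau (b i *: (b j *: x)) *: hom_fun h (c i)).
      rewrite (_ : b j *: (F h *: x) = F h *: (b j *: x)); last by rewrite !scalerA mulrC.
      rewrite /F scaler_suml !tau_sum.
      by apply: eq_bigr => i _; rewrite tauZ // -scalerA [in RHS]tauZ // mulrC.
    rewrite h'E {1}(expand_module (b j *: x)) linear_sum; apply: eq_bigr => i _.
    by rewrite linearZ.
  have FZ (r : R) (h1 h2 : Hom C C) : F (r *: h1 + h2) = r * F h1 + F h2.
    have e (x : C) : F (r *: h1 + h2) *: x = (r * F h1 + F h2) *: x.
        transitivity (hom_fun (r *: h1 + h2) x); first by rewrite hE.
      transitivity (r *: hom_fun h1 x + hom_fun h2 x); first by [].
      by rewrite !hE scalerDl scalerA.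
    rewrite (expand_ring (F _)) [RHS]expand_ring; apply: eq_bigr => i _.
    by rewrite e.
  have Fl : linear (F : Hom C C -> R^o) by move=> r h1 h2; rewrite FZ.
  exists (mk_linear Fl); exists (fun r => MkHom (smulP r)) => [h|r] /=.
    by apply: val_inj; apply/funext => x; exact: esym (hE h x).
  by rewrite /F /= -expand_ring.
have [P free] := exists_free_resolution nR fgC; exists P => f cf.
have [s [sD sZ] ds] := partial_splitting free i.
(* The splitting [s] provides a primitive of the cocycle over [E]; the adjunction makes it
   [R]-linear. *)
pose g x : R^o := tau (f (s x)).
have lg : partially_linear g.
  split=> [x y|e x Ee]; rewrite /g; first by rewrite sD linearD tauD.
  by rewrite sZ // linearZ tauZ.
exists (mk_linear (expand_partially_linear lg (fun x => E_tau _))) => x /=.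
rewrite [LHS]expand_module; apply: eq_bigr => j _; congr (_ *: _).
rewrite -!linearZ /= /g.
have [y ey] : exists y, res_diff P i.+1 y = s (res_diff P i (b j *: x)) - b j *: x.
  by apply/res_exact; rewrite linearB /= ds subrr.
congr tau; apply/eqP; rewrite eq_sym -subr_eq0 -linearB /= -ey.
by apply/eqP; exact: cf.
Qed.

End DualBases.

(** * Induced and coinduced layers *)

Section Layers.
Variable P : comNzRingType.
Implicit Types A B C E T : P -> Prop.

Definition layer n A (g : 'I_n -> P) (f : P) : Prop :=
  exists x : 'I_n -> P, (forall j, A (x j)) /\ f = \sum_j x j * g j.

Definition direct n A (g : 'I_n -> P) :=
  forall x : 'I_n -> P, (forall j, A (x j)) -> \sum_j x j * g j = 0 -> forall j, x j = 0.

Definition sum_closed A := A 0 /\ forall x y, A x -> A y -> A (x + y).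

Definition mul_into A B C := forall x y, A x -> B y -> C (x * y).

Lemma sum_closed_sum A (I : Type) (r : seq I) (Q : pred I) (F : I -> P) :
  sum_closed A -> (forall i, Q i -> A (F i)) -> A (\sum_(i <- r | Q i) F i).
Proof. by move=> [A0 AD] AF; apply: (big_ind A). Qed.

Lemma layer_sum_closed n A (g : 'I_n -> P) : sum_closed A -> sum_closed (layer A g).
Proof.
move=> [A0 AD]; split=> [|_ _ [x [Ax ->]] [y [Ay ->]]].
  by exists (fun=> 0); split=> //; rewrite big1 // => j _; rewrite mul0r.
exists (fun j => x j + y j); split=> [j|]; first exact: AD.
by rewrite -big_split; apply: eq_bigr => j _; rewrite mulrDl.
Qed.

Lemma layer_mul n1 n2 n3 A B C E (g : 'I_n1 -> P) (h : 'I_n2 -> P) (f : 'I_n3 -> P) :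
  sum_closed C -> mul_into A B C -> mul_into E C C ->
  (forall j l, layer E f (g j * h l)) -> mul_into (layer A g) (layer B h) (layer C f).
Proof.
move=> sC ABC ECC gh _ _ [x [Ax ->]] [y [By ->]].
rewrite big_distrlr /=; have [lC0 lCD] := layer_sum_closed f sC.
apply: sum_closed_sum => // j _; apply: sum_closed_sum => // l _.
have [ka [Eka eka]] := gh j l.
rewrite mulrACA eka; exists (fun m => ka m * (x j * y l)); split=> [m|].
  by apply: (ECC _ _ (Eka m)); apply: ABC.
by rewrite mulr_sumr; apply: eq_bigr => m _; ring.
Qed.

Lemma layer_incl n A (g : 'I_n.+1 -> P) x : g ord0 = 1 -> A 0 -> A x -> layer A g x.
Proof.
move=> g0 A0 Ax; exists (fun j => if j == ord0 then x else 0); split=> [j|].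
  by case: eqP.
by rewrite big_ord_recl g0 mulr1 big1 ?addr0 // => j _; rewrite mul0r.
Qed.

Lemma layer_gen n A (g : 'I_n -> P) j : A 0 -> A 1 -> layer A g (g j).
Proof.
move=> A0 A1; exists (fun l => (l == j)%:R); split=> [l|]; first by case: eqP.
rewrite (bigD1 j) //= eqxx mul1r big1 ?addr0 // => l /negbTE ->.
by rewrite mul0r.
Qed.

Lemma layer_mono n A B (g : 'I_n -> P) f : (forall x, A x -> B x) -> layer A g f -> layer B g f.
Proof. by move=> AB [x [Ax ->]]; exists x; split=> // j; apply: AB. Qed.

(** The hypotheses of [dual_bases_semidualizing] for subsets of one ring [P]: [T] is the ring, [C]
    the module and [E] the base over which they are dual. *)
Record dual_data T C E (I : finType) (b c : I -> P) (tau : P -> P) : Prop := DualData {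
  dual_T : [/\ sum_closed T, mul_into T T T, T 1 & T (-1)];
  dual_C : sum_closed C /\ mul_into T C C;
  dual_E : [/\ sum_closed E, mul_into E E E & forall x, E x -> T x];
  dual_b : forall i, T (b i);
  dual_c : forall i, C (c i);
  dual_tau : forall x, C x -> E (tau x);
  dual_tauD : forall x y, C x -> C y -> tau (x + y) = tau x + tau y;
  dual_tauZ : forall e x, E e -> C x -> tau (e * x) = e * tau x;
  dual_ring : forall r, T r -> r = \sum_i tau (r * c i) * b i;
  dual_module : forall x, C x -> x = \sum_i tau (b i * x) * c i;
  dual_pairing : forall i j, tau (b i * c j) = (i == j)%:R
}.

Lemma direct_unique n A (g : 'I_n -> P) (x y : 'I_n -> P) : direct A g ->
  sum_closed A -> (forall z, A z -> A (- z)) -> (forall j, A (x j)) -> (forall j, A (y j)) ->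
  \sum_j x j * g j = \sum_j y j * g j -> forall j, x j = y j.
Proof.
move=> dA [_ AD] AN Ax Ay e j; apply/eqP; rewrite -subr_eq0; apply/eqP.
apply: (dA (fun j => x j - y j)) => [l|]; first by apply: AD => //; apply: AN.
by under eq_bigr do rewrite mulrBl; rewrite sumrB e subrr.
Qed.

Section Steps.
Variables (T C E : P -> Prop) (I : finType) (b c : I -> P) (tau : P -> P).
Hypothesis D : dual_data T C E b c tau.
Variables (n : nat) (y e : 'I_n.+1 -> P).
Hypothesis y0 : y ord0 = 1.
Hypothesis yy : forall j l, layer E y (y j * y l).

Let sT : sum_closed T. Proof. by case: (dual_T D). Qed.
Let TT : mul_into T T T. Proof. by case: (dual_T D). Qed.
Let T1 : T 1. Proof. by case: (dual_T D). Qed.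
Let TN1 : T (-1). Proof. by case: (dual_T D). Qed.
Let sC : sum_closed C. Proof. by case: (dual_C D). Qed.
Let TC : mul_into T C C. Proof. by case: (dual_C D). Qed.
Let sE : sum_closed E. Proof. by case: (dual_E D). Qed.
Let EE : mul_into E E E. Proof. by case: (dual_E D). Qed.
Let ET x : E x -> T x. Proof. by case: (dual_E D) => _ _; apply. Qed.
Let EC : mul_into E C C. Proof. by move=> x z /ET Tx; apply: TC. Qed.
Let CN x : C x -> C (- x). Proof. by rewrite -mulN1r; apply: TC. Qed.

Let layer_T : [/\ sum_closed (layer T y), mul_into (layer T y) (layer T y) (layer T y),
  layer T y 1 & layer T y (-1)].
Proof.
split; first exact: layer_sum_closed.
- by apply: (layer_mul sT TT) yy => x z /ET; apply: TT.
- by apply: layer_incl => //; case: sT.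
- by apply: layer_incl => //; case: sT.
Qed.

(** [layer C e] is the coinduced module, with [e] dual to [y]: the coefficient of [e ord0] in
    [y j * e l] is the pairing, so [tau'] is [tau] of that coefficient. The base is kept and the
    dual bases are multiplied. *)
Lemma dual_coinduced : (forall j l, exists ka : 'I_n.+1 -> P,
    [/\ forall m, E (ka m), ka ord0 = (j == l)%:R & y j * e l = \sum_m ka m * e m]) ->
  direct C e ->
  exists tau', dual_data (layer T y) (layer C e) E
     (fun ij : I * 'I_n.+1 => b ij.1 * y ij.2) (fun ij => c ij.1 * e ij.2) tau' /\
   forall x j l, C x -> tau' (x * (y j * e l)) = (j == l)%:R * tau x.
Proof.
move=> ye de.
have [dec decP] := @choice_on _ _ (layer C e)
  (fun f (x : 'I_n.+1 -> P) => (forall j, C (x j)) /\ f = \sum_j x j * e j) (fun=> 0) (fun f H => H).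
pose tau' f := tau (dec f ord0).
have tau'E (x : 'I_n.+1 -> P) : (forall j, C (x j)) -> tau' (\sum_j x j * e j) = tau (x ord0).
  move=> Cx; have [|C1 e1] := decP (\sum_j x j * e j); first by exists x.
  by rewrite /tau'; congr tau; symmetry; apply: (direct_unique de).
have key x j l : C x -> tau' (x * (y j * e l)) = (j == l)%:R * tau x.
  move=> Cx; have [ka [Eka ka0 ->]] := ye j l.
  have -> : x * (\sum_m ka m * e m) = \sum_m (ka m * x) * e m.
    by rewrite mulr_sumr; apply: eq_bigr => m _; ring.
  rewrite tau'E => [|m]; last exact: EC.
  by rewrite (dual_tauZ D) // ka0.
have slC := layer_sum_closed e sC.
have [lC0 lCD] := slC.
have tau'D f1 f2 : layer C e f1 -> layer C e f2 -> tau' (f1 + f2) = tau' f1 + tau' f2.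
  move=> [x1 [Cx1 ->]] [x2 [Cx2 ->]]; rewrite !tau'E // -(dual_tauD D) //.
  rewrite -big_split /=; under eq_bigr do rewrite -mulrDl.
  by rewrite tau'E // => j; case: sC => _; apply.
have tau'0 : tau' 0 = 0 by apply: (addrI (tau' 0)); rewrite -tau'D // !addr0.
have tau'_sum (J : finType) (F : J -> P) : (forall j, layer C e (F j)) ->
    tau' (\sum_j F j) = \sum_j tau' (F j).
  move=> CF; pose Q u v := layer C e u /\ tau' u = v.
  suff [] : Q (\sum_j F j) (\sum_j tau' (F j)) by [].
  apply: big_ind2 => // u1 u2 v1 v2 [Cu1 <-] [Cv1 <-].
  by split; [apply: lCD|apply: tau'D].
have lTC : mul_into (layer T y) (layer C e) (layer C e).
  apply: (layer_mul sC TC EC) => j l; have [ka [Eka _ ->]] := ye j l.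
  by exists ka.
have gen x j l : C x -> layer C e (x * (y j * e l)).
  move=> Cx; have [ka [Eka _ ->]] := ye j l.
  exists (fun m => ka m * x); split=> [m|]; first exact: EC.
  by rewrite mulr_sumr; apply: eq_bigr => m _; ring.
exists tau'; split=> //; split=> //.
- by split=> // x Ex; apply: layer_incl => //; [case: sT|apply: ET].
- move=> [i j] /=; exists (fun l => if l == j then b i else 0); split=> [l|].
    by case: eqP => _; [apply: (dual_b D)|case: sT].
  by rewrite (bigD1 j) //= eqxx big1 ?addr0 // => l /negbTE ->; rewrite mul0r.
- move=> [i j] /=; exists (fun l => if l == j then c i else 0); split=> [l|].
    by case: eqP => _; [apply: (dual_c D)|case: sC].
  by rewrite (bigD1 j) //= eqxx big1 ?addr0 // => l /negbTE ->; rewrite mul0r.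
- by move=> _ [x [Cx ->]]; rewrite tau'E //; apply: (dual_tau D).
- move=> a _ Ea [x [Cx ->]]; rewrite mulr_sumr; under eq_bigr do rewrite mulrA.
  by rewrite !tau'E // => [|j]; [apply: (dual_tauZ D)|apply: EC].
- move=> _ [r [Tr ->]].
  rewrite -(pair_bigA _ (fun i l => tau' ((\sum_j r j * y j) * (c i * e l)) * (b i * y l))) /=.
  rewrite exchange_big; apply: eq_bigr => l _ /=.
  rewrite {1}(dual_ring D (Tr l)) mulr_suml; apply: eq_bigr => i _.
  rewrite -mulrA; congr (_ * _).
  have -> : (\sum_j r j * y j) * (c i * e l) = \sum_j (r j * c i) * (y j * e l).
    by rewrite mulr_suml; apply: eq_bigr => j _; ring.
  have Crc j : C (r j * c i) by apply: TC => //; apply: (dual_c D).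
  rewrite tau'_sum => [|j]; last exact: gen.
  rewrite (bigD1 l) //= key // eqxx mul1r big1 ?addr0 // => j /negbTE ne.
  by rewrite key // ne mul0r.
- move=> _ [x [Cx ->]].
  rewrite -(pair_bigA _ (fun i l => tau' ((b i * y l) * (\sum_j x j * e j)) * (c i * e l))) /=.
  rewrite exchange_big; apply: eq_bigr => l _ /=.
  rewrite {1}(dual_module D (Cx l)) mulr_suml; apply: eq_bigr => i _.
  rewrite -mulrA; congr (_ * _).
  have -> : (b i * y l) * (\sum_j x j * e j) = \sum_j (b i * x j) * (y l * e j).
    by rewrite mulr_sumr; apply: eq_bigr => j _; ring.
  have Cbx j : C (b i * x j) by apply: TC => //; apply: (dual_b D).
  rewrite tau'_sum => [|j]; last exact: gen.
  rewrite (bigD1 l) //= key // eqxx mul1r big1 ?addr0 // => j ne.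
  by rewrite key // eq_sym (negbTE ne) mul0r.
move=> [i j] [i' j'] /=; rewrite mulrACA key; last by apply: TC; [apply: (dual_b D)|apply: (dual_c D)].
rewrite (dual_pairing D) -mulnb natrM mulrC; congr (_ * _).
Qed.

(** Extension of scalars: base, ring and module all acquire the layer [y]. The dual bases stay the
    same, since [tau] is applied coefficientwise. *)
Lemma dual_induced : direct C y ->
  exists tau', dual_data (layer T y) (layer C y) (layer E y) b c tau'.
Proof.
move=> dy.
have [dec decP] := @choice_on _ _ (layer C y)
  (fun f (x : 'I_n.+1 -> P) => (forall j, C (x j)) /\ f = \sum_j x j * y j) (fun=> 0) (fun f H => H).
pose tau' f := \sum_j tau (dec f j) * y j.
have tau'E (x : 'I_n.+1 -> P) : (forall j, C (x j)) ->
    tau' (\sum_j x j * y j) = \sum_j tau (x j) * y j.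
  move=> Cx; have [|C1 e1] := decP (\sum_j x j * y j); first by exists x.
  rewrite /tau'; apply: eq_bigr => j _; congr (tau _ * _); symmetry.
  exact: (direct_unique dy).
have lTC : mul_into (layer T y) (layer C y) (layer C y) by apply: (layer_mul sC TC EC).
have tau'D f1 f2 : layer C y f1 -> layer C y f2 -> tau' (f1 + f2) = tau' f1 + tau' f2.
  move=> [x1 [Cx1 ->]] [x2 [Cx2 ->]]; rewrite !tau'E // -!big_split /=.
  under eq_bigr do rewrite -mulrDl.
  rewrite tau'E => [|j]; last by case: sC => _; apply.
  by apply: eq_bigr => j _; rewrite (dual_tauD D) // mulrDl.
have slC := layer_sum_closed y sC.
have [lC0 lCD] := slC.
have tau'0 : tau' 0 = 0 by apply: (addrI (tau' 0)); rewrite -tau'D // !addr0.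
have tau'_sum (J : finType) (F : J -> P) : (forall j, layer C y (F j)) ->
    tau' (\sum_j F j) = \sum_j tau' (F j).
  move=> CF; pose Q u v := layer C y u /\ tau' u = v.
  suff [] : Q (\sum_j F j) (\sum_j tau' (F j)) by [].
  apply: big_ind2 => // u1 u2 v1 v2 [Cu1 <-] [Cv1 <-].
  by split; [apply: lCD|apply: tau'D].
have E0 : E 0 by case: sE.
exists tau'; split=> //.
- split; first exact: layer_sum_closed.
    exact: (layer_mul sE EE EE).
  by move=> x; apply: layer_mono.
- by move=> i; apply: layer_incl => //; [case: sT|apply: (dual_b D)].
- by move=> i; apply: layer_incl => //; [case: sC|apply: (dual_c D)].
- move=> _ [x [Cx ->]]; rewrite tau'E //; exists (fun j => tau (x j)).
  by split=> // j; apply: (dual_tau D).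
- move=> _ _ [a [Ea ->]] [x [Cx ->]]; rewrite tau'E //.
  rewrite !big_distrlr /=.
  have gen j l : layer C y ((a j * y j) * (x l * y l)).
    by rewrite mulrACA; have [ka [Eka ->]] := yy j l; exists (fun m => ka m * (a j * x l));
       split=> [m|]; [apply/EC/EC|rewrite mulr_sumr; apply: eq_bigr => m _; ring].
  rewrite tau'_sum => [|j]; last by apply: sum_closed_sum.
  apply: eq_bigr => j _; rewrite tau'_sum //; apply: eq_bigr => l _.
  rewrite ![a j * y j * _]mulrACA; have [ka [Eka ->]] := yy j l.
  have -> : a j * x l * (\sum_m ka m * y m) = \sum_m (ka m * a j * x l) * y m.
    by rewrite mulr_sumr; apply: eq_bigr => m _; ring.
  rewrite tau'E => [|m]; last by apply: EC => //; apply: EE.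
  rewrite mulr_sumr; apply: eq_bigr => m _; rewrite (dual_tauZ D) //; last exact: EE.
  by ring.
- move=> _ [r [Tr ->]].
  have rc i : tau' ((\sum_j r j * y j) * c i) = \sum_j tau (r j * c i) * y j.
    rewrite mulr_suml; under eq_bigr do rewrite mulrAC.
    by rewrite tau'E // => j; apply: TC => //; apply: (dual_c D).
  under [RHS]eq_bigr do rewrite rc mulr_suml.
  rewrite exchange_big; apply: eq_bigr => j _ /=.
  by rewrite {1}(dual_ring D (Tr j)) mulr_suml; apply: eq_bigr => i _; rewrite mulrAC.
- move=> _ [x [Cx ->]].
  have bx i : tau' (b i * (\sum_j x j * y j)) = \sum_j tau (b i * x j) * y j.
    rewrite mulr_sumr; under eq_bigr do rewrite mulrA.
    by rewrite tau'E // => j; apply: TC => //; apply: (dual_b D).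
  under [RHS]eq_bigr do rewrite bx mulr_suml.
  rewrite exchange_big; apply: eq_bigr => j _ /=.
  by rewrite {1}(dual_module D (Cx j)) mulr_suml; apply: eq_bigr => i _; rewrite mulrAC.
move=> i j; pose x l := if l == ord0 :> 'I_n.+1 then b i * c j else 0.
have Cx l : C (x l).
  rewrite /x; case: eqP => _; last by case: sC.
  by apply: TC; [apply: (dual_b D)|apply: (dual_c D)].
have {1}-> : b i * c j = \sum_l x l * y l.
  by rewrite big_ord_recl /x /= y0 mulr1 big1 ?addr0 // => l _; rewrite mul0r.
have t0 : tau 0 = 0.
  by apply: (addrI (tau 0)); rewrite -(dual_tauD D) ?addr0 //; case: sC.
rewrite tau'E // big_ord_recl {1}/x eqxx y0 mulr1 (dual_pairing D).
by rewrite big1 ?addr0 // => l _; rewrite /x /= t0 mul0r.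
Qed.

End Steps.

End Layers.

(** * Directness of sums from leading monomials *)

Section LeadingMonomials.
Variables (k : fieldType) (d : nat).
Local Notation Pc := {mpoly k[d]}.

Lemma mlead_sum_distinct (T : eqType) (r : seq T) (F : T -> Pc) : uniq r ->
  (forall x y, x \in r -> y \in r -> F x != 0 -> F y != 0 ->
     mlead (F x) = mlead (F y) -> x = y) ->
  (exists2 x, x \in r & F x != 0) ->
  exists x, [/\ x \in r, F x != 0, \sum_(i <- r) F i != 0
    & mlead (\sum_(i <- r) F i) = mlead (F x)].
Proof.
move=> ur inj ex.
have [x [xr Fx maxx]] : exists x, [/\ x \in r, F x != 0 &
    forall y, y \in r -> F y != 0 -> (mlead (F y) <= mlead (F x))%O].
  elim: r ex {ur inj} => [[x] //|a r IH] ex.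
  have [[x xr Fx]|N] := pselect (exists2 x, x \in r & F x != 0).
    have [x0 [x0r Fx0 maxx0]] := IH (ex_intro2 _ _ x xr Fx).
    have [Fa|Fa] := eqVneq (F a) 0.
      exists x0; split=> //; first by rewrite inE x0r orbT.
      by move=> y; rewrite inE => /predU1P[->|]; [rewrite Fa eqxx|exact: maxx0].
    have [le|le] := leP (mlead (F a)) (mlead (F x0)).
      exists x0; split=> //; first by rewrite inE x0r orbT.
      by move=> y; rewrite inE => /predU1P[->|]; [|exact: maxx0].
    exists a; split=> //; first exact: mem_head.
    move=> y; rewrite inE => /predU1P[->//|yr Fy].
    by apply: le_trans (ltW le); apply: maxx0.
  case: ex => x; rewrite inE => /predU1P[->|xr] Fx; last by case: N; exists x.
  exists a; split=> //; first exact: mem_head.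
  by move=> y; rewrite inE => /predU1P[->//|yr Fy]; case: N; exists y.
have cf : (\sum_(i <- r) F i)@_(mlead (F x)) != 0.
  rewrite raddf_sum (bigD1_seq x) //= big1_seq ?addr0 ?mleadc_eq0 // => y /andP[ne yr].
  have [->|Fy] := eqVneq (F y) 0; first by rewrite mcoeff0.
  apply: mcoeff_gt_mlead; rewrite lt_neqAle maxx // andbT.
  by apply: contra ne => /eqP e; apply/eqP/inj.
exists x; split=> //.
  by apply: contraNneq cf => ->; rewrite mcoeff0.
apply/le_anti/andP; split; last by apply: msupp_le_mlead; rewrite mcoeff_msupp.
apply: le_trans (mlead_sum_le _ _ _) _.
rewrite big_seq_cond; elim/big_ind: _ => [|u v lu lv|y /andP[yr _]]; first exact: le0x.
  by rewrite leUx lu.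
by have [->|Fy] := eqVneq (F y) 0; [rewrite mlead0 le0x|apply: maxx].
Qed.

(** Independence of the leading exponents keeps the terms of [p] apart after substitution, so the
    [z i] are algebraically independent. *)
Lemma mlead_substitution (n : nat) (z : 'I_n -> Pc) (lz : 'I_n -> 'X_{1..d}) :
  (forall i, z i != 0) -> (forall i, mlead (z i) = lz i) ->
  injective (fun m : 'X_{1..n} => (\sum_i lz i *+ m i)%MM) ->
  forall p : {mpoly k[n]}, p != 0 -> exists m : 'X_{1..n},
    mmap (@mpolyC d k) z p != 0 /\ mlead (mmap (@mpolyC d k) z p) = (\sum_i lz i *+ m i)%MM.
Proof.
move=> z0 lead_z inj p p0.
have mm0 m : mmap1 z m != 0.
  by apply/prodf_neq0 => i _; rewrite expf_neq0.
have mml m : mlead (mmap1 z m) = (\sum_i lz i *+ m i)%MM.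
  rewrite /mmap1 mlead_prod => [|i _ _]; last by rewrite expf_neq0.
  by apply: eq_bigr => i _; rewrite mleadX // lead_z.
pose F m := (p@_m)%:MP * mmap1 z m.
have F0 m : m \in msupp p -> F m != 0.
  by rewrite mcoeff_msupp => pm; rewrite /F mulf_neq0 // mpolyC_eq0.
have Fl m : m \in msupp p -> mlead (F m) = (\sum_i lz i *+ m i)%MM.
  by rewrite mcoeff_msupp => pm; rewrite /F mul_mpolyC mleadZ.
have [||m [mp _ s0 es]] := @mlead_sum_distinct _ (msupp p) F (msupp_uniq p).
- by move=> x y xp yp _ _; rewrite !Fl // => /inj.
- by exists (mlead p); [exact: mlead_supp|apply/F0/mlead_supp].
by exists m; rewrite -Fl.
Qed.

Variables (P : idomainType) (chi : {rmorphism P -> Pc}) (wv : nat -> 'I_d) (nn : nat -> nat).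
Variable L : nat.

(** Divisibility of these exponents leaves the residues modulo [nn t] to the generators of layer
    [t]: when their leading exponents in [wv t] are distinct modulo [nn t], no cancellation occurs
    between summands. *)
Definition lead_adapted (A : P -> Prop) s := forall x, A x -> x != 0 ->
  chi x != 0 /\ forall t, (s <= t)%N -> (t < L)%N -> (nn t %| mlead (chi x) (wv t))%N.

Lemma lead_adapted_layer n (A : P -> Prop) (g : 'I_n -> P) s : lead_adapted A s ->
  (s < L)%N -> n = nn s -> (forall j, chi (g j) != 0) ->
  (forall j l, (mlead (chi (g j)) (wv s) = mlead (chi (g l)) (wv s) %[mod nn s])%N -> j = l) ->
  (forall j t, (s < t)%N -> (t < L)%N -> (nn t %| mlead (chi (g j)) (wv t))%N) ->
  direct A g /\ lead_adapted (layer A g) s.+1.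
Proof.
move=> lA sL en g0 gs gt.
have key (x : 'I_n -> P) : (forall j, A (x j)) -> (exists j, x j != 0) ->
    exists j, [/\ x j != 0, chi (\sum_j x j * g j) != 0 &
      mlead (chi (\sum_j x j * g j)) = (mlead (chi (x j)) + mlead (chi (g j)))%MM].
  move=> Ax [j0 xj0]; rewrite rmorph_sum.
  have nz j : x j != 0 -> chi (x j * g j) != 0 /\
      mlead (chi (x j * g j)) = (mlead (chi (x j)) + mlead (chi (g j)))%MM.
    move=> xj; have [c0 _] := lA _ (Ax j) xj.
    by rewrite rmorphM /= mulf_neq0 // mleadM.
  have zn j : chi (x j * g j) != 0 -> x j != 0.
    by apply: contraNneq => ->; rewrite mul0r rmorph0.
  have [|||j [_ cj s0 es]] := @mlead_sum_distinct _ (index_enum 'I_n) (fun j => chi (x j * g j)).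
  - by rewrite /index_enum; case: index_enum_key => /=; rewrite -enumT enum_uniq.
  - move=> j l _ _ /zn xj /zn xl; have [_ ->] := nz _ xj; have [_ ->] := nz _ xl.
    move=> e; apply: gs; have := congr1 (fun m : 'X_{1..d} => m (wv s)) e.
    rewrite !mnmDE => e'.
    have [_ /(_ s (leqnn s) sL) /dvdnP[q1 e1]] := lA _ (Ax j) xj.
    have [_ /(_ s (leqnn s) sL) /dvdnP[q2 e2]] := lA _ (Ax l) xl.
    have := congr1 (fun m => m %% nn s)%N e'; by rewrite e1 e2 !modnMDl.
  - by exists j0; [rewrite mem_index_enum|case: (nz _ xj0)].
  exists j; have xj := zn _ cj; split=> //.
  by rewrite es; case: (nz _ xj).
split=> [x Ax e j|_ [x [Ax ->]] xn0].
  apply/eqP; apply: contrapT => /negP xj.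
  have [|l [_ + _]] := key x Ax; first by exists j.
  by rewrite e rmorph0 eqxx.
have [|j [xj s0 es]] := key x Ax.
  apply: contrapT => /forallNP N; case/eqP: xn0; apply: big1 => j _.
  by have /negP := N j; rewrite negbK => /eqP ->; rewrite mul0r.
split=> // t st tL; rewrite es mnmDE dvdn_add //; last exact: gt.
by have [_] := lA _ (Ax j) xj; apply=> //; apply: ltnW.
Qed.

End LeadingMonomials.

(** * Factorization of the generators of the canonical module *)

Section CanonicalFactorization.
Variables (k : fieldType) (d : nat) (R : comNzRingType).
Local Notation P := {mpoly k[d]}.
Local Notation S := {mpoly k[d]}.
Variables (psi : {rmorphism R -> P}) (phi : {rmorphism S -> R}).
Hypothesis nR : noetherian R.
Hypothesis psi_phiC : forall a, psi (phi a%:MP) = a%:MP.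
Variables (I : finType) (b : I -> R) (cw : I -> P) (Om : P -> Prop) (tau : P -> S).
Hypothesis sOm : sum_closed Om.
Hypothesis OmM : forall r f, Om f -> Om (psi r * f).
Hypothesis Om_cw : forall i, Om (cw i).
Hypothesis tauD : forall x y, Om x -> Om y -> tau (x + y) = tau x + tau y.
Hypothesis tauZ : forall s x, Om x -> tau (psi (phi s) * x) = s * tau x.
Hypothesis expand_ring : forall r, r = \sum_i phi (tau (psi r * cw i)) * b i.
Hypothesis expand_module : forall x, Om x -> x = \sum_i psi (phi (tau (psi (b i) * x))) * cw i.
Hypothesis Om_monomial : forall f m, Om f -> m \in msupp f -> Om 'X_[m].

Let tau_sum (T : eqType) (r : seq T) (F : T -> P) : {in r, forall i, Om (F i)} ->
  tau (\sum_(i <- r) F i) = \sum_(i <- r) tau (F i).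
Proof.
move=> OF; have [O0 OD] := sOm.
have t0 : tau 0 = 0 by apply: (addrI (tau 0)); rewrite -tauD // !addr0.
rewrite big_seq [RHS]big_seq.
pose Q x y := Om x /\ tau x = y.
suff [] : Q (\sum_(i <- r | i \in r) F i) (\sum_(i <- r | i \in r) tau (F i)) by [].
apply: big_ind2 => // [x1 x2 y1 y2 [Ox1 <-] [Oy1 <-]|i ir].
  by split; [apply: OD|apply: tauD].
by split=> //; apply: OF.
Qed.

Lemma tau_pspan j r f : Om f -> pspan (zvar phi) j (r : R^o) ->
  pspan (mvar k d) j (tau (psi r * f) : S^o).
Proof.
move=> Of [h ->]; exists (fun i => tau (psi (h i) * f)).
rewrite rmorph_sum mulr_suml -(big_mkord xpredT (fun i => psi (zvar phi i *: h i) * f)).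
rewrite tau_sum => [|i _]; last exact: OmM.
rewrite big_mkord; apply: eq_bigr => i _.
rewrite [zvar phi i *: h i]/(zvar phi i * h i) rmorphM -mulrA tauZ //; exact: OmM.
Qed.

(** The coordinates [tau (psi r * cw i)] are linear over the parameters, so regularity is that of
    the variables of a polynomial ring, tested coordinatewise. *)
Lemma parameters_regular j : (j < d)%N ->
  forall r : R, pspan (zvar phi) j (zvar phi j * r : R^o) -> pspan (zvar phi) j (r : R^o).
Proof.
move=> jd r zr; rewrite [r]expand_ring.
apply: (@submod_sum R R^o) => [|i _]; first exact: pspan_submod.
apply: (@pspan_phi _ _ _ phi R^o).
have := kill_pspan (tau_pspan (Om_cw i) zr).
rewrite rmorphM -mulrA tauZ => [|]; last exact: OmM.
rewrite rmorphM /= kill_var ltnn => /eqP; rewrite mulf_eq0.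
rewrite -[j]/(nat_of_ord (Ordinal jd)) mvarE -[_ == 0 as X in X || _]msize_poly_eq0 msizeX /=.
move=> /eqP kt; have := sub_kill_pspan j (tau (psi r * cw i)).
by rewrite kt subr0.
Qed.

Variables (C : lmodType R).
Hypothesis semC : semidualizing C.
Variable iota : C -> P.
Hypothesis iotaD : forall c1 c2, iota (c1 + c2) = iota c1 + iota c2.
Hypothesis iotaZ : forall r c, iota (r *: c) = psi r * iota c.
Hypothesis iota_inj : forall c, iota c = 0 -> c = 0.
Hypothesis iota_functional : exists2 d0, d0 != 0 & forall c, exists r, psi r = d0 * iota c.
Hypothesis iota_monomial : forall c m, m \in msupp (iota c) -> exists c', iota c' = 'X_[m].

(** A homomorphism between fractional ideals is multiplication by a fraction; cross products keep
    this inside [P]. *)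
Lemma proportional (theta : C -> P) : (forall r c, theta (r *: c) = psi r * theta c) ->
  forall c1 c2, theta c1 * iota c2 = theta c2 * iota c1.
Proof.
move=> thZ c1 c2; have [d0 d00 H] := iota_functional.
have [r1 e1] := H c1; have [r2 e2] := H c2; apply: (mulfI d00).
have iota_inj2 x y : iota x = iota y -> x = y.
  move=> e; apply/eqP; rewrite -subr_eq0; apply/eqP/iota_inj.
  by rewrite iotaD e -scaleN1r iotaZ rmorphN1 mulN1r subrr.
have : r2 *: c1 = r1 *: c2 by apply: iota_inj2; rewrite !iotaZ e1 e2; ring.
move/(congr1 theta); rewrite !thZ e1 e2 => e.
transitivity (d0 * iota c2 * theta c1); first by ring.
by rewrite e; ring.
Qed.

(** With [J = (omega : I)], surjectivity of [I * J -> omega] on the minimal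
    generator [we] of [omega]: there are monomials [g] of [I] and [we / g] of [J]. *)
Theorem canonical_generator_factors (a : R) (we : 'X_{1..d}) :
  Om 'X_[we] -> (tau (psi a * 'X_[we]))@_0%MM != 0 ->
  (forall n, Om 'X_[n] -> (tau (psi a * 'X_[n]))@_0%MM != 0 -> n = we) ->
  exists g, (exists c, iota c = 'X_[g]) /\
    forall a1, (exists c, iota c = 'X_[a1]) -> exists n, Om 'X_[n] /\ (a1 + we = g + n)%MM.
Proof.
move=> Owe twe only_we.
have [Q [fgC endC faithC extC]] := semidualizing_reduction_data semC.
have red j : (j <= d)%N -> reduces Q (zvar phi) j.
  exact: (regular_reduces nR fgC endC faithC extC parameters_regular).
have regC j : (j < d)%N -> forall v : C, pspan (zvar phi) j (zvar phi j *: v) -> pspan (zvar phi) j v.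
  by move=> jd v; apply: (pspan_regular nR fgC faithC (red j (ltnW jd))); apply: parameters_regular.
have na : ~ pspan (zvar phi) d (a : R^o).
  move=> /(tau_pspan Owe)/kill_pspan; rewrite kill_all => /eqP.
  by rewrite mpolyC_eq0; apply/negP.
have [x nx] : exists x : C, ~ pspan (zvar phi) d (a *: x).
  apply: contrapT => /forallNP N; apply/na/(reduces_faithful (red d (leqnn d))) => c.
  exact: contrapT (N c).
have genR r : exists f : I -> S, r = \sum_i phi (f i) * b i.
  by exists (fun i => tau (psi r * cw i)); apply: expand_ring.
have [lam [lamD lamZ lamx]] := exists_residue_functional genR fgC regC nx.
(* The adjoint of [lam]: an [R]-linear map from [C] to [Om] with [tau (theta c) = lam c]. *)
pose theta c := \sum_i psi (phi (lam (b i *: c))) * cw i.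
have Otheta c : Om (theta c) by apply: sum_closed_sum => // i _; apply: OmM.
have lam0 : lam 0 = 0 by apply: (addrI (lam 0)); rewrite -lamD !addr0.
have lam_sum (F : I -> C) : lam (\sum_i F i) = \sum_i lam (F i).
  exact: (big_morph lam lamD lam0).
have lam_expand r c : lam (r *: c) = \sum_i tau (psi r * cw i) * lam (b i *: c).
  rewrite {1}(expand_ring r) scaler_suml lam_sum; apply: eq_bigr => i _.
  by rewrite -scalerA lamZ.
have thetaZ r c : theta (r *: c) = psi r * theta c.
  rewrite [RHS]expand_module; last exact: OmM.
  apply: eq_bigr => i _; congr (psi (phi _) * _).
  rewrite scalerA lam_expand mulrA -rmorphM /theta mulr_sumr.
  rewrite (@tau_sum I) => [|j _]; last by do 2! apply: OmM.
  apply: eq_bigr => j _; rewrite [psi _ * (_ * _)]mulrCA (tauZ _ (OmM _ (Om_cw j))).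
  by rewrite mulrC.
have tau_theta c : tau (theta c) = lam c.
  rewrite /theta (@tau_sum I) => [|j _]; last exact: OmM.
  rewrite -[c in RHS]scale1r lam_expand; apply: eq_bigr => i _.
  by rewrite (tauZ _ (Om_cw i)) rmorph1 mul1r mulrC.
have cross := proportional thetaZ.
(* [tau (psi a * theta x)] has nonzero constant term, and ['X_[we]] is the only monomial of [Om]
   that can contribute to it. *)
have wex : we \in msupp (theta x).
  have := lamx; rewrite -tau_theta thetaZ => H.
  apply: contraTT H => wex; rewrite negbK [theta x]mpolyE mulr_sumr.
  have OX m : m \in msupp (theta x) -> Om (psi a * 'X_[m]) by move/(Om_monomial (Otheta x))/OmM.
  have e m : psi a * ((theta x)@_m *: 'X_[m]) = psi (phi ((theta x)@_m)%:MP) * (psi a * 'X_[m]).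
    by rewrite psi_phiC -mul_mpolyC mulrCA.
  rewrite tau_sum => [|m ms]; last by rewrite e; apply/OmM/OX.
  rewrite raddf_sum big1_seq //= => m ms.
  rewrite e tauZ; last exact: OX.
  rewrite [LHS]rmorphM /=; have [e0|ne] := eqVneq (tau (psi a * 'X_[m]))@_0%MM 0.
    by rewrite e0 mulr0.
  by rewrite -(only_we m (Om_monomial (Otheta x) ms) ne) ms in wex.
have x0 : iota x != 0.
  apply/eqP => /iota_inj e; move: lamx; rewrite e scaler0 lam0 mcoeff0.
  by rewrite eqxx.
have [c0 e0] := iota_monomial (mlead_supp x0); set a0 := mlead _ in e0.
have suppX (f : P) m l : (l \in msupp (f * 'X_[m])) -> exists2 n, n \in msupp f & l = (n + m)%MM.
  move=> /msuppM_le/allpairsP[[l1 l2] /= [l1f]]; rewrite msuppX inE => /eqP -> ->.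
  by exists l1.
have suppX' (f : P) m n : n \in msupp f -> (n + m)%MM \in msupp (f * 'X_[m]).
  by rewrite !mcoeff_msupp addmC mcoeffMX.
(* The cross relation of [x] and [c0] gives [we + a0 = m + g]; that of [c0] and [c1] below gives
   [m + a1 = n + a0], and the claim follows by subtraction. *)
have : (we + a0)%MM \in msupp (theta c0 * iota x).
  by rewrite -cross e0; apply: suppX'.
move=> /msuppM_le/allpairsP[[m g] /= [mP gx eg]].
exists g; split; first exact: iota_monomial gx.
move=> a1 [c1 e1].
have : (m + a1)%MM \in msupp (theta c1 * 'X_[a0]).
  by rewrite -e0 cross e1; apply: suppX'.
move=> /suppX[n nth en]; exists n; split; first exact: Om_monomial nth.
apply/mnmP => i; have /mnmP/(_ i) := eg; have /mnmP/(_ i) := en.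
by rewrite !mnmDE; lia.
Qed.

End CanonicalFactorization.

(** * The ladder *)

Section LadderShape.
Variables N M : nat.

(** Blocks [0, ..., N.-1] are 2x3 and blocks [N, ..., N + M] are 2x2.  Block [i]
    lies in the rows [i] and [i.+1]; columns are counted from the right, and
    [sigma i] is the first column of block [i], which is also the last one of
    block [i.-1]. *)
Definition nblocks := (N + M).+1.
Definition sigma i := (i + minn i N)%N.
Definition ladder_width := sigma nblocks.
(** Row [r] meets blocks [r.-1] and [r]. In row 0 the truncated predecessor leaves block 0 alone; in
    the last row the upper bound exceeds the width, so block [r.-1] alone remains. *)
Definition in_ladder r c := (sigma r.-1 <= c <= sigma r.+1)%N.
Definition ladder : grid :=
  @Grid nblocks.+1 ladder_width.+1
    [set x : 'I_nblocks.+1 * 'I_ladder_width.+1 | in_ladder x.1 (ladder_width - x.2)]%SET.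

Local Notation L := nblocks.
Local Notation W := ladder_width.

Definition at_pos r c : 'I_L.+1 * 'I_W.+1 := (inord r, inord (W - c)).
Definition in_block i r c := [&& (i < L)%N, (i <= r <= i.+1)%N & (sigma i <= c <= sigma i.+1)%N].

Ltac shape := unfold in_ladder, in_block, ladder_width, sigma, nblocks in *; lia.

Lemma widthE : W = (N + N + M).+1.
Proof. shape. Qed.

Lemma sigma_mono i j : (i <= j)%N -> (sigma i <= sigma j)%N.
Proof. by rewrite /sigma; lia. Qed.

Lemma sigma_width i : (i <= L)%N -> (sigma i <= W)%N.
Proof. shape. Qed.

Lemma mem_ladder r c : (r <= L)%N -> (c <= W)%N -> (at_pos r c \in cells ladder) = in_ladder r c.
Proof.
move=> rL cW; rewrite inE /= !inordK ?subKn // ltnS //; exact: leq_subr.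
Qed.

Lemma in_block_ladder i r c : in_block i r c -> at_pos r c \in cells ladder.
Proof. by move=> H; rewrite mem_ladder; shape. Qed.

Lemma in_ladder_block r c : (r <= L)%N -> (c <= W)%N -> in_ladder r c -> exists i, in_block i r c.
Proof.
move=> rL cW H.
have [h|h] := leqP (sigma r) c; last by exists r.-1; shape.
by have [h2|h2] := ltnP r L; [exists r; shape|exists r.-1; shape].
Qed.

Lemma ladder_block x : x \in cells ladder -> exists i r c, in_block i r c /\ x = at_pos r c.
Proof.
case: x => r c; rewrite inE /= => H.
have [|||i Hi] := @in_ladder_block r (W - c); rewrite ?leq_subr //.
  by have := ltn_ord r; rewrite ltnS.
exists i, r, (W - c)%N; split=> //; rewrite /at_pos subKn; last by rewrite -ltnS.
by congr (_, _); apply/val_inj; rewrite /= inordK.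
Qed.

(** Rows at distance two or more share at most one column, so a minor uses consecutive rows, whose
    common columns are those of one block. *)
Lemma minor_in_ladder i p j q : minor_in ladder i p j q ->
  p = i.+1 :> nat /\ [/\ sigma i <= W - q, W - q < W - j & W - j <= sigma i.+1]%N.
Proof.
move=> [ip jq /fintype.subsetP sub].
have := sub (i, j); have := sub (i, q); have := sub (p, j); have := sub (p, q).
rewrite !inE !eqxx !orbT /= => /(_ isT) h1 /(_ isT) h2 /(_ isT) h3 /(_ isT) h4.
have qW := ltn_ord q; have jW := ltn_ord j.
have aux (i' p' j' q' : nat) : (i' < p')%N -> (j' < q')%N -> (q' < W.+1)%N ->
    in_ladder p' (W - q') -> in_ladder p' (W - j') -> in_ladder i' (W - q') -> in_ladder i' (W - j') ->
    p' = i'.+1 /\ [/\ sigma i' <= W - q', W - q' < W - j' & W - j' <= sigma i'.+1]%N.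
  rewrite /in_ladder => ip' jq' qW' /andP[h5 _] _ _ /andP[_ h8].
  have xy : (W - q' < W - j')%N by lia.
  have e : p' = i'.+1.
    apply/eqP; rewrite eqn_leq ip' andbT leqNgt; apply/negP => lt.
    have := @sigma_mono i'.+1 p'.-1; rewrite -ltnS prednK; last by lia.
    by move=> /(_ lt); lia.
  by move: h5; rewrite e.
exact: aux.
Qed.

Lemma block_minor i c1 c2 : (i < L)%N -> (sigma i <= c1)%N -> (c1 < c2)%N -> (c2 <= sigma i.+1)%N ->
  minor_in ladder (inord i) (inord i.+1) (inord (W - c2)) (inord (W - c1)).
Proof.
move=> iL s1 c12 s2; have sW := @sigma_width i.+1 iL.
split; first by rewrite !inordK ?ltnS // ltnW.
  by rewrite !inordK; lia.
have memc r c : (i <= r <= i.+1)%N -> (c1 <= c <= c2)%N -> (inord r, inord (W - c)) \in cells ladder.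
  by move=> ri ci; apply: (@in_block_ladder i); shape.
by apply/fintype.subsetP => x /finset.setUP[/finset.setUP[/finset.setUP[]|]|] /finset.set1P ->;
  apply: memc; lia.
Qed.

Lemma ladder_is_ladder : is_ladder ladder.
Proof.
have sW := sigma_width; split.
- move=> i p j q; rewrite !inE /=; shape.
- split=> [i|j].
    exists (inord (W - sigma i)).
    have -> : (i, inord (W - sigma i)) = at_pos i (sigma i) :> _ * _.
      by congr (_, _); apply/val_inj; rewrite /= inordK.
    have iL : (i <= L)%N by rewrite -ltnS.
    by rewrite mem_ladder // ?sW //; shape.
  have jW : (j <= W)%N by rewrite -ltnS.
  have rE n : (n <= W)%N -> exists2 r, (r <= L)%N & in_ladder r n.
    (* A row through column [n]: up to column [N + N] the staircase advances two columns per row,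
       afterwards one. *)
    rewrite widthE => nW; exists (if (n <= N + N)%N then n./2 else (n - N)%N).
      by case: ifP; rewrite /nblocks; lia.
    by rewrite /in_ladder /sigma; case: ifP; lia.
  have [r rL Hr] := rE _ (leq_subr j W).
  exists (inord r); have -> : (inord r, j) = at_pos r (W - j) :> _ * _.
    by congr (_, _); apply/val_inj; rewrite /= subKn // inordK.
  by rewrite mem_ladder // leq_subr.
- move=> x /ladder_block[i [r [c [/and3P[iL ri /andP[c1 c2]] ->]]]].
  have [e|ne] := eqVneq c (sigma i).
    exists (inord i), (inord i.+1), (inord (W - sigma i.+1)), (inord (W - sigma i)); split.
      by apply: block_minor => //; shape.
    have : r = i \/ r = i.+1 by lia.
    by case=> ->; rewrite e !inE /at_pos !eqxx ?orbT.
  exists (inord i), (inord i.+1), (inord (W - c)), (inord (W - sigma i)); split.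
    by apply: block_minor => //; shape.
  have : r = i \/ r = i.+1 by lia.
  by case=> ->; rewrite !inE /at_pos !eqxx ?orbT.
move=> [Z1 [Z2 [[nZ1 nZ2 _ _] [dZ ZY mZ]]]].
have side i p j q x y : minor_in ladder i p j q -> x \in minor_cells i p j q ->
    y \in minor_cells i p j q -> (x \in Z1) = (y \in Z1).
  move=> /mZ[[_ _ /fintype.subsetP s] xm ym|[_ _ /fintype.subsetP s] xm ym].
    by rewrite !s.
  by rewrite !(disjointFl dZ (s _ _)).
(* Each cell of a block shares a minor with the first corner of the block, and the next corner lies
   in two blocks; so the whole ladder is on one side of a separation. *)
have sideb i r c : in_block i r c -> (at_pos r c \in Z1) = (at_pos i (sigma i) \in Z1).
  move=> /and3P[iL ri /andP[c1 c2]]; have : r = i \/ r = i.+1 by lia.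
  have [->|ne] := eqVneq c (sigma i).
    have mi : minor_in ladder (inord i) (inord i.+1) (inord (W - sigma i.+1)) (inord (W - sigma i)).
      by apply: block_minor => //; shape.
    by case=> ->; apply: (side _ _ _ _ _ _ mi); rewrite !inE /at_pos !eqxx ?orbT.
  have mi : minor_in ladder (inord i) (inord i.+1) (inord (W - c)) (inord (W - sigma i)).
    by apply: block_minor => //; shape.
  by case=> ->; apply: (side _ _ _ _ _ _ mi); rewrite !inE /at_pos !eqxx ?orbT.
have side0 i : (i < L)%N -> (at_pos i (sigma i) \in Z1) = (at_pos 0 0 \in Z1).
  elim: i => [|i IH] iL; first by rewrite /sigma min0n.
  rewrite -IH; last exact: ltnW.
  by apply: sideb; shape.
have all_side x : x \in cells ladder -> (x \in Z1) = (at_pos 0 0 \in Z1).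
  move=> /ladder_block[i [r [c [H ->]]]]; rewrite (sideb _ _ _ H) side0 //.
  by case/and3P: H.
have [x1 x1Z] := finset.set0Pn _ nZ1; have [x2 x2Z] := finset.set0Pn _ nZ2.
have x1Y : x1 \in cells ladder by rewrite -ZY inE x1Z.
have x2Y : x2 \in cells ladder by rewrite -ZY inE x2Z orbT.
have := all_side _ x2Y; rewrite -(all_side _ x1Y) x1Z => x2Z1.
by have := disjointFr dZ x2Z1; rewrite x2Z.
Qed.

End LadderShape.

(** * The toric parametrization of the ladder ring *)

Section LadderRing.
Variables (k : fieldType) (N M : nat).
Local Notation L := (nblocks N M).
Local Notation W := (ladder_width N M).
Local Notation Y := (ladder N M).
Local Notation sg := (sigma N).

(** The polynomial ring of the toric parametrization has the variables
    [x] (index [0]), and for each block [i] the ratio [w i] (index [i.+1]) of its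
    two rows, the upper entry of its last column (index [(L + i).+1]) and, if it
    is a 2x3 block, that of its middle column (index [(L + L + i).+1]). *)
Definition nvars := (L + L + N).+1.
Local Notation d := nvars.
Local Notation P := {mpoly k[d]}.
Local Notation R := (R2 k Y).

Definition um n : 'X_{1..d} := U_(inord n)%MM.
(** Corner [i.+1] is the lower entry of the last column of block [i], hence [w i] times the upper
    one; corner 0 is the variable [x]. *)
Definition cornerm i : 'X_{1..d} := if i is j.+1 then (um j.+1 + um (L + j).+1)%MM else um 0.
Definition colm i c : 'X_{1..d} :=
  if c == sg i then cornerm i else if c == sg i.+1 then um (L + i).+1 else um (L + L + i).+1.
(** The cell is in the upper row of block [r] if [sg r <= c], and otherwise in the lower row of
    block [r.-1], whose ratio has index [r]. A shared corner is read as upper. *)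
Definition cellm r c : 'X_{1..d} :=
  if (sg r <= c)%N then colm r c else (um r + colm r.-1 c)%MM.

Definition cell_of (a : 'I_#|Y|) : 'I_(nrows Y) * 'I_(ncols Y) := enum_val a.

Definition psi0 : {mpoly k[#|Y|]} -> P :=
  mmap (@mpolyC d k) (fun a => 'X_[cellm (cell_of a).1 (W - (cell_of a).2)]).

Lemma psi0_is_additive : additive psi0.
Proof. exact: mmap_is_additive. Qed.
Lemma psi0_is_multiplicative : multiplicative psi0.
Proof. exact: mmap_is_multiplicative. Qed.
HB.instance Definition _ := GRing.isAdditive.Build _ _ psi0 psi0_is_additive.
HB.instance Definition _ := GRing.isMultiplicative.Build _ _ psi0 psi0_is_multiplicative.

Lemma ladder_varE (x : 'I_(nrows Y) * 'I_(ncols Y)) : x \in cells Y ->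
  exists2 a, cell_of a = x & ladder_var k x = 'X_a.
Proof.
move=> xY; pose a0 : 'I_#|Y| := enum_rank_in xY x.
have e : cell_of a0 = x by exact: enum_rankK_in.
exists a0 => //; rewrite /ladder_var (bigD1 a0) /=; last exact/eqP.
rewrite big1 ?addr0 // => a /andP[/eqP ea /negP[]].
by apply/eqP/enum_val_inj; rewrite ea -[RHS]/(cell_of a0) e.
Qed.

Lemma psi0_var x : x \in cells Y -> psi0 (ladder_var k x) = 'X_[cellm x.1 (W - x.2)].
Proof.
move=> /ladder_varE[a ea ->]; rewrite /psi0 mmapX mmap1U.
by congr 'X_[cellm _ (W - _)]; rewrite -ea.
Qed.

Lemma sigma_lt i : (sg i < sg i.+1)%N.
Proof. by rewrite /sigma; lia. Qed.

Lemma cellm_upper i c : (sg i <= c <= sg i.+1)%N -> cellm i.+1 c = (um i.+1 + colm i c)%MM.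
Proof.
move=> /andP[c1 c2]; rewrite /cellm; case: leqP => // c3 /=.
have -> : c = sg i.+1 by apply/eqP; rewrite eqn_leq c2 c3.
by rewrite /colm eqxx /= gtn_eqF // sigma_lt.
Qed.

Lemma cellm_lower i c : (sg i <= c)%N -> cellm i c = colm i c.
Proof. by rewrite /cellm => ->. Qed.

Lemma psi0_I2 p : p \in @I2 k Y -> psi0 p = 0.
Proof.
move=> /asboolP[n [a [g [gS ->]]]]; rewrite rmorph_sum big1 // => l _.
have [i [p' [j [q [H ->]]]]] := gS l.
have [ep [s1 s2 s3]] := minor_in_ladder H.
have [_ _ /fintype.subsetP sub] := H.
rewrite rmorphM rmorphB !rmorphM /=.
rewrite !psi0_var ?sub ?inE ?eqxx ?orbT //= -!mpolyXD ep.
have s1' : (sg i <= W - j)%N by apply: leq_trans (ltnW s2).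
have s3' : (W - q <= sg i.+1)%N by apply: leq_trans (ltnW s2) _.
rewrite !cellm_upper ?s1 ?s1' // !cellm_lower //.
apply/eqP; rewrite mulf_eq0 subr_eq0; apply/orP; right; apply/eqP; congr 'X_[_].
by apply/mnmP => t; rewrite !mnmDE addnCA [RHS]addnCA [X in (_ + X)%N = _]addnC.
Qed.

Definition toR (p : {mpoly k[#|Y|]}) : R := (\pi_({ideal_quot (@I2 k Y)}) p)%qT.

Lemma toR_is_additive : additive toR.
Proof. by move=> p q; rewrite /toR !rmorphB. Qed.
Lemma toR_is_multiplicative : multiplicative toR.
Proof. by split=> [p q|]; rewrite /toR ?rmorphM ?rmorph1. Qed.
HB.instance Definition _ := GRing.isAdditive.Build _ _ toR toR_is_additive.
HB.instance Definition _ := GRing.isMultiplicative.Build _ _ toR toR_is_multiplicative.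

Definition fromR (r : R) : {mpoly k[#|Y|]} := repr (r : {ideal_quot (@I2 k Y)})%qT.

Lemma fromRK r : toR (fromR r) = r.
Proof. by rewrite /toR /fromR reprK. Qed.

Lemma toR_eq p q : toR p = toR q <-> p - q \in @I2 k Y.
Proof. by rewrite (@Quotient.idealrBE _ (@I2 k Y)); split=> /eqP. Qed.

Definition psi (r : R) : P := psi0 (fromR r).

Lemma psi_toR p : psi (toR p) = psi0 p.
Proof.
apply/eqP; rewrite -subr_eq0 -rmorphB /=; apply/eqP/psi0_I2/toR_eq.
by rewrite fromRK.
Qed.

Lemma psi_is_additive : additive psi.
Proof. by move=> r s; rewrite -[r]fromRK -[s]fromRK -rmorphB !psi_toR rmorphB. Qed.
Lemma psi_is_multiplicative : multiplicative psi.
Proof.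
split=> [r s|]; first by rewrite -[r]fromRK -[s]fromRK -rmorphM !psi_toR rmorphM.
by rewrite -(rmorph1 toR) psi_toR rmorph1.
Qed.
HB.instance Definition _ := GRing.isAdditive.Build R P psi psi_is_additive.
HB.instance Definition _ := GRing.isMultiplicative.Build R P psi psi_is_multiplicative.

Definition cell r c : R := toR (@ladder_var k Y (at_pos N M r c)).

Lemma psi_cell i r c : in_block N M i r c -> psi (cell r c) = 'X_[cellm r c].
Proof.
move=> H; rewrite psi_toR psi0_var ?(in_block_ladder H) //=.
case/and3P: H => iL /andP[_ ri] /andP[_ ci].
have cW := sigma_width (iL : (i.+1 <= L)%N).
have rL : (r <= L)%N by apply: leq_trans ri iL.
have cW' : (c <= W)%N by apply: leq_trans ci cW.
by rewrite !inordK ?subKn // ltnS leq_subr.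
Qed.

Lemma cell_minor i c1 c2 : (i < L)%N -> (sg i <= c1)%N -> (c1 < c2)%N -> (c2 <= sg i.+1)%N ->
  cell i c1 * cell i.+1 c2 = cell i c2 * cell i.+1 c1.
Proof.
move=> iL s1 c12 s2; rewrite /cell -!rmorphM; symmetry; apply/toR_eq/asboolP.
exists 1%N, (fun=> 1), (fun=> @ladder_var k Y (at_pos N M i c2) * @ladder_var k Y (at_pos N M i.+1 c1)
   - @ladder_var k Y (at_pos N M i c1) * @ladder_var k Y (at_pos N M i.+1 c2)).
split=> [_|]; last by rewrite big_ord1 mul1r.
do 4 eexists; split; first exact: (block_minor iL s1 c12 s2).
by [].
Qed.

Lemma ladder_ring_ind (A : R -> Prop) :
  (forall a, A (toR a%:MP)) -> (forall x y, A x -> A y -> A (x + y)) ->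
  (forall x y, A x -> A y -> A (x * y)) ->
  (forall i r c, in_block N M i r c -> A (cell r c)) -> forall x, A x.
Proof.
move=> AC AD AM Acell x; rewrite -[x]fromRK; elim/mpolyind: (fromR x) => [|a m p _ _ IH].
  by rewrite -mpolyC0.
rewrite rmorphD /=; apply: (AD _ _ _ IH); rewrite -mul_mpolyC rmorphM /=.
apply: (AM _ _ (AC _)); rewrite mpolyXE_id rmorph_prod.
have A1 : A 1 by rewrite -(rmorph1 toR) -mpolyC1.
apply: (big_ind A A1 (AM)) => l _; rewrite rmorphXn /=.
elim: (m l) => [|n IHn]; first by rewrite expr0.
rewrite exprS; apply: (AM _ _ _ IHn).
have lY : cell_of l \in cells Y by exact: enum_valP.
have [a' ea' e] := ladder_varE lY.
have [i [r [c [H er]]]] := ladder_block lY.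
have -> : 'X_l = @ladder_var k Y (at_pos N M r c).
  by rewrite -er e; congr 'X__; apply: enum_val_inj.
exact: Acell H.
Qed.

Lemma noetherian_ladder : noetherian R.
Proof.
apply: (@noetherian_surj _ _ toR); last exact: noetherian_mpoly.
by move=> y; exists (fromR y); apply: fromRK.
Qed.

Definition corner i := cell i (sg i).
Definition diff1 i := cell i.+1 (sg i) - cell i (sg i).+1.
Definition diff2 i := cell i.+1 (sg i).+1 - cell i (sg i).+2.
Definition inner1 i := cell i (sg i).+1.
Definition inner2 i := cell i (sg i).+2.

(** [L.+1] corners, [L] first and [N] second diagonal differences: as many parameters as there are
    variables in [P]. *)
Definition parameter n : R :=
  if (n <= L)%N then corner n else if (n <= L + L)%N then diff1 (n - L.+1)
  else diff2 (n - (L + L).+1).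

Definition phi : {mpoly k[d]} -> R :=
  mmap (toR \o @mpolyC _ k) (fun i : 'I_d => parameter i).

Lemma phi_is_additive : additive phi.
Proof. exact: mmap_is_additive. Qed.
Lemma phi_is_multiplicative : multiplicative phi.
Proof. exact: mmap_is_multiplicative. Qed.
HB.instance Definition _ := GRing.isAdditive.Build {mpoly k[d]} R phi phi_is_additive.
HB.instance Definition _ := GRing.isMultiplicative.Build {mpoly k[d]} R phi phi_is_multiplicative.

Lemma phiC a : phi a%:MP = toR a%:MP.
Proof. by rewrite /phi mmapC. Qed.

Lemma psi_phiC a : psi (phi a%:MP) = a%:MP.
Proof. by rewrite phiC psi_toR /psi0 mmapC. Qed.

Lemma phi_var n : (n < d)%N -> phi (mvar k d n) = parameter n.
Proof.
move=> nd; rewrite -[n]/(nat_of_ord (Ordinal nd)) mvarE /phi mmapX mmap1U //.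
Qed.

Lemma phi_corner i : (i <= L)%N -> phi (mvar k d i) = corner i.
Proof. by move=> iL; rewrite phi_var /parameter ?iL // /d ltnS; lia. Qed.

Lemma phi_diff1 i : (i < L)%N -> phi (mvar k d (L + i).+1) = diff1 i.
Proof.
move=> iL; rewrite phi_var; last by rewrite /d ltnS; lia.
by rewrite /parameter leqNgt ltnS leq_addr /= ltn_add2l iL subSS addKn.
Qed.

Lemma phi_diff2 i : (i < N)%N -> phi (mvar k d (L + L + i).+1) = diff2 i.
Proof.
move=> iN; rewrite phi_var; last by rewrite /d ltnS; lia.
rewrite /parameter; have -> : ((L + L + i).+1 <= L)%N = false by lia.
have -> : ((L + L + i).+1 <= L + L)%N = false by lia.
by rewrite subSS addKn.
Qed.

Lemma sigma_big i : (i < N)%N -> sg i.+1 = (sg i).+2.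
Proof. by rewrite /sigma; lia. Qed.

Lemma sigma_small i : (N <= i)%N -> sg i.+1 = (sg i).+1.
Proof. by rewrite /sigma; lia. Qed.

Section Relations.
Variable i : nat.
Hypothesis iL : (i < L)%N.

(** From the minor of the first two columns. The other two minors give the next two lemmas, which
    complete the multiplication table of 1, [inner1], [inner2] over the parameters. *)
Lemma inner11_big : (i < N)%N ->
  inner1 i * inner1 i = diff2 i * corner i - diff1 i * inner1 i + corner i * inner2 i.
Proof.
move=> iN; have := @cell_minor i (sg i) (sg i).+1 iL (leqnn _) (leqnn _).
rewrite sigma_big // => /(_ (leqnSn _)) H.
rewrite /inner1 /inner2 /diff1 /diff2 /corner.
have -> : (cell i.+1 (sg i).+1 - cell i (sg i).+2) * cell i (sg i) -
  (cell i.+1 (sg i) - cell i (sg i).+1) * cell i (sg i).+1 +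
  cell i (sg i) * cell i (sg i).+2 = cell i (sg i) * cell i.+1 (sg i).+1 -
   cell i (sg i).+1 * cell i.+1 (sg i) + cell i (sg i).+1 * cell i (sg i).+1 by ring.
by rewrite H subrr add0r.
Qed.

Lemma inner12_big : (i < N)%N ->
  inner1 i * inner2 i = corner i * corner i.+1 - diff1 i * inner2 i.
Proof.
move=> iN; have := @cell_minor i (sg i) (sg i).+2 iL (leqnn _).
rewrite /corner sigma_big // => /(_ (leqnSn _) (leqnn _)) ->.
by rewrite /inner1 /inner2 /diff1; ring.
Qed.

Lemma inner22_big : (i < N)%N ->
  inner2 i * inner2 i = corner i.+1 * inner1 i - diff2 i * inner2 i.
Proof.
move=> iN; have := @cell_minor i (sg i).+1 (sg i).+2 iL (leqnSn _) (leqnn _).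
rewrite /corner sigma_big // /inner1 => /(_ (leqnn _)) H.
by rewrite [X in _ = X - _]mulrC H /inner2 /diff2; ring.
Qed.

Lemma inner11_small : (N <= i)%N ->
  inner1 i * inner1 i = corner i * corner i.+1 - diff1 i * inner1 i.
Proof.
move=> iN; have := @cell_minor i (sg i) (sg i).+1 iL (leqnn _) (leqnn _).
rewrite /corner sigma_small // => /(_ (leqnn _)) ->.
by rewrite /inner1 /diff1; ring.
Qed.

End Relations.

End LadderRing.

(** * The tower of block extensions *)

Section Tower.
Variables (k : fieldType) (N M : nat).
Local Notation L := (nblocks N M).
Local Notation d := (nvars N M).
Local Notation P := {mpoly k[d]}.
Local Notation R := (R2 k (ladder N M)).
Local Notation psi := (@psi k N M).
Local Notation phi := (@phi k N M).
Local Notation corner := (corner k N M).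
Local Notation inner1 := (inner1 k N M).
Local Notation inner2 := (inner2 k N M).
Local Notation diff1 := (diff1 k N M).
Local Notation diff2 := (diff2 k N M).
Local Notation um := (um N M).

Definition bn i : nat := if (i < N)%N then 2%N else 1%N.
Definition yR i (j : nat) : R := match j with 0%N => 1 | 1%N => inner1 i | _ => inner2 i end.
Definition yP i (j : nat) : P := psi (yR i j).
Definition wP i : P := 'X_[um i.+1].
(** With [n = bn i] and [q, p] the corners of block [i], [w i] is a root of a
    polynomial [q w^(n+1) - diff1 w^n - ... - p] over the parameters; the [yP i j]
    are the values of its Horner scheme, and the [eP i j] form the dual basis. *)
Definition eP i (j : nat) : P :=
  if j == 0%N then psi (corner i) * wP i ^+ bn i else wP i ^+ (bn i - j).

Definition parameters (f : P) := exists s, f = psi (phi s).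

Definition glayer (J : nat -> bool) s (j : 'I_(bn s).+1) : P := if J s then eP s j else yP s j.

(** At the blocks in [J] the layers are coinduced, elsewhere they are induced:
    [tower J L] is the module [C_J], which is the ring for [J] empty. *)
Fixpoint tower (J : nat -> bool) s : P -> Prop :=
  if s is s'.+1 then layer (tower J s') (@glayer J s') else parameters.

(** The base over which ring and module are dual: an induced layer enlarges it, a coinduced one does
    not. *)
Fixpoint base_tower (J : nat -> bool) s : P -> Prop :=
  if s is s'.+1 then
    if J s' then base_tower J s' else layer (base_tower J s') (fun j : 'I_(bn s').+1 => yP s' j)
  else parameters.

(** The index [j] with [eP i j = wP i ^+ e i] at a 2x3 block, and with [eP i j = 1] at a 2x2
    block. *)
Definition idx (e : nat -> bool) i : nat := if (i < N)%N then (if e i then 1%N else 2%N) else 1%N.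

Lemma idx_bn e i : (idx e i < (bn i).+1)%N.
Proof. by rewrite /idx /bn; case: ifP => //; case: (e i). Qed.

Lemma parametersD f g : parameters f -> parameters g -> parameters (f + g).
Proof. by move=> [s ->] [t ->]; exists (s + t); rewrite !rmorphD. Qed.
Lemma parametersM f g : parameters f -> parameters g -> parameters (f * g).
Proof. by move=> [s ->] [t ->]; exists (s * t); rewrite !rmorphM. Qed.
Lemma parametersN f : parameters f -> parameters (- f).
Proof. by move=> [s ->]; exists (- s); rewrite !rmorphN. Qed.
Lemma parameters0 : parameters 0. Proof. by exists 0; rewrite !rmorph0. Qed.
Lemma parameters1 : parameters 1. Proof. by exists 1; rewrite !rmorph1. Qed.
Lemma parameters_corner i : (i <= L)%N -> parameters (psi (corner i)).
Proof. by move=> iL; exists (mvar k d i); rewrite phi_corner. Qed.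
Lemma parameters_diff1 i : (i < L)%N -> parameters (psi (diff1 i)).
Proof. by move=> iL; exists (mvar k d (L + i).+1); rewrite phi_diff1. Qed.
Lemma parameters_diff2 i : (i < N)%N -> parameters (psi (diff2 i)).
Proof. by move=> iL; exists (mvar k d (L + L + i).+1); rewrite phi_diff2. Qed.

Section Block.
Variable i : nat.
Hypothesis iL : (i < L)%N.

Lemma psi_corner : psi (corner i) = 'X_[cornerm N M i].
Proof.
rewrite (@psi_cell _ _ _ i); last first.
  by rewrite /in_block iL !leqnn leqnSn ltnW // sigma_lt.
by rewrite cellm_lower // /colm eqxx.
Qed.

Lemma psi_inner1 : psi (inner1 i) = 'X_[um (if (i < N)%N then (L + L + i).+1 else (L + i).+1)%N].
Proof.
rewrite (@psi_cell _ _ _ i); last first.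
  by rewrite /in_block iL !leqnn !leqnSn /= sigma_lt.
rewrite cellm_lower // /colm gtn_eqF //; case: ltnP => iN.
  by rewrite sigma_big // ltn_eqF.
by rewrite sigma_small // eqxx.
Qed.

Lemma psi_inner2 : (i < N)%N -> psi (inner2 i) = 'X_[um (L + i).+1].
Proof.
move=> iN; rewrite (@psi_cell _ _ _ i); last first.
  by rewrite /in_block iL sigma_big // !leqnn leqnSn /= -addn2 leq_addr.
rewrite cellm_lower; last by rewrite -addn2 leq_addr.
by rewrite /colm sigma_big // eqxx gtn_eqF // -addn2 -[X in (X < _)%N]addn0 ltn_add2l.
Qed.

Lemma psi_corner_next : psi (corner i.+1) = wP i * 'X_[um (L + i).+1].
Proof.
rewrite (@psi_cell _ _ _ i); last first.
  by rewrite /in_block iL !leqnn leqnSn /= ltnW // sigma_lt.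
by rewrite cellm_lower // /colm eqxx /= mpolyXD.
Qed.

Lemma psi_diff1 : psi (diff1 i) = wP i * psi (corner i) - psi (inner1 i).
Proof.
rewrite /diff1 rmorphB /=; congr (_ - _).
rewrite (@psi_cell _ _ _ i); last first.
  by rewrite /in_block iL !leqnn leqnSn /= ltnW // sigma_lt.
rewrite cellm_upper; last by rewrite leqnn ltnW // sigma_lt.
by rewrite psi_corner mpolyXD /colm eqxx.
Qed.

Lemma psi_diff2 : (i < N)%N -> psi (diff2 i) = wP i * psi (inner1 i) - psi (inner2 i).
Proof.
move=> iN; rewrite /diff2 rmorphB /=; congr (_ - _).
rewrite (@psi_cell _ _ _ i); last first.
  by rewrite /in_block iL !leqnn !leqnSn /= sigma_lt.
rewrite cellm_upper; last by rewrite leqnSn sigma_lt.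
rewrite psi_inner1 iN mpolyXD /colm gtn_eqF // sigma_big // ltn_eqF //.
Qed.

Lemma corner_next : psi (corner i.+1) = wP i * psi (if (i < N)%N then inner2 i else inner1 i).
Proof.
rewrite psi_corner_next; case: ltnP => iN; first by rewrite psi_inner2.
by rewrite psi_inner1 ltnNge iN.
Qed.

End Block.

Lemma layer_pair n (A : P -> Prop) (g : 'I_n -> P) f (ka : nat -> P) :
  (forall m : 'I_n, A (ka m)) -> f = \sum_(m < n) ka m * g m -> layer A g f.
Proof. by move=> Aka ->; exists (fun m => ka m). Qed.

Lemma yR_mul i (j l : 'I_(bn i).+1) : (i < L)%N -> exists ka : nat -> {mpoly k[d]},
  yR i j * yR i l = \sum_(m < (bn i).+1) phi (ka m) * yR i m.
Proof.
move=> iL; pose z := mvar k d.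
have unit_case (m : 'I_(bn i).+1) : exists ka : nat -> {mpoly k[d]},
    yR i m = \sum_(m' < (bn i).+1) phi (ka m') * yR i m'.
  exists (fun m' : nat => (m' == m :> nat)%:R); rewrite (bigD1 m) //= eqxx rmorph1 mul1r big1 ?addr0 // => m'.
  by rewrite -val_eqE /= => /negbTE ->; rewrite rmorph0 mul0r.
have [j0|j0] := eqVneq (nat_of_ord j) 0%N; first by rewrite j0 mul1r.
have [l0|l0] := eqVneq (nat_of_ord l) 0%N; first by rewrite l0 mulr1.
move: (nat_of_ord j) (nat_of_ord l) (ltn_ord j) (ltn_ord l) j0 l0 => {}j {}l.
rewrite /bn; case: (ltnP i N) => iN.
  case: j => [|[|[|]]] //; case: l => [|[|[|]]] // _ _ _ _ /=.
  - exists (fun m => match m with 0%N => z (L + L + i).+1 * z i | 1%N => - z (L + i).+1 | _ => z i end).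
    rewrite !big_ord_recl big_ord0 /= rmorphM rmorphN /= /z phi_diff1 // phi_diff2 // phi_corner ?(ltnW iL) //.
    by rewrite inner11_big //; ring.
  - exists (fun m => match m with 0%N => z i * z i.+1 | 1%N => 0 | _ => - z (L + i).+1 end).
    rewrite !big_ord_recl big_ord0 /= rmorphM rmorphN rmorph0 /= /z phi_diff1 // !phi_corner ?(ltnW iL) //.
    by rewrite inner12_big //; ring.
  - exists (fun m => match m with 0%N => z i * z i.+1 | 1%N => 0 | _ => - z (L + i).+1 end).
    rewrite !big_ord_recl big_ord0 /= rmorphM rmorphN rmorph0 /= /z phi_diff1 // !phi_corner ?(ltnW iL) //.
    by rewrite mulrC inner12_big //; ring.
  exists (fun m => match m with 0%N => 0 | 1%N => z i.+1 | _ => - z (L + L + i).+1 end).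
  rewrite !big_ord_recl big_ord0 /= rmorphN rmorph0 /= /z phi_diff2 // phi_corner //.
  by rewrite inner22_big //; ring.
case: j => [|[|]] //; case: l => [|[|]] // _ _ _ _ /=.
exists (fun m => match m with 0%N => z i * z i.+1 | _ => - z (L + i).+1 end).
rewrite !big_ord_recl big_ord0 /= rmorphM rmorphN /= /z phi_diff1 // !phi_corner ?(ltnW iL) //.
by rewrite inner11_small //; ring.
Qed.

Lemma yP_mul i (j l : 'I_(bn i).+1) : (i < L)%N ->
  layer parameters (fun m : 'I_(bn i).+1 => yP i m) (yP i j * yP i l).
Proof.
move=> iL; have [ka e] := yR_mul j l iL.
apply: (@layer_pair _ _ _ _ (fun m => psi (phi (ka m)))); first by move=> m; exists (ka m).
by rewrite /yP -rmorphM e rmorph_sum; apply: eq_bigr => m _; rewrite rmorphM.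
Qed.

Lemma yP_eP_mul i (j l : 'I_(bn i).+1) : (i < L)%N -> exists ka : 'I_(bn i).+1 -> P,
  [/\ forall m, parameters (ka m), ka ord0 = (j == l)%:R
    & yP i j * eP i l = \sum_m ka m * eP i m].
Proof.
move=> iL; rewrite -val_eqE /=.
suff [ka [H1 H2 H3]] : exists ka : nat -> P, [/\ forall m, parameters (ka m), ka 0%N = (j == l :> nat)%:R
    & yP i j * eP i l = \sum_(m < (bn i).+1) ka m * eP i m].
  by exists (fun m : 'I_(bn i).+1 => ka m).
have [j0|j0] := eqVneq (nat_of_ord j) 0%N.
  exists (fun m : nat => (m == l :> nat)%:R); rewrite j0; split=> // [m|].
    by case: eqP => _; [apply: parameters1|apply: parameters0].
  rewrite (bigD1 l) //= eqxx /yP /= rmorph1 !mul1r big1 ?addr0 // => m.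
  by rewrite -val_eqE /= => /negbTE ->; rewrite mul0r.
have pq : parameters (psi (corner i)) by apply/parameters_corner/ltnW.
have pp : parameters (psi (corner i.+1)) by apply: parameters_corner.
have pc1 := parameters_diff1 iL.
set q := psi (corner i); set p := psi (corner i.+1) in pp *; set c1 := psi (diff1 i) in pc1 *.
have ec1 := psi_diff1 iL; have ep := corner_next iL.
move: (nat_of_ord j) (nat_of_ord l) (ltn_ord j) (ltn_ord l) j0 => {}j {}l.
rewrite /eP /bn; case: (ltnP i N) => iN.
  have pc2 := parameters_diff2 iN; set c2 := psi (diff2 i) in pc2 *.
  have ec2 := psi_diff2 iL iN; rewrite iN in ep.
  (* Horner form of the block equation: the identities below are polynomial in [wP i], [q], [c1],
     [c2] once [p] is replaced by its expression [ep']. *)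
  have ey1 : yP i 1 = wP i * q - c1 by rewrite /yP /= /c1 ec1; ring.
  have ey2 : yP i 2 = wP i * (wP i * q - c1) - c2 by rewrite -ey1 /yP /= /c2 ec2; ring.
  have ep' : p = wP i * (wP i * (wP i * q - c1) - c2) by rewrite /p ep -ey2.
  have P0 := parameters0; have P1 := parameters1.
  have PN := parametersN; have PM := parametersM.
  case: j => [|[|[|]]] //; case: l => [|[|[|]]] // _ _ _ /=.
  - exists (fun m => match m with 0%N => 0 | 1%N => q * c2 | _ => q * p end); split=> [[|[|?]]||] //; try by apply: PM.
    by rewrite !big_ord_recl big_ord0 /= -/q ey1 ep'; ring.
  - exists (fun m => match m with 0%N => 1 | 1%N => - c1 | _ => 0 end); split=> [[|[|?]]||] //; try by apply: PN.
    by rewrite !big_ord_recl big_ord0 /= -/q ey1; ring.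
  - exists (fun m => match m with 0%N => 0 | 1%N => q | _ => - c1 end); split=> [[|[|?]]||] //; try by apply: PN.
    by rewrite !big_ord_recl big_ord0 /= -/q ey1; ring.
  - exists (fun m => match m with 0%N => 0 | 1%N => q * p | _ => 0 end); split=> [[|[|?]]||] //; try by apply: PM.
    by rewrite !big_ord_recl big_ord0 /= -/q ey2 ep'; ring.
  - exists (fun m => match m with 0%N => 0 | 1%N => 0 | _ => p end); split=> [[|[|?]]||] //.
    by rewrite !big_ord_recl big_ord0 /= -/q ey2 ep'; ring.
  exists (fun m => match m with 0%N => 1 | 1%N => - c1 | _ => - c2 end); split=> [[|[|?]]||] //; try by apply: PN.
  by rewrite !big_ord_recl big_ord0 /= -/q ey2; ring.
have ey1 : yP i 1 = wP i * q - c1 by rewrite /yP /= /c1 ec1; ring.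
have ep' : p = wP i * (wP i * q - c1) by rewrite /p ep ltnNge iN -ey1.
have P0 := parameters0; have P1 := parameters1.
have PN := parametersN; have PM := parametersM.
case: j => [|[|]] //; case: l => [|[|]] // _ _ _ /=.
- exists (fun m => match m with 0%N => 0 | _ => q * p end); split=> [[|?]||] //; try by apply: PM.
  by rewrite !big_ord_recl big_ord0 /= -/q ey1 ep'; ring.
exists (fun m => match m with 0%N => 1 | _ => - c1 end); split=> [[|?]||] //; try by apply: PN.
by rewrite !big_ord_recl big_ord0 /= -/q ey1; ring.
Qed.

End Tower.

(** * Leading monomials of the tower *)

Section TowerLeads.
Variables (k : fieldType) (N M : nat).
Local Notation L := (nblocks N M).
Local Notation d := (nvars N M).
Local Notation P := {mpoly k[d]}.
Local Notation psi := (@psi k N M).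
Local Notation phi := (@phi k N M).
Local Notation corner := (corner k N M).
Local Notation um := (um N M).
Local Notation bn := (bn N).
Local Notation yP := (@yP k N M).
Local Notation eP := (@eP k N M).
Local Notation wP := (@wP k N M).
Local Notation v := (mvar k d).

Lemma var_um n : (n < d)%N -> v n = 'X_[um n].
Proof.
move=> nd; rewrite -[in LHS]/(nat_of_ord (Ordinal nd)) mvarE /um.
by congr ('X_[U_(_)]); apply/val_inj; rewrite /= inordK.
Qed.

Lemma w_lt i : (i < L)%N -> (i.+1 < d)%N. Proof. by rewrite /nvars; lia. Qed.
Lemma l_lt i : (i < L)%N -> ((L + i).+1 < d)%N. Proof. by rewrite /nvars; lia. Qed.
Lemma m_lt i : (i < N)%N -> ((L + L + i).+1 < d)%N. Proof. by rewrite /nvars; lia. Qed.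
Lemma N_lt i : (i < N)%N -> (i < L)%N. Proof. by rewrite /nblocks; lia. Qed.

(** In the coordinates [x], [w i], [diff1 i], [diff2 i] the parameters and the
    inner entries have distinct leading monomials; [chi] expresses the toric
    coordinates through them. *)
Fixpoint chi_corner i : P := if i is j.+1 then
    let a := v j.+1 * chi_corner j - v (L + j).+1 in
    v j.+1 * (if (j < N)%N then v j.+1 * a - v (L + L + j).+1 else a)
  else v 0.
Definition chi_inner1 j := v j.+1 * chi_corner j - v (L + j).+1.
Definition chi_inner2 j := v j.+1 * chi_inner1 j - v (L + L + j).+1.
Definition chi_var n : P :=
  if (n <= L)%N then v n else if (n <= L + L)%N then
    (if (n - L.+1 < N)%N then chi_inner2 (n - L.+1) else chi_inner1 (n - L.+1))
  else chi_inner1 (n - (L + L).+1).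

Definition chi : P -> P := mmap (@mpolyC d k) (fun i : 'I_d => chi_var i).

Lemma chi_is_additive : additive chi.
Proof. exact: mmap_is_additive. Qed.
Lemma chi_is_multiplicative : multiplicative chi.
Proof. exact: mmap_is_multiplicative. Qed.
HB.instance Definition _ := GRing.isAdditive.Build P P chi chi_is_additive.
HB.instance Definition _ := GRing.isMultiplicative.Build P P chi chi_is_multiplicative.

Lemma chi_um n : (n < d)%N -> chi 'X_[um n] = chi_var n.
Proof. by move=> nd; rewrite /chi mmapX mmap1U inordK. Qed.

Lemma chi_wP i : (i < L)%N -> chi (wP i) = v i.+1.
Proof. by move=> iL; rewrite chi_um ?w_lt // /chi_var iL. Qed.

Lemma chi_cornerE i : (i <= L)%N -> chi (psi (corner i)) = chi_corner i.
Proof.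
elim: i => [_|i IH iL]; first by rewrite psi_corner // /cornerm chi_um.
rewrite psi_corner_next // rmorphM /= chi_wP // chi_um ?l_lt // /chi_var.
have -> : ((L + i).+1 <= L)%N = false by lia.
have -> : ((L + i).+1 <= L + L)%N by lia.
by rewrite subSS addKn.
Qed.

Lemma chi_inner1E i : (i < L)%N -> chi (yP i 1) = chi_inner1 i.
Proof.
move=> iL; rewrite /yP /= psi_inner1 //; case: ltnP => iN.
  rewrite chi_um ?m_lt // /chi_var.
  have -> : ((L + L + i).+1 <= L)%N = false by lia.
  have -> : ((L + L + i).+1 <= L + L)%N = false by lia.
  by rewrite subSS addKn.
rewrite chi_um ?l_lt // /chi_var.
have -> : ((L + i).+1 <= L)%N = false by lia.
have -> : ((L + i).+1 <= L + L)%N by lia.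
by rewrite subSS addKn ltnNge iN.
Qed.

Lemma chi_inner2E i : (i < N)%N -> chi (yP i 2) = chi_inner2 i.
Proof.
move=> iN; have iL := N_lt iN; rewrite /yP /= psi_inner2 // chi_um ?l_lt // /chi_var.
have -> : ((L + i).+1 <= L)%N = false by lia.
have -> : ((L + i).+1 <= L + L)%N by lia.
by rewrite subSS addKn iN.
Qed.

Lemma chi_diff1 i : (i < L)%N -> chi (psi (diff1 k N M i)) = v (L + i).+1.
Proof.
move=> iL; rewrite (psi_diff1 _ iL) rmorphB /= rmorphM /= (chi_wP iL) (chi_cornerE (ltnW iL)).
by rewrite -[psi (inner1 _ _ _ _)]/(yP i 1) (chi_inner1E iL) /chi_inner1 opprB addrC subrK.
Qed.

Lemma chi_diff2 i : (i < N)%N -> chi (psi (diff2 k N M i)) = v (L + L + i).+1.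
Proof.
move=> iN; have iL := N_lt iN.
rewrite (psi_diff2 _ iL iN) rmorphB /= rmorphM /= (chi_wP iL).
rewrite -[psi (inner1 _ _ _ _)]/(yP i 1) -[psi (inner2 _ _ _ _)]/(yP i 2).
by rewrite (chi_inner1E iL) (chi_inner2E iN) /chi_inner2 opprB addrC subrK.
Qed.

(** Crossing block [t] multiplies the leading monomial of the corner by [(bn t).+1] factors [w t];
    these exponents are the moduli in [lead_adapted]. *)
Definition lead_corner i : 'X_{1..d} := (um 0 + \sum_(t < i) um t.+1 *+ (bn t).+1)%MM.

(** The monomial order compares degrees first, so a variable lies below every monomial of degree at
    least two. *)
Lemma mlead_sub_var (f : P) n : (1 < mdeg (mlead f))%N -> (n < d)%N ->
  f - v n != 0 /\ mlead (f - v n) = mlead f.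
Proof.
move=> f1 nd; have e : mlead (f - v n) = mlead f.
  apply: mleadDl; rewrite mleadN var_um // mleadXm; apply: lt_mdeg_ltmc.
  by rewrite mdeg1.
by split=> //; apply/eqP => z; move: f1; rewrite -e z mlead0 mdeg0.
Qed.

Lemma mlead_var_mul (f : P) n : (n < d)%N -> f != 0 ->
  v n * f != 0 /\ mlead (v n * f) = (um n + mlead f)%MM.
Proof.
move=> nd f0; have v0 : v n != 0 by rewrite var_um // -msize_poly_eq0 msizeX.
by rewrite mulf_neq0 // mleadM // (var_um nd) mleadXm.
Qed.

Lemma lead_corner_deg i : (0 < mdeg (lead_corner i))%N.
Proof. by rewrite mdegD mdeg1. Qed.

Lemma lead_inner1_aux i : (i < L)%N -> chi_corner i != 0 -> mlead (chi_corner i) = lead_corner i ->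
  chi_inner1 i != 0 /\ mlead (chi_inner1 i) = (um i.+1 + lead_corner i)%MM.
Proof.
move=> iL q0 eq; have [w0 ew] := mlead_var_mul (w_lt iL) q0.
have [|n0 en] := @mlead_sub_var (v i.+1 * chi_corner i) (L + i).+1 _ (l_lt iL).
  by rewrite ew eq mdegD mdeg1; have := lead_corner_deg i; lia.
by rewrite /chi_inner1 en ew eq.
Qed.

Lemma lead_inner2_aux i : (i < N)%N -> chi_inner1 i != 0 ->
  mlead (chi_inner1 i) = (um i.+1 + lead_corner i)%MM ->
  chi_inner2 i != 0 /\ mlead (chi_inner2 i) = (um i.+1 *+ 2 + lead_corner i)%MM.
Proof.
move=> iN q0 eq; have iL := N_lt iN; have [w0 ew] := mlead_var_mul (w_lt iL) q0.
have [|n0 en] := @mlead_sub_var (v i.+1 * chi_inner1 i) (L + L + i).+1 _ (m_lt iN).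
  by rewrite ew eq !mdegD mdeg1; have := lead_corner_deg i; lia.
by rewrite /chi_inner2 en ew eq (mulmS _ 1) mulm1n addmA.
Qed.

Lemma lead_chi_corner i : (i <= L)%N -> chi_corner i != 0 /\ mlead (chi_corner i) = lead_corner i.
Proof.
elim: i => [_|i IH iL].
  rewrite /= var_um // /lead_corner big_ord0 addm0 mleadXm.
  by rewrite -msize_poly_eq0 msizeX.
have [q0 eq] := IH (ltnW iL); have [a0 ea] := lead_inner1_aux iL q0 eq.
rewrite /= -/(chi_inner1 i).
have -> : lead_corner i.+1 = (um i.+1 *+ (bn i).+1 + lead_corner i)%MM.
  by rewrite /lead_corner big_ord_recr /= [RHS]addmC addmA.
rewrite /bn; case: ltnP => iN.
  have [b0 eb] := lead_inner2_aux iN a0 ea; rewrite -/(chi_inner2 i).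
  have [c0 ec] := mlead_var_mul (w_lt iL) b0; rewrite ec eb; split=> //.
  by rewrite [(um _ *+ 3)%MM]mulmS addmA.
have [c0 ec] := mlead_var_mul (w_lt iL) a0; rewrite ec ea; split=> //.
by rewrite (mulmS _ 1) mulm1n addmA.
Qed.

Lemma lead_yP i (j : 'I_(bn i).+1) : (i < L)%N -> chi (yP i j) != 0 /\
  mlead (chi (yP i j)) = (um i.+1 *+ j + (if j == ord0 then 0 else lead_corner i))%MM.
Proof.
move=> iL; have [q0 eq] := lead_chi_corner (ltnW iL).
have [a0 ea] := lead_inner1_aux iL q0 eq.
rewrite -[j == ord0]/(nat_of_ord j == 0%N); move: (nat_of_ord j) (ltn_ord j) => [|[|[|{}j]]] jb.
- have -> : chi (yP i 0) = 1 by rewrite /yP /= rmorph1 rmorph1.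
  by rewrite oner_neq0 mlead1 mulm0n add0m.
- by rewrite (chi_inner1E iL) ea mulm1n.
- have iN : (i < N)%N by move: jb; rewrite /bn; case: ifP.
  by rewrite (chi_inner2E iN); exact: lead_inner2_aux iN a0 ea.
by move: jb; rewrite /bn; case: ifP.
Qed.

Lemma lead_wP_exp i n : (i < L)%N -> chi (wP i ^+ n) != 0 /\ mlead (chi (wP i ^+ n)) = (um i.+1 *+ n)%MM.
Proof.
move=> iL; have v0 : v i.+1 != 0 by rewrite var_um ?w_lt // -msize_poly_eq0 msizeX.
rewrite rmorphXn /= chi_wP // expf_neq0 // mleadX // var_um ?w_lt //.
by rewrite mleadXm.
Qed.

Lemma lead_eP i (j : 'I_(bn i).+1) : (i < L)%N -> chi (eP i j) != 0 /\
  mlead (chi (eP i j)) = (um i.+1 *+ (bn i - j) + (if j == ord0 then lead_corner i else 0))%MM.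
Proof.
move=> iL; rewrite -[j == ord0]/(nat_of_ord j == 0%N) /eP.
have [w0 ew] := lead_wP_exp (bn i - j) iL.
case: (eqVneq (nat_of_ord j) 0%N) => [e|_]; last by rewrite ew addm0.
have [q0 eq] := lead_chi_corner (ltnW iL).
move: w0 ew; rewrite e subn0 => w0 ew.
rewrite rmorphM /= (chi_cornerE (ltnW iL)) (mleadM q0 w0) eq ew addmC; split=> //.
by rewrite mulf_neq0.
Qed.

Definition w_index t : 'I_d := inord t.+1.

Lemma um_coef n t : (n < d)%N -> (t < L)%N -> um n (w_index t) = (n == t.+1).
Proof.
move=> nd tL; rewrite mnm1E /w_index -val_eqE /= !inordK //; exact: w_lt.
Qed.

Lemma lead_corner_coef i t : (i <= L)%N -> (t < L)%N ->
  lead_corner i (w_index t) = if (t < i)%N then (bn t).+1 else 0%N.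
Proof.
move=> iL tL; rewrite mnmDE um_coef // add0n mnm_sumE.
case: ltnP => ti; last first.
  rewrite big1 // => t' _; rewrite mulmnE um_coef //; last by apply/w_lt/(leq_trans (ltn_ord t')).
  by rewrite eqSS ltn_eqF // (leq_trans (ltn_ord t')).
rewrite (bigD1 (Ordinal ti)) //= big1 ?addn0 => [|t' ne].
  by rewrite mulmnE um_coef ?w_lt // eqxx mul1n.
rewrite mulmnE um_coef ?w_lt //; last by apply/(leq_trans (ltn_ord t')).
by move: ne; rewrite -val_eqE /= eqSS => /negbTE ->.
Qed.

Lemma glayer_leads J s : (s < L)%N -> forall j : 'I_(bn s).+1,
  [/\ chi (glayer k M J j) != 0,
      mlead (chi (glayer k M J j)) (w_index s) = if J s then (bn s - j)%N else j
    & forall t, (s < t)%N -> (t < L)%N -> mlead (chi (glayer k M J j)) (w_index t) = 0%N].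
Proof.
move=> sL j; rewrite /glayer; have sd := w_lt sL.
have lc0 : lead_corner s (w_index s) = 0%N by rewrite lead_corner_coef ?ltnn // ltnW.
have lct t : (s < t)%N -> (t < L)%N -> lead_corner s (w_index t) = 0%N.
  by move=> st tL; rewrite lead_corner_coef ?(ltnW sL) // ltnNge (ltnW st).
have ums : um s.+1 (w_index s) = 1%N by rewrite um_coef // eqxx.
have umt t : (s < t)%N -> (t < L)%N -> um s.+1 (w_index t) = 0%N.
  by move=> st tL; rewrite um_coef // eqSS ltn_eqF.
case: (J s).
  have [g0 eg] := lead_eP j sL; rewrite eg; split=> // [|t st tL]; rewrite mnmDE mulmnE.
    by rewrite ums mul1n; case: ifP; rewrite ?lc0 ?mnm0E addn0.
  by rewrite umt // mul0n; case: ifP; rewrite ?lct ?mnm0E.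
have [g0 eg] := lead_yP j sL; rewrite eg; split=> // [|t st tL]; rewrite mnmDE mulmnE.
  by rewrite ums mul1n; case: ifP; rewrite ?lc0 ?mnm0E addn0.
by rewrite umt // mul0n; case: ifP; rewrite ?lct ?mnm0E.
Qed.

Definition lead_parameter n : 'X_{1..d} := if (n <= L)%N then lead_corner n else um n.

Lemma lead_parameterE (i : 'I_d) :
  chi (psi (parameter k N M i)) != 0 /\ mlead (chi (psi (parameter k N M i))) = lead_parameter i.
Proof.
rewrite /parameter /lead_parameter; have := ltn_ord i; move: (nat_of_ord i) => n nd.
have vl m : (m < d)%N -> v m != 0 /\ mlead (v m) = um m.
  by move=> md; rewrite var_um // -msize_poly_eq0 msizeX mleadXm.
case: leqP => nL; first by rewrite chi_cornerE //; apply: lead_chi_corner.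
case: leqP => nLL.
  have [i' ei] : exists i', n = (L + i').+1 by exists (n - L.+1)%N; lia.
  by rewrite ei subSS addKn chi_diff1; [apply: vl; rewrite -ei|lia].
have [i' ei] : exists i', n = (L + L + i').+1 by exists (n - (L + L).+1)%N; lia.
rewrite ei subSS addKn chi_diff2; first by apply: vl; rewrite -ei.
by move: nd; rewrite /nvars ei; lia.
Qed.

Lemma lead_parameter_coef (m : 'X_{1..d}) t : (t < L)%N ->
  (\sum_(i < d) lead_parameter i *+ m i)%MM (w_index t) =
  ((bn t).+1 * \sum_(i < d | t < i <= L) m i)%N.
Proof.
move=> tL; rewrite mnm_sumE big_distrr /= [RHS]big_mkcond; apply: eq_bigr => i _.
rewrite mulmnE /lead_parameter; case: (leqP i L) => iL; last first.
  rewrite andbF um_coef // (_ : (i == t.+1 :> nat) = false) ?mul0n //; lia.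
by rewrite lead_corner_coef // andbT; case: ifP.
Qed.

(** The exponent of [w t] gives the sum of the [m i] over the corners beyond [t], and that of [x]
    the sum over all corners; differences recover each of them. Beyond the corners, each parameter
    leads with its own variable. *)
Lemma lead_parameter_inj : injective (fun m : 'X_{1..d} => (\sum_(i < d) lead_parameter i *+ m i)%MM).
Proof.
move=> m m' e.
have big_t t : (t < L)%N -> (\sum_(i < d | t < i <= L) m i = \sum_(i < d | t < i <= L) m' i)%N.
  move=> tL; have := congr1 (fun u : 'X_{1..d} => u (w_index t)) e.
  by rewrite !lead_parameter_coef // => /eqP; rewrite eqn_mul2l /= => /eqP.
have sum0 (u : 'X_{1..d}) : (\sum_(i < d) lead_parameter i *+ u i)%MM (inord 0) =
   (\sum_(i < d | i <= L) u i)%N.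
  rewrite mnm_sumE [RHS]big_mkcond; apply: eq_bigr => i _.
  rewrite mulmnE /lead_parameter; case: ifP => iL.
    rewrite mnmDE mnm1E eqxx mnm_sumE big1 ?mul1n // => t _.
    rewrite mulmnE mnm1E -val_eqE /= !inordK //; apply/w_lt.
    exact: leq_trans (ltn_ord t) iL.
  by rewrite mnm1E -val_eqE /= !inordK // (_ : (i == 0 :> nat) = false) ?mul0n //; lia.
have split_t (u : 'X_{1..d}) (i : 'I_d) : (i <= L)%N ->
    (\sum_(l < d | i <= l <= L) u l = u i + \sum_(l < d | i < l <= L) u l)%N.
  move=> iL; rewrite (bigD1 i) ?leqnn //=; congr (_ + _)%N; apply: eq_bigl => l.
  by rewrite -val_eqE /=; lia.
apply/mnmP => i; have [iL|iL] := leqP i L.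
  have gt_eq : (\sum_(l < d | i < l <= L) m l = \sum_(l < d | i < l <= L) m' l)%N.
    have [lt|ge] := ltnP i L; first exact: big_t.
    by rewrite !big_pred0 // => l; lia.
  have ge_eq : (\sum_(l < d | i <= l <= L) m l = \sum_(l < d | i <= l <= L) m' l)%N.
    case: (nat_of_ord i) iL => [|i'] i'L; last exact: big_t.
    have := congr1 (fun u : 'X_{1..d} => u (inord 0)) e; rewrite !sum0.
    by move=> e0; rewrite -[X in (X = _)%N]/(\sum_(l < d | (l <= L)%N) m l)%N e0.
  by move: ge_eq; rewrite !split_t // gt_eq => /addIn.
have coef_i (u : 'X_{1..d}) : (\sum_(l < d) lead_parameter l *+ u l)%MM i = u i.
  rewrite mnm_sumE (bigD1 i) //= mulmnE /lead_parameter leqNgt iL /= mnm1E.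
  rewrite (_ : inord i = i) ?eqxx ?mul1n; last by apply/val_inj; rewrite /= inordK.
  rewrite big1 ?addn0 // => l ne; rewrite mulmnE; case: ifP => lL.
    rewrite mnmDE mnm1E mnm_sumE big1 ?addn0.
      rewrite -val_eqE /= inordK // (_ : (0 == i :> nat)%N = false) //; lia.
    move=> t _; rewrite mulmnE mnm1E -val_eqE /= inordK; last by apply/w_lt; have := ltn_ord t; lia.
    rewrite (_ : (t.+1 == i :> nat)%N = false) //; have := ltn_ord t; lia.
  rewrite mnm1E -val_eqE /= inordK // (_ : (l == i :> nat) = false) //.
  by apply/negbTE; rewrite val_eqE.
by have := congr1 (fun u : 'X_{1..d} => u i) e; rewrite !coef_i.
Qed.

Lemma lead_phi p : p != 0 -> exists m : 'X_{1..d},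
  chi (psi (phi p)) != 0 /\ mlead (chi (psi (phi p))) = (\sum_(i < d) lead_parameter i *+ m i)%MM.
Proof.
move=> p0.
have -> : chi (psi (phi p)) = mmap (@mpolyC d k) (fun i : 'I_d => chi (psi (parameter k N M i))) p.
  pose f := (chi \o psi \o phi)%FUN.
  apply: (mpoly_rmorph_eq (f := f) (g := mmap (@mpolyC d k) (fun i : 'I_d => chi (psi (parameter k N M i))))).
    by move=> c /=; rewrite psi_phiC /chi !mmapC.
  move=> i /=; rewrite mmapX mmap1U -mvarE phi_var //.
exact: (@mlead_substitution k d d _ lead_parameter (fun i => (lead_parameterE i).1)
   (fun i => (lead_parameterE i).2) lead_parameter_inj p p0).
Qed.

Lemma psi_phi_inj p : psi (phi p) = 0 -> p = 0.
Proof.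
move=> e; apply/eqP; apply: contrapT => /negP /lead_phi[m [/negP]].
by rewrite e rmorph0 eqxx.
Qed.

Lemma parameters_adapted : lead_adapted chi w_index (fun t => (bn t).+1) L (@parameters k N M) 0.
Proof.
move=> _ [s ->] s0.
have p0 : s != 0 by apply: contraNneq s0 => ->; rewrite !rmorph0.
have [m [c0 ec]] := lead_phi p0; split=> // t _ tL.
by rewrite ec lead_parameter_coef // dvdn_mulr.
Qed.

Lemma tower_step_adapted J s : (s < L)%N ->
  lead_adapted chi w_index (fun t => (bn t).+1) L (@tower k N M J s) s ->
  direct (@tower k N M J s) (@glayer k N M J s) /\
  lead_adapted chi w_index (fun t => (bn t).+1) L (@tower k N M J s.+1) s.+1.
Proof.
move=> sL lA; have gl := glayer_leads J sL.
apply: (@lead_adapted_layer k d P chi w_index (fun t => (bn t).+1) L _ _ (@glayer k N M J s) s lA sL) => //.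
- by move=> j; case: (gl j).
- move=> j l; have [_ -> _] := gl j; have [_ -> _] := gl l; move=> e; apply/val_inj => /=.
  have jb := ltn_ord j; have lb := ltn_ord l; move: e; case: (J s).
    by rewrite !modn_small; lia.
  by rewrite !modn_small.
by move=> j t st tL; have [_ _ ->] := gl j.
Qed.

Lemma tower_adapted J s : (s <= L)%N ->
  lead_adapted chi w_index (fun t => (bn t).+1) L (@tower k N M J s) s.
Proof.
elim: s => [_|s IH sL]; first exact: parameters_adapted.
by have [] := tower_step_adapted sL (IH (ltnW sL)).
Qed.

Lemma tower_direct J s : (s < L)%N -> direct (@tower k N M J s) (@glayer k N M J s).
Proof. by move=> sL; have [] := tower_step_adapted sL (@tower_adapted J s (ltnW sL)). Qed.

End TowerLeads.

(** * The ladder ring as a tower *)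

Section TowerRing.
Variables (k : fieldType) (N M : nat).
Local Notation L := (nblocks N M).
Local Notation d := (nvars N M).
Local Notation R := (R2 k (ladder N M)).
Local Notation psi := (@psi k N M).
Local Notation phi := (@phi k N M).
Local Notation corner := (corner k N M).
Local Notation diff1 := (diff1 k N M).
Local Notation diff2 := (diff2 k N M).
Local Notation inner1 := (inner1 k N M).
Local Notation inner2 := (inner2 k N M).
Local Notation bn := (bn N).
Local Notation yP := (@yP k N M).
Local Notation yR := (@yR k N M).
Local Notation tower := (@tower k N M).
Local Notation sg := (sigma N).

Definition ring_parameters (r : R) := exists s, r = phi s.

Fixpoint ring_tower s : R -> Prop :=
  if s is s'.+1 then layer (ring_tower s') (fun j : 'I_(bn s').+1 => yR s' j) else ring_parameters.

Lemma ring_tower_sum_closed s : sum_closed (ring_tower s).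
Proof.
elim: s => [|s IH]; last exact: layer_sum_closed.
split=> [|_ _ [p ->] [q ->]]; first by exists 0; rewrite rmorph0.
by exists (p + q); rewrite rmorphD.
Qed.

Lemma ring_towerS s r : ring_tower s r -> ring_tower s.+1 r.
Proof. by move=> Tr; apply: layer_incl => //; case: (ring_tower_sum_closed s). Qed.

Lemma ring_tower_mono s t r : (s <= t)%N -> ring_tower s r -> ring_tower t r.
Proof.
move=> st Tr; elim: t st => [|t IH]; first by rewrite leqn0 => /eqP <-.
by rewrite leq_eqVlt => /predU1P[<- //|/IH]; apply: ring_towerS.
Qed.

Lemma ring_tower_param s p : ring_tower s (phi p).
Proof. by apply: (@ring_tower_mono 0) => //; exists p. Qed.

Lemma ring_tower_mul s : (s <= L)%N -> mul_into (ring_tower s) (ring_tower s) (ring_tower s).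
Proof.
elim: s => [_ _ _ [p ->] [q ->]|s IH sL]; first by exists (p * q); rewrite rmorphM.
apply: (@layer_mul _ _ _ _ _ _ _ ring_parameters) => //.
- exact: ring_tower_sum_closed.
- exact/IH/ltnW.
- move=> _ r [p ->]; apply: (IH (ltnW sL)); exact: ring_tower_param.
move=> j l; have [ka ->] := yR_mul k j l sL.
by exists (fun m => phi (ka m)); split=> // m; exists (ka m).
Qed.

Lemma ring_tower_yR s j : (j <= bn s)%N -> ring_tower s.+1 (yR s j).
Proof.
move=> jb; apply: (@layer_gen _ _ _ (fun j : 'I_(bn s).+1 => yR s j) (Ordinal (jb : (j < (bn s).+1)%N))).
  by case: (ring_tower_sum_closed s).
by rewrite -(rmorph1 phi); apply: ring_tower_param.
Qed.

Lemma cell_generators (V : R -> Prop) : (forall x y, V x -> V y -> V (x + y)) ->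
  (forall n, (n < d)%N -> V (parameter k N M n)) ->
  (forall i j, (i < L)%N -> (0 < j <= bn i)%N -> V (yR i j)) ->
  forall i r c, in_block N M i r c -> V (cell k N M r c).
Proof.
move=> VD Vp Vy i r c /and3P[iL ri ci].
have Vc j : (j <= L)%N -> V (corner j).
  move=> jL; have jd : (j < d)%N by rewrite /nvars; lia.
  by rewrite -phi_corner // phi_var //; apply: Vp.
have V1 : V (inner1 i) by apply: (Vy i 1%N) => //; rewrite /bn; case: ifP.
have Vd1 : V (diff1 i) by rewrite -phi_diff1 // phi_var ?l_lt //; apply/Vp/l_lt.
have e1 : cell k N M i.+1 (sg i) = diff1 i + inner1 i by rewrite /diff1 subrK.
have Vc0 := Vc i (ltnW iL); have Vc1 := Vc i.+1 iL; rewrite /corner in Vc0 Vc1.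
have [iN|iN] := ltnP i N.
  have V2 : V (inner2 i) by apply: (Vy i 2%N) => //; rewrite /bn iN.
  have Vd2 : V (diff2 i) by rewrite -phi_diff2 // phi_var ?m_lt //; apply/Vp/m_lt.
  have e2 : cell k N M i.+1 (sg i).+1 = diff2 i + inner2 i by rewrite /diff2 subrK.
  rewrite sigma_big // in ci Vc1.
  have : c = sg i \/ c = (sg i).+1 \/ c = (sg i).+2 by lia.
  have : r = i \/ r = i.+1 by lia.
  case=> -> [->|[->|->]] //; first by rewrite e1; apply: VD.
  by rewrite e2; apply: VD.
rewrite sigma_small // in ci Vc1.
have : c = sg i \/ c = (sg i).+1 by lia.
have : r = i \/ r = i.+1 by lia.
by case=> -> [->|->] //; rewrite e1; apply: VD.
Qed.

Lemma ring_tower_all r : ring_tower L r.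
Proof.
have TD := (ring_tower_sum_closed L).2.
apply: (@ladder_ring_ind k N M (ring_tower L)).
- by move=> a; rewrite -phiC; apply: ring_tower_param.
- exact: TD.
- exact: (@ring_tower_mul L (leqnn _)).
apply: (cell_generators TD) => [n nd|i j iL /andP[_ jb]].
  by rewrite -phi_var //; apply: ring_tower_param.
by apply: (@ring_tower_mono i.+1 L _ iL); apply: ring_tower_yR.
Qed.

Local Notation no := (fun _ : nat => false).

Lemma psi_ring_tower s r : ring_tower s r -> tower no s (psi r).
Proof.
elim: s r => [_ [p ->]|s IH _ [x [Tx ->]]]; first by exists p.
exists (fun j => psi (x j)); split=> [j|]; first exact: (IH _ (Tx j)).
by rewrite rmorph_sum; apply: eq_bigr => j _; rewrite rmorphM.
Qed.

Lemma tower_psi s f : tower no s f -> exists r, psi r = f.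
Proof.
elim: s f => [_ [p ->]|s IH _ [x [Tx ->]]]; first by exists (phi p).
have [y yP] := choice (fun j => IH _ (Tx j)).
exists (\sum_j y j * yR s j); rewrite rmorph_sum; apply: eq_bigr => j _.
by rewrite rmorphM /= yP.
Qed.

Lemma tower_noE f : tower no L f <-> exists r, psi r = f.
Proof.
split=> [|[r <-]]; first exact: tower_psi.
exact/psi_ring_tower/ring_tower_all.
Qed.

(** Elements of [R] can be written in the tower using only the 2-minors, and the images of its
    layers are direct in [P]; so the minors already generate the toric ideal. *)
Lemma psi_inj : injective psi.
Proof.
suff inj0 s r : (s <= L)%N -> ring_tower s r -> psi r = 0 -> r = 0.
  move=> r r' e; apply/eqP; rewrite -subr_eq0; apply/eqP.
  apply: (inj0 L) => //; first exact: ring_tower_all.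
  by rewrite rmorphB /= e subrr.
elim: s r => [_ _ [p ->]|s IH _ sL [x [Tx ->]]].
  by move=> /psi_phi_inj ->; rewrite rmorph0.
move=> e; apply: big1 => j _.
rewrite (IH (x j) (ltnW sL) (Tx j)) ?mul0r //.
apply: (@tower_direct k N M no s sL (fun j => psi (x j))) => [l|].
  exact: (psi_ring_tower (Tx l)).
by rewrite -[RHS]e rmorph_sum; apply: eq_bigr => l _; rewrite rmorphM.
Qed.

End TowerRing.

(** * Dual bases along the tower *)

Section TowerDuality.
Variables (k : fieldType) (N M : nat).
Local Notation L := (nblocks N M).
Local Notation d := (nvars N M).
Local Notation P := {mpoly k[d]}.
Local Notation R := (R2 k (ladder N M)).
Local Notation bn := (bn N).
Local Notation yP := (@yP k N M).
Local Notation eP := (@eP k N M).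
Local Notation parameters := (@parameters k N M).
Local Notation tower := (@tower k N M).
Local Notation base_tower := (@base_tower k N M).
Local Notation no := (fun _ : nat => false).
Local Notation all := (fun _ : nat => true).
Local Notation idx := (idx N).

Lemma dual_parameters : dual_data parameters parameters parameters
  (fun _ : unit => 1) (fun _ : unit => 1) id.
Proof.
have sP : sum_closed parameters by split; [apply: parameters0|apply: parametersD].
have P1 := @parameters1 k N M.
split=> //.
- split=> //; first exact: parametersM.
  by apply: parametersN.
- by split=> //; apply: parametersM.
- by split=> //; apply: parametersM.
- by move=> r _; rewrite (big_pred1 tt) ?mulr1 //; case.
- by move=> r _; rewrite (big_pred1 tt) ?mulr1 ?mul1r //; case.
by case; case; rewrite mulr1.
Qed.

Lemma base_tower_parameters J s f : parameters f -> base_tower J s f.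
Proof.
elim: s f => [//|s IH] f pf /=; case: (J s); first exact: IH.
by apply: layer_incl; [rewrite /yP /= rmorph1|apply/IH/parameters0|apply: IH].
Qed.

Section Step.
Variables (J : nat -> bool) (s : nat) (I : finType) (b c : I -> P) (tau : P -> P).
Hypothesis sL : (s < L)%N.
Hypothesis D : dual_data (tower no s) (tower J s) (base_tower J s) b c tau.

Let y0 : yP s (@ord0 (bn s)) = 1. Proof. by rewrite /yP rmorph1. Qed.

Let yy (j l : 'I_(bn s).+1) : layer (base_tower J s) (fun m : 'I_(bn s).+1 => yP s m) (yP s j * yP s l).
Proof. by apply: layer_mono (yP_mul k j l sL) => f; apply: base_tower_parameters. Qed.

Lemma tower_dual_coinduced : J s -> exists tau',
  dual_data (tower no s.+1) (tower J s.+1) (base_tower J s.+1)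
    (fun ij : I * 'I_(bn s).+1 => b ij.1 * yP s ij.2) (fun ij => c ij.1 * eP s ij.2) tau' /\
  forall x (j l : 'I_(bn s).+1), tower J s x -> tau' (x * (yP s j * eP s l)) = (j == l)%:R * tau x.
Proof.
move=> Js; have dg := @tower_direct k N M J s sL; rewrite /= /glayer Js in dg *.
apply: (dual_coinduced D y0 yy _ dg) => j l.
have [ka [pka ka0 e]] := yP_eP_mul k j l sL.
by exists ka; split=> // m; apply: base_tower_parameters.
Qed.

Lemma tower_dual_induced : J s = false -> exists tau',
  dual_data (tower no s.+1) (tower J s.+1) (base_tower J s.+1) b c tau'.
Proof.
move=> Js; have dg := @tower_direct k N M J s sL; rewrite /= /glayer Js in dg *.
exact: (dual_induced D y0 yy dg).
Qed.

End Step.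

Lemma tower_dual J s : (s <= L)%N -> exists (I : finType) (b c : I -> P) (tau : P -> P),
  dual_data (tower no s) (tower J s) (base_tower J s) b c tau.
Proof.
elim: s => [_|s IH sL].
  by exists unit, (fun=> 1), (fun=> 1), id; apply: dual_parameters.
have [I [b [c [tau D]]]] := IH (ltnW sL).
case e: (J s).
  by have [tau' [D' _]] := tower_dual_coinduced sL D e; do 4 eexists; exact: D'.
by have [tau' D'] := tower_dual_induced sL D e; do 4 eexists; exact: D'.
Qed.

Lemma base_tower_all s : base_tower all s = parameters.
Proof. by elim: s. Qed.

Definition ypow (e : nat -> bool) s := \prod_(i < s) yP i (idx e i).
Definition epow (e : nat -> bool) s := \prod_(i < s) eP i (idx e i).

(** With every layer coinduced the base stays the ring of parameters, and the pairing of products of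
    basis elements factors over the blocks; this is recorded for later use on the canonical
    module. *)
Lemma tower_dual_all s : (s <= L)%N -> exists (I : finType) (b c : I -> P) (tau : P -> P),
  dual_data (tower no s) (tower all s) parameters b c tau /\
  forall e f, [/\ tower no s (ypow e s), tower all s (epow f s) &
    tau (ypow e s * epow f s) = \prod_(i < s) (idx e i == idx f i)%:R].
Proof.
elim: s => [_|s IH sL].
  exists unit, (fun=> 1), (fun=> 1), id; split; first exact: dual_parameters.
  by move=> e f; rewrite /ypow /epow !big_ord0 mulr1; split=> //; apply: parameters1.
have [I [b [c [tau [D pair]]]]] := IH (ltnW sL).
rewrite -(base_tower_all s) in D.
have [tau' [D' key]] := tower_dual_coinduced sL D isT.
rewrite base_tower_all in D'; do 4 eexists; split; first exact: D'.
move=> e f; have [Ye Ef epair] := pair e f.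
rewrite /ypow /epow !big_ord_recr /= -/(ypow e s) -/(epow f s).
have es : (idx e s < (bn s).+1)%N by apply: idx_bn.
have fs : (idx f s < (bn s).+1)%N by apply: idx_bn.
split.
- by exists (fun j => if j == Ordinal es then ypow e s else 0); split=> [j|];
    [case: eqP => _ //; case: (dual_T D) => -[]
    |rewrite (bigD1 (Ordinal es)) //= eqxx big1 ?addr0 // => j /negbTE ->; rewrite mul0r].
- by exists (fun j => if j == Ordinal fs then epow f s else 0); split=> [j|];
    [case: eqP => _ //; case: (dual_C D) => -[]
    |rewrite (bigD1 (Ordinal fs)) //= eqxx big1 ?addr0 // => j /negbTE ->; rewrite mul0r].
rewrite mulrACA (key (ypow e s * epow f s) (Ordinal es) (Ordinal fs)).
  by rewrite epair mulrC -val_eqE.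
by case: (dual_C D) => _; apply.
Qed.

End TowerDuality.

Section TowerModules.
Variables (k : fieldType) (N M : nat).
Local Notation L := (nblocks N M).
Local Notation d := (nvars N M).
Local Notation P := {mpoly k[d]}.
Local Notation R := (R2 k (ladder N M)).
Local Notation psi := (@psi k N M).
Local Notation tower := (@tower k N M).
Local Notation base_tower := (@base_tower k N M).

(** A copy of [P] that carries the [R]-module structure through [psi] in place of the scaling by
    [k]. *)
Definition toric : Type := P.
HB.instance Definition _ := GRing.Zmodule.on toric.

Definition toric_scale (r : R) (f : toric) : toric := psi r * f.

Lemma toric_scaleA a b v : toric_scale a (toric_scale b v) = toric_scale (a * b) v.
Proof. by rewrite /toric_scale rmorphM mulrA. Qed.
Lemma toric_scale1 : left_id 1 toric_scale.
Proof. by move=> v; rewrite /toric_scale rmorph1 mul1r. Qed.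
Lemma toric_scaleDr : right_distributive toric_scale +%R.
Proof. by move=> a u v; rewrite /toric_scale mulrDr. Qed.
Lemma toric_scaleDl v : {morph toric_scale^~ v : a b / a + b}.
Proof. by move=> a b; rewrite /toric_scale rmorphD mulrDl. Qed.

HB.instance Definition _ := GRing.Zmodule_isLmodule.Build R toric
  toric_scaleA toric_scale1 toric_scaleDr toric_scaleDl.

Lemma tower_mul J r (f : P) : tower J L f -> tower J L (psi r * f).
Proof.
have [I [b [c [tau D]]]] := @tower_dual k N M J L (leqnn _).
case: (dual_C D) => _; apply; apply/tower_noE; by exists r.
Qed.

Lemma tower_submod J : submod (tower J L : toric -> Prop).
Proof.
have [I [b [c [tau D]]]] := @tower_dual k N M J L (leqnn _).
have [[T0 TD] _] := dual_C D; split=> //.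
by move=> a x Tx; apply: tower_mul.
Qed.

Definition tower_module J : lmodType R := submodule (tower_submod J).

Lemma tower_module_semidualizing J : semidualizing (tower_module J).
Proof.
have [I [b [c [tau D]]]] := @tower_dual k N M J L (leqnn _).
have bR i : exists r, psi r = b i by apply/tower_noE/(dual_b D).
have [b' eb] := choice bR.
have tR (x : tower_module J) : exists r, psi r = tau (val x).
  have [_ _ ET] := dual_E D.
  exact/tower_noE/ET/(dual_tau D)/(submodule_prop x).
have [tau' etau] := choice tR.
pose c' i : tower_module J := to_submodule (tower_submod J) (dual_c D i).
have tx (x : tower_module J) : tower J L (val x) by apply: submodule_prop.
have psiI := @psi_inj k N M.
apply: (@dual_bases_semidualizing R (tower_module J) I (fun r => base_tower J L (psi r)) b' c' tau').
- exact: noetherian_ladder.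
- by move=> x; rewrite etau; apply: (dual_tau D).
- by move=> x y; apply: psiI; rewrite rmorphD /= !etau (dual_tauD D).
- by move=> e x Ee; apply: psiI; rewrite rmorphM /= !etau (dual_tauZ D).
- move=> r; apply: psiI; rewrite rmorph_sum {1}(dual_ring D (r := psi r)); last by apply/tower_noE; exists r.
  by apply: eq_bigr => i _; rewrite rmorphM /= etau eb.
- move=> x; apply: val_inj; rewrite {1}(dual_module D (tx x)).
  rewrite [RHS](linear_sum (mk_linear (@submodule_val_linear _ _ _ (tower_submod J)))); apply: eq_bigr => i _.
  rewrite -[RHS]/(psi (tau' (b' i *: x)) * c i) etau -[\val (b' i *: x)]/(psi (b' i) * val x).
  by rewrite eb.
move=> i j; apply: psiI; rewrite etau rmorph_nat /= -(dual_pairing D).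
by rewrite -eb.
Qed.

End TowerModules.

(** * Monomials of the tower modules *)

Section ToricMonomials.
Variables (k : fieldType) (N M : nat).
Local Notation L := (nblocks N M).
Local Notation d := (nvars N M).
Local Notation P := {mpoly k[d]}.
Local Notation psi := (@psi k N M).
Local Notation phi := (@phi k N M).
Local Notation corner := (corner k N M).
Local Notation diff1 := (diff1 k N M).
Local Notation diff2 := (diff2 k N M).
Local Notation inner1 := (inner1 k N M).
Local Notation inner2 := (inner2 k N M).
Local Notation um := (um N M).
Local Notation cornerm := (cornerm N M).
Local Notation bn := (bn N).
Local Notation wP := (@wP k N M).
Local Notation eP := (@eP k N M).
Local Notation tower := (@tower k N M).
Implicit Types (m : 'X_{1..d}) (K : nat -> bool).

Definition xexp m := m (inord 0).
Definition wexp m i := m (inord i.+1).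
Definition lexp m i := m (inord (L + i).+1).
Definition cexp m i : nat := if (i < N)%N then m (inord (L + L + i).+1) else 0%N.
(** The exponents in [m] of the two factors of [psi (corner i)], which is
    [w i.-1 * l i.-1], or the variable [x] if [i = 0]. *)
Definition in1 m i := if i is j.+1 then wexp m j else xexp m.
Definition in2 m i := if i is j.+1 then lexp m j else xexp m.

(** A factor [w i] turns an upper entry of block [i] into a lower one, so it needs an entry to act
    on: one of the last or middle column, or the first corner, whose two factors give the two
    inequalities. [K] allows one [w i] in excess. *)
Definition allowed (K : nat -> bool) m := forall i, (i < L)%N ->
  (wexp m i <= in1 m i + (lexp m i + cexp m i) + K i)%N /\
  (wexp m i <= in2 m i + (lexp m i + cexp m i) + K i)%N.

Lemma wexpD m1 m2 i : wexp (m1 + m2) i = (wexp m1 i + wexp m2 i)%N. Proof. exact: mnmDE. Qed.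
Lemma lexpD m1 m2 i : lexp (m1 + m2) i = (lexp m1 i + lexp m2 i)%N. Proof. exact: mnmDE. Qed.
Lemma xexpD m1 m2 : xexp (m1 + m2) = (xexp m1 + xexp m2)%N. Proof. exact: mnmDE. Qed.
Lemma cexpD m1 m2 i : cexp (m1 + m2) i = (cexp m1 i + cexp m2 i)%N.
Proof. by rewrite /cexp; case: ifP => // _; apply: mnmDE. Qed.
Lemma in1D m1 m2 i : in1 (m1 + m2) i = (in1 m1 i + in1 m2 i)%N.
Proof. case: i => [|i]; [exact: xexpD|exact: wexpD]. Qed.
Lemma in2D m1 m2 i : in2 (m1 + m2) i = (in2 m1 i + in2 m2 i)%N.
Proof. case: i => [|i]; [exact: xexpD|exact: lexpD]. Qed.

Lemma allowedD (K1 K2 K : nat -> bool) m1 m2 : (forall i, (i < L)%N -> (K1 i + K2 i <= K i)%N) ->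
  allowed K1 m1 -> allowed K2 m2 -> allowed K (m1 + m2).
Proof.
move=> KK a1 a2 i iL; have := KK i iL; have [h1 h2] := a1 i iL; have [h3 h4] := a2 i iL.
by rewrite wexpD in1D in2D lexpD cexpD; lia.
Qed.

Lemma um_exp n t : (n < d)%N -> (t < d)%N -> um n (inord t) = (n == t).
Proof. by move=> nd td; rewrite mnm1E -val_eqE /= !inordK. Qed.

Lemma wexp_um n i : (n < d)%N -> (i < L)%N -> wexp (um n) i = (n == i.+1).
Proof. by move=> nd iL; rewrite /wexp um_exp //; apply: w_lt. Qed.
Lemma lexp_um n i : (n < d)%N -> (i < L)%N -> lexp (um n) i = (n == (L + i).+1).
Proof. by move=> nd iL; rewrite /lexp um_exp //; apply: l_lt. Qed.
Lemma cexp_um n i : (n < d)%N -> (i < L)%N -> cexp (um n) i = (i < N)%N && (n == (L + L + i).+1).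
Proof. by move=> nd iL; rewrite /cexp; case: ltnP => // iN; rewrite um_exp //; apply: m_lt. Qed.
Lemma xexp_um n : (n < d)%N -> xexp (um n) = (n == 0%N).
Proof. by move=> nd; rewrite /xexp um_exp. Qed.

Lemma in1_um n i : (n < d)%N -> (i < L)%N -> in1 (um n) i = (n == i).
Proof. by move=> nd iL; case: i iL => [|i] iL; [apply: xexp_um|apply: wexp_um => //; apply: ltnW]. Qed.
Lemma in2_um n i : (n < d)%N -> (i < L)%N ->
  in2 (um n) i = (n == if i is j.+1 then (L + j).+1 else 0%N).
Proof. by move=> nd iL; case: i iL => [|i] iL; [apply: xexp_um|apply: lexp_um => //; apply: ltnW]. Qed.

Definition um_expE := (wexp_um, lexp_um, cexp_um, in1_um, in2_um).
Definition expD := (wexpD, lexpD, cexpD, in1D, in2D).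

Local Notation no := (fun _ : nat => false).
Local Notation only s := (fun i : nat => (i == s) && (i < N)%N).

Lemma allowed_intro m : (forall i, (i < L)%N -> (0 < wexp m i)%N -> wexp m i = 1%N /\
  ((0 < lexp m i + cexp m i)%N \/ (0 < in1 m i)%N /\ (0 < in2 m i)%N)) -> allowed no m.
Proof.
move=> H i iL; have [->//|] := posnP (wexp m i).
by move=> /(H i iL)[-> ]; lia.
Qed.

Lemma allowed_um n : (n < d)%N -> ((n == 0%N) || (L < n)%N) -> allowed no (um n).
Proof. by move=> nd H; apply: allowed_intro => i iL; rewrite wexp_um //; lia. Qed.

Lemma allowed_corner i : (i <= L)%N -> allowed no (cornerm i).
Proof.
case: i => [_|j jL]; first exact: allowed_um.
have h1 := w_lt jL; have h2 := l_lt jL; apply: allowed_intro => t tL.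
rewrite /cornerm wexpD !wexp_um // => pos.
have e : t = j by lia.
by rewrite e lexpD !lexp_um // eqxx; lia.
Qed.

Lemma allowed_w i : (i < N)%N -> allowed (only i) (um i.+1).
Proof.
move=> iN t tL; have h1 := w_lt (N_lt M iN); rewrite wexp_um // eqSS eq_sym.
by case: eqP => [->|]; [rewrite iN|]; lia.
Qed.

Lemma allowed_w_corner i : (i < L)%N -> allowed no (um i.+1 + cornerm i).
Proof.
move=> iL; have h1 := w_lt iL; apply: allowed_intro => t tL.
case: i iL h1 => [|j] jL h1; rewrite /cornerm.
  rewrite wexpD !wexp_um // => pos; have -> : t = 0%N by lia.
  by split=> //; right; rewrite in1D in2D !in1_um ?in2_um.
have h2 := l_lt (ltnW jL); have h3 := w_lt (ltnW jL).
rewrite !wexpD !wexp_um // => pos; have : t = j.+1 \/ t = j by lia.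
case=> ->; split; try lia.
  by right; rewrite !in1D !in2D !in1_um ?in2_um ?eqxx //; lia.
have jL' := ltnW jL; left; rewrite !lexpD !lexp_um // !eqxx; lia.
Qed.

Lemma allowed_w_l i : (i < L)%N -> allowed no (um i.+1 + um (L + i).+1).
Proof.
move=> iL; have h1 := w_lt iL; have h2 := l_lt iL; apply: allowed_intro => t tL.
rewrite wexpD !wexp_um // => pos; have -> : t = i by lia.
by split; [lia|left; rewrite lexpD !lexp_um // eqxx; lia].
Qed.

Lemma allowed_w_m i : (i < N)%N -> allowed no (um i.+1 + um (L + L + i).+1).
Proof.
move=> iN; have iL := N_lt M iN.
have h1 := w_lt iL; have h2 := m_lt M iN; apply: allowed_intro => t tL.
rewrite wexpD !wexp_um // => pos; have -> : t = i by lia.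
by split; [lia|left; rewrite cexpD !cexp_um // eqxx iN; lia].
Qed.

Lemma allowed_cell i r c : in_block N M i r c -> allowed no (cellm N M r c).
Proof.
move=> /and3P[iL ri ci].
have key : cellm N M r c = colm N M i c \/ cellm N M r c = (um i.+1 + colm N M i c)%MM.
  have : r = i \/ r = i.+1 by lia.
  case=> ->; [left; rewrite cellm_lower //; by case/andP: ci|right; exact: cellm_upper].
case: key => -> {ri r}; rewrite /colm; case: eqP => [_|/eqP ne1].
- exact/allowed_corner/ltnW.
- case: eqP => [_|/eqP ne2].
    by apply: allowed_um; [apply: l_lt|lia].
  have iN : (i < N)%N by rewrite ltnNge; apply/negP => iN; rewrite sigma_small // in ci ne2; lia.
  by apply: allowed_um; [apply: m_lt|lia].
- exact: allowed_w_corner.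
case: eqP => [_|/eqP ne2]; first exact: allowed_w_l.
have iN : (i < N)%N by rewrite ltnNge; apply/negP => iN; rewrite sigma_small // in ci ne2; lia.
exact: allowed_w_m.
Qed.

Definition supported K (f : P) := forall m, m \in msupp f -> allowed K m.

Lemma supported_sum K : sum_closed (supported K).
Proof.
split=> [m|f g Kf Kg m]; first by rewrite msupp0.
by move=> /msuppD_le; rewrite mem_cat => /orP[/Kf|/Kg].
Qed.

Lemma supportedM (K1 K2 K : nat -> bool) f g : (forall i, (i < L)%N -> (K1 i + K2 i <= K i)%N) ->
  supported K1 f -> supported K2 g -> supported K (f * g).
Proof.
move=> KK Kf Kg m /msuppM_le/allpairsP[[m1 m2] /= [/Kf a1 /Kg a2 ->]].
exact: allowedD KK a1 a2.
Qed.

Lemma supportedX K m : allowed K m -> supported K 'X_[m].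
Proof. by move=> Km n; rewrite msuppX inE => /eqP ->. Qed.

Lemma supported_psi r : supported no (psi r).
Proof.
move: r; apply: (@ladder_ring_ind k N M (fun r => supported no (psi r))).
- move=> a m; rewrite -phiC psi_phiC msuppC; case: ifP => // _; rewrite inE => /eqP -> i iL.
  by rewrite /wexp mnm0E.
- by move=> x y Kx Ky; rewrite rmorphD; apply: (supported_sum no).2.
- by move=> x y Kx Ky; rewrite rmorphM; apply: supportedM Kx Ky => i _.
- by move=> i r c H; rewrite (psi_cell _ H); apply/supportedX/(allowed_cell H).
Qed.

Lemma supportedW K f : supported no f -> supported K f.
Proof. by move=> Kf m /Kf a i /a[]; rewrite !addn0; lia. Qed.

Lemma supported1 K : supported K 1.
Proof. by apply: supportedW; rewrite -(rmorph1 psi); apply: supported_psi. Qed.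

Lemma supported_eP s j : (s < L)%N -> (j <= bn s)%N -> supported (only s) (eP s j).
Proof.
move=> sL; rewrite /eP /bn; case: ltnP => sN jb.
  have Kw : supported (only s) (wP s) by apply/supportedX/(allowed_w sN).
  case: j jb => [|[|[|//]]] _ /=; rewrite ?expr1 ?expr0 //; last exact: supported1.
  rewrite psi_corner // expr2 mulrA; apply: (@supportedM no (only s)) => //.
  by rewrite mulrC -mpolyXD; apply/supportedX/allowed_w_corner.
apply: supportedW; case: j jb => [|[|//]] _ /=; last exact: supported1.
by rewrite psi_corner // expr1 mulrC -mpolyXD; apply/supportedX/allowed_w_corner.
Qed.

Lemma tower_supported_aux J s f : (s <= L)%N -> tower J s f ->
  supported (fun i => [&& J i, (i < N)%N & (i < s)%N]) f.
Proof.
elim: s f => [f _ [p ->]|s IH _ sL [x [Tx ->]]]; first exact/supportedW/supported_psi.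
apply: sum_closed_sum => [|j _]; first exact: supported_sum.
have Kx := IH _ (ltnW sL) (Tx j); rewrite /glayer; case Js: (J s).
  apply: supportedM Kx (supported_eP (j := j) sL _) => [i iL|]; last by rewrite -ltnS.
  by case: (eqVneq i s) => [->|ne]; [rewrite Js|]; lia.
by apply: supportedM Kx (@supported_psi _) => i iL; lia.
Qed.

Lemma tower_supported J f : tower J L f -> supported (fun i => J i && (i < N)%N) f.
Proof.
move=> /(tower_supported_aux (leqnn _)) Kf m /Kf a i iL.
by have := a i iL; rewrite iL andbT.
Qed.

Definition toric_image (f : P) := exists r, psi r = f.

Lemma toric_image1 : toric_image 1. Proof. by exists 1; rewrite rmorph1. Qed.
Lemma toric_imageM f g : toric_image f -> toric_image g -> toric_image (f * g).
Proof. by move=> [r <-] [s <-]; exists (r * s); rewrite rmorphM. Qed.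
Lemma toric_imageX f n : toric_image f -> toric_image (f ^+ n).
Proof. by move=> [r <-]; exists (r ^+ n); rewrite rmorphXn. Qed.

Definition xP : P := 'X_[um 0].
Definition lP i : P := 'X_[um (L + i).+1].
Definition mP i : P := if (i < N)%N then 'X_[um (L + L + i).+1] else 1.

Lemma toric_image_corner i : (i < L)%N -> toric_image 'X_[cornerm i].
Proof. by move=> iL; exists (corner i); rewrite psi_corner. Qed.

Lemma toric_image_w_corner i : (i < L)%N -> toric_image (wP i * 'X_[cornerm i]).
Proof.
move=> iL; exists (diff1 i + inner1 i); rewrite rmorphD /= psi_diff1 //.
by rewrite psi_corner // subrK.
Qed.

Lemma toric_image_l i : (i < L)%N -> toric_image (lP i).
Proof.
move=> iL; have [iN|iN] := ltnP i N; first by exists (inner2 i); rewrite psi_inner2.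
by exists (inner1 i); rewrite psi_inner1 // ltnNge iN.
Qed.

Lemma toric_image_w_l i : (i < L)%N -> toric_image (wP i * lP i).
Proof. by move=> iL; exists (corner i.+1); rewrite psi_corner_next. Qed.

Lemma toric_image_m i : (i < L)%N -> toric_image (mP i).
Proof.
move=> iL; rewrite /mP; case: ltnP => iN; last exact: toric_image1.
by exists (inner1 i); rewrite psi_inner1 // iN.
Qed.

Lemma toric_image_w_m i : (i < N)%N -> toric_image (wP i * mP i).
Proof.
move=> iN; have iL := N_lt M iN; exists (diff2 i + inner2 i).
by rewrite rmorphD /= psi_diff2 // subrK /mP iN psi_inner1 // iN.
Qed.

Lemma toric_image_pair i (u : P) n a : toric_image u -> toric_image (wP i * u) -> (a <= n)%N ->
  toric_image (wP i ^+ a * u ^+ n).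
Proof.
move=> Tu Twu an; rewrite -(subnKC an) exprD mulrA -exprMn.
by apply: toric_imageM; apply: toric_imageX.
Qed.

Lemma toric_image_block i a b c t : (i < L)%N -> (c != 0%N -> (i < N)%N) -> (a <= b + c + t)%N ->
  toric_image (wP i ^+ a * (lP i ^+ b * mP i ^+ c * 'X_[cornerm i] ^+ t)).
Proof.
(* The factors [w i] are spent on the last column, then on the middle one, then on the corner. *)
move=> iL cN abct; pose a1 := minn a b; pose a2 := minn (a - a1) c; pose a3 := (a - a1 - a2)%N.
have -> : a = (a1 + a2 + a3)%N by rewrite /a3 /a2 /a1; lia.
rewrite !exprD mulrACA [_ * _ * (lP i ^+ b * _)]mulrACA.
apply: toric_imageM; first apply: toric_imageM.
- apply: toric_image_pair; [exact: toric_image_l|exact: toric_image_w_l|].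
  by rewrite /a1; lia.
- have [c0|/cN iN] := eqVneq c 0%N.
    have -> : a2 = 0%N by rewrite /a2 c0; lia.
    by rewrite c0 !expr0 mulr1; exact: toric_image1.
  apply: toric_image_pair; [exact: toric_image_m|exact: toric_image_w_m|].
  by rewrite /a2; lia.
apply: toric_image_pair; [exact: toric_image_corner|exact: toric_image_w_corner|].
by rewrite /a3 /a2 /a1; lia.
Qed.

Definition toric_product s x (e l c : nat -> nat) : P :=
  xP ^+ x * \prod_(i < s) (wP i ^+ e i * (lP i ^+ l i * mP i ^+ c i)).

(** The last block takes as much of its left corner as it needs to absorb its
    power of [w]; the corner is a product of variables of the previous block. *)
Lemma toric_image_product s x e l c : (s <= L)%N ->
  (forall i, (i < s)%N -> [/\ (e i <= (if i is j.+1 then e j else x) + (l i + c i))%N,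
     (e i <= (if i is j.+1 then l j else x) + (l i + c i))%N & c i != 0%N -> (i < N)%N]) ->
  toric_image (toric_product s x e l c).
Proof.
elim: s x e l => [|s IH] x e l sL H.
  by rewrite /toric_product big_ord0 mulr1; apply/toric_imageX/(toric_image_corner (i := 0)).
have [h1 h2 h3] := H s (ltnSn s).
(* The number of copies of corner [s] needed; they are taken from [w] and [l] of the previous block,
   or from [x] if [s = 0]. *)
pose t := (e s - (l s + c s))%N.
pose x' := if s is 0%N then (x - t)%N else x.
pose dec (u : nat -> nat) i := if i.+1 == s then (u i - t)%N else u i.
have -> : toric_product s.+1 x e l c = toric_product s x' (dec e) (dec l) c *
    (wP s ^+ e s * (lP s ^+ l s * mP s ^+ c s * 'X_[cornerm s] ^+ t)).
  rewrite /toric_product big_ord_recr /= mulrA.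
  suff -> : xP ^+ x * \prod_(i < s) (wP i ^+ e i * (lP i ^+ l i * mP i ^+ c i)) =
    xP ^+ x' * \prod_(i < s) (wP i ^+ dec e i * (lP i ^+ dec l i * mP i ^+ c i)) * 'X_[cornerm s] ^+ t.
    by ring.
  move: h1 h2; rewrite /x' /dec {x' dec h3 IH sL H}/t; case: s => [|s] h1 h2.
    rewrite !big_ord0 !mulr1 -exprD subnK //; lia.
  rewrite !big_ord_recr /= eqxx /cornerm mpolyXD exprMn.
  under [in RHS]eq_bigr => i _ do rewrite eqSS (ltn_eqF (ltn_ord i)).
  have t1 : (e s.+1 - (l s.+1 + c s.+1) <= e s)%N by lia.
  have t2 : (e s.+1 - (l s.+1 + c s.+1) <= l s)%N by lia.
  move: (e s.+1 - _)%N t1 t2 => t t1 t2.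
  have e1 : e s = (e s - t + t)%N by lia.
  have e2 : l s = (l s - t + t)%N by lia.
  by rewrite {1}e1 {1}e2 !exprD /wP /lP; ring.
apply: toric_imageM; last by apply: toric_image_block => //; rewrite /t; lia.
apply: IH => [|i si]; first exact: ltnW.
have [g1 g2 g3] := H i (ltnW si).
have tl : i.+1 = s -> (t <= l i)%N by move=> es; rewrite /t; move: h2; rewrite -es; lia.
have ex : x' = x by rewrite /x'; case: (s) si.
split=> //; rewrite ex /dec; move: g1 g2 tl; clearbody t; case: i si {g3 ex} => [|i] si.
- by case: eqP => [es|_] g1 g2; [move=> /(_ es)|]; lia.
- by rewrite [i.+1 == s]ltn_eqF //; case: eqP => [es|_] g1 g2; [move=> /(_ es)|]; lia.
- by case: eqP => [es|_] g1 g2; [move=> /(_ es)|]; lia.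
by rewrite [i.+1 == s]ltn_eqF //; case: eqP => [es|_] g1 g2; [move=> /(_ es)|]; lia.
Qed.

Lemma toric_productE m : 'X_[m] = toric_product L (xexp m) (wexp m) (lexp m) (cexp m).
Proof.
have vE n (nd : (n < d)%N) : 'X_(Ordinal nd) = 'X_[um n] :> P.
  by congr ('X_[U_(_)]); apply/val_inj; rewrite /= inordK.
have mE n (nd : (n < d)%N) : m (Ordinal nd) = m (inord n).
  by congr (m _); apply/val_inj; rewrite /= inordK.
pose F n : P := 'X_[um n] ^+ m (inord n).
have -> : 'X_[m] = \prod_(n < (L + L + N).+1) F n.
  by rewrite mpolyXE_id; apply: eq_bigr => -[n nd] _; rewrite vE mE.
rewrite big_ord_recl /toric_product; congr (_ * _).
under eq_bigr => i _ do rewrite [F _]/(F i.+1).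
rewrite big_split_ord big_split_ord /= -mulrA !big_split /=; congr (_ * (_ * _)).
rewrite (big_ord_widen L (fun i => F (L + L + i).+1)); last by rewrite /nblocks; lia.
rewrite big_mkcond; apply: eq_bigr => i _; rewrite /mP /cexp; case: ifP => // _.
Qed.

Lemma allowed_image m : allowed no m -> toric_image 'X_[m].
Proof.
move=> am; rewrite toric_productE; apply: toric_image_product => // i iL.
have [h1 h2] := am i iL; rewrite !addn0 in h1 h2; split=> //.
by rewrite /cexp; case: ifP.
Qed.

Lemma sum_of_monomials (A : P -> Prop) f : sum_closed A ->
  (forall a g, A g -> A (a%:MP * g)) -> (forall m, m \in msupp f -> A 'X_[m]) -> A f.
Proof.
move=> [A0 AD] AZ AX; rewrite [f]mpolyE big_seq; apply: (big_ind A) => // m mf.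
by rewrite -mul_mpolyC; apply/AZ/AX.
Qed.

Lemma toric_imageP f : toric_image f <-> supported no f.
Proof.
split=> [[r <-]|Kf]; first exact: supported_psi.
apply: sum_of_monomials => [|a g|m /Kf]; last exact: allowed_image.
  split=> [|_ _ [r <-] [s <-]]; first by exists 0; rewrite rmorph0.
  by exists (r + s); rewrite rmorphD.
by apply: toric_imageM; exists (phi a%:MP); rewrite psi_phiC.
Qed.

Lemma tower_sum_closed J : sum_closed (tower J L).
Proof. by have [T0 TD _] := @tower_submod k N M J. Qed.

Definition w_support (eps : nat -> bool) : 'X_{1..d} := (\sum_(i < N | eps i) um i.+1)%MM.

Lemma w_supportE eps : 'X_[w_support eps] = \prod_(i < N) (if eps i then wP i else 1) :> P.
Proof.
rewrite /w_support -big_mkcond /=; elim/big_rec2: _ => [|i f g _ <-]; first by rewrite mpolyX0.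
by rewrite mpolyXD.
Qed.

Lemma tower_w_support (J eps : nat -> bool) : (forall i, (i < N)%N -> eps i -> J i) -> tower J L 'X_[w_support eps].
Proof.
move=> eJ; rewrite w_supportE.
suff H s : (s <= L)%N -> tower J s (\prod_(i < s) (if (i < N)%N && eps i then wP i else 1)).
  rewrite (big_ord_widen L (fun i => if eps i then wP i else 1)); last by rewrite /nblocks; lia.
  by have := H _ (leqnn L); under eq_bigr do rewrite if_and; rewrite -big_mkcond.
elim: s => [_|s IH sL]; first by rewrite big_ord0; apply: parameters1.
rewrite big_ord_recr /=.
have [j e] : exists j : 'I_(bn s).+1, glayer k M J j = if (s < N)%N && eps s then wP s else 1.
  rewrite /glayer; have [sN|sN] := ltnP s N.
    have b2 : bn s = 2%N by rewrite /bn sN.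
    case: ifP => [/andP[_ /(eJ _ sN) ->]|].
      by exists (inord 1); rewrite /eP b2 inordK ?expr1 // b2.
    case: (J s) => _; [exists ord_max; rewrite /eP b2 //|exists ord0; rewrite /yP /= rmorph1 //].
  have b1 : bn s = 1%N by rewrite /bn ltnNge sN.
  case: (J s) => /=; [exists ord_max; rewrite /eP b1 //|exists ord0; rewrite /yP /= rmorph1 //].
rewrite -e; move: (\prod_(i < s) _) (IH (ltnW sL)) => U TU.
exists (fun l => if l == j then U else 0).
split=> [l|]; last by rewrite (bigD1 j) //= eqxx big1 ?addr0 // => l /negbTE ->; rewrite mul0r.
case: eqP => _ //.
have [I [b [c [tau D]]]] := @tower_dual k N M J s (ltnW sL).
by case: (dual_C D) => -[].
Qed.

Lemma w_support_exp eps : [/\ xexp (w_support eps) = 0%N,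
  forall i, (i < L)%N -> wexp (w_support eps) i = (i < N)%N && eps i,
  forall i, (i < L)%N -> lexp (w_support eps) i = 0%N &
  forall i, (i < L)%N -> cexp (w_support eps) i = 0%N].
Proof.
have wd (i : 'I_N) : (i.+1 < d)%N by apply/w_lt/N_lt.
have E t : (t < d)%N -> w_support eps (inord t) = (\sum_(i < N | eps i) (i.+1 == t))%N.
  by move=> td; rewrite mnm_sumE; apply: eq_bigr => i _; rewrite um_exp.
split=> [|i iL|i iL|i iL].
- by rewrite /xexp E // big1.
- rewrite /wexp E ?w_lt //; have [iN|iN] /= := ltnP i N; last first.
    by rewrite big1 // => j _; rewrite eqSS ltn_eqF // (leq_trans (ltn_ord j)).
  rewrite big_mkcond (bigD1 (Ordinal iN)) //= eqxx big1 ?addn0 => [|j].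
    by case: (eps i).
  by rewrite -val_eqE /= eqSS => /negbTE ->; case: ifP.
- rewrite /lexp E ?l_lt // big1 // => j _; have := ltn_ord j; have := N_lt M (ltn_ord j).
  by lia.
rewrite /cexp; case: ifP => // iN; rewrite E ?m_lt // big1 // => j _.
by have := N_lt M (ltn_ord j); lia.
Qed.

Definition excess K m i := [&& (i < N)%N, K i & (lexp m i + cexp m i < wexp m i)%N].

Lemma w_support_le K m : (w_support (excess K m) <= m)%MM.
Proof.
apply/mnm_lepP => i; rewrite /w_support mnm_sumE big_mkcond.
have [/existsP[j /andP[ej /eqP ij]]|/existsPn none] := boolP [exists j : 'I_N, excess K m j && (i == inord j.+1)].
  rewrite (bigD1 j) //= ej big1 ?addn0; last first.
    move=> l lj; case: ifP => // _; rewrite mnm1E ij -val_eqE /= !inordK //; try by apply/w_lt/N_lt.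
    by move: lj; rewrite -val_eqE /= eqSS => /negbTE ->.
  rewrite ij mnm1E eqxx; case/and3P: ej => _ _; rewrite /wexp; lia.
rewrite big1 // => j _; have := none j; case: ifP => //= _.
by rewrite mnm1E eq_sym => /negbTE ->.
Qed.

(** Removing [w i] also lowers the bound [in1] at block [i.+1]. This is harmless because [w i] is
    removed only where its exponent exceeds [lexp m i + cexp m i]: the bound [in2] at block [i.+1]
    is then at least one smaller than [in1] and makes up for the loss. *)
Lemma allowed_excess K m : allowed (fun i => K i && (i < N)%N) m ->
  allowed no (m - w_support (excess K m)).
Proof.
move=> am; have le := w_support_le K m.
set eps := excess K m in le *; set mu := (m - _)%MM.
have em : m = (mu + w_support eps)%MM by rewrite submK.
have [e1 e2 e3 e4] := w_support_exp eps.
have x1 : xexp mu = xexp m by rewrite em xexpD e1 addn0.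
have l1 i : (i < L)%N -> lexp mu i = lexp m i by move=> iL; rewrite em lexpD e3 ?addn0.
have c1 i : (i < L)%N -> cexp mu i = cexp m i by move=> iL; rewrite em cexpD e4 ?addn0.
have w1 i : (i < L)%N -> wexp m i = (wexp mu i + eps i)%N.
  by move=> iL; rewrite {1}em wexpD e2 //; rewrite /eps /excess; case: ltnP.
move=> i iL; have [h1 h2] := am i iL.
have w1i := w1 i iL; have epsE : eps i = [&& (i < N)%N, K i & (lexp m i + cexp m i < wexp m i)%N] by [].
rewrite l1 // c1 //; case: i iL h1 h2 w1i epsE => [|i] iL h1 h2 w1i epsE.
  by move: h1 h2; rewrite /in1 /in2 x1; case: (eps 0) w1i epsE; lia.
move: h1 h2; rewrite /in1 /in2 l1 ?(ltnW iL) //.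
have := w1 i (ltnW iL); have : eps i = [&& (i < N)%N, K i & (lexp m i + cexp m i < wexp m i)%N] by [].
by case: (eps i); case: (eps i.+1) w1i epsE; lia.
Qed.

(** The slack of one at a block of [J] is taken up by the generator [w i] of the coinduced layer;
    what remains of the monomial lies in the ring. *)
Lemma towerP J f : tower J L f <-> supported (fun i => J i && (i < N)%N) f.
Proof.
split; first exact: tower_supported.
move=> Kf; apply: sum_of_monomials => [|a g|m /Kf am]; first exact: tower_sum_closed.
  by rewrite -psi_phiC; apply: tower_mul.
rewrite -[m](submK (w_support_le J m)) mpolyXD.
have [r <-] := allowed_image (allowed_excess am).
by apply/tower_mul/tower_w_support => i _ /and3P[].
Qed.

End ToricMonomials.

(** * Minimal generators of the canonical module *)

Lemma mul_diffD (A : comNzRingType) (x y u v a : A) :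
  (x + y) * a - (u + v) * a = (x * a - u * a) + (y * a - v * a).
Proof. by ring. Qed.

Lemma mul_diffM (A : comNzRingType) (x y u v a : A) :
  (x * y) * a - (u * v) * a = x * (y * a - v * a) + v * (x * a - u * a).
Proof. by ring. Qed.

Section CanonicalModule.
Variables (k : fieldType) (N M : nat).
Local Notation L := (nblocks N M).
Local Notation d := (nvars N M).
Local Notation P := {mpoly k[d]}.
Local Notation R := (R2 k (ladder N M)).
Local Notation psi := (@psi k N M).
Local Notation phi := (@phi k N M).
Local Notation corner := (corner k N M).
Local Notation diff1 := (diff1 k N M).
Local Notation diff2 := (diff2 k N M).
Local Notation inner1 := (inner1 k N M).
Local Notation inner2 := (inner2 k N M).
Local Notation bn := (bn N).
Local Notation yR := (@yR k N M).
Local Notation tower := (@tower k N M).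
Local Notation all := (fun _ : nat => true).
Local Notation idx := (idx N).
Local Notation w_support := (@w_support N M).

Definition ring_ypow (e : nat -> bool) s : R := \prod_(i < s) yR i (idx e i).

Lemma psi_ring_ypow e s : psi (ring_ypow e s) = ypow k N M e s.
Proof. by rewrite /ring_ypow rmorph_prod. Qed.

Lemma epow_w_support e : epow k N M e L = 'X_[w_support e].
Proof.
rewrite w_supportE (big_ord_widen L (fun i => if e i then wP k N M i else 1)); last first.
  by rewrite /nblocks; lia.
rewrite [RHS]big_mkcond /=; apply: eq_bigr => i _; rewrite /eP /idx /bn.
by case: (i < N)%N => /=; [case: (e i)|]; rewrite /= ?expr0 ?expr1.
Qed.

(** The multiplication table of the inner entries has its coefficients in the ideal of the
    parameters. Hence a product of one inner entry per block is a socle element modulo the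
    parameters. *)
Lemma yR_mul_parameters (V : R -> Prop) : (forall x y, V x -> V y -> V (x + y)) ->
  (forall r x, V x -> V (r * x)) -> (forall n, (n < d)%N -> V (parameter k N M n)) ->
  forall i j l, (i < L)%N -> (0 < j <= bn i)%N -> (0 < l <= bn i)%N -> V (yR i j * yR i l).
Proof.
move=> VD VM Vp i j l iL.
have VM' r x : V x -> V (x * r) by rewrite mulrC; apply: VM.
have VN x : V x -> V (- x) by rewrite -mulN1r; apply: VM.
have VB x y : V x -> V y -> V (x - y) by move=> Vx /VN; apply: VD.
have Vq n : (n <= L)%N -> V (corner n).
  move=> nL; have nd : (n < d)%N by rewrite /nvars; lia.
  by rewrite -phi_corner // phi_var //; apply: Vp.
have Vc1 : V (diff1 i) by rewrite -phi_diff1 // phi_var ?l_lt //; apply/Vp/l_lt.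
have Vc2 : (i < N)%N -> V (diff2 i) by move=> iN; rewrite -phi_diff2 // phi_var ?m_lt //; apply/Vp/m_lt.
have Vqi := Vq i (ltnW iL); have Vpi := Vq i.+1 iL.
rewrite /bn; case: (ltnP i N) => iN.
  have {}Vc2 := Vc2 iN.
  have V12 : V (inner1 i * inner2 i).
    by rewrite inner12_big //; apply: VB; [apply: VM|apply: VM'].
  case: j => [|[|[|j]]] //; case: l => [|[|[|l]]] // _ _ /=.
  - rewrite inner11_big //; apply: VD; last exact: VM'.
    by apply: VB; [apply: VM'|apply: VM'].
  - by rewrite mulrC.
  rewrite inner22_big //; by apply: VB; apply: VM'.
case: j => [|[|j]] //; case: l => [|[|l]] // _ _ /=.
by rewrite inner11_small //; apply: VB; apply: VM'.
Qed.

Lemma idx_range e i : (0 < idx e i <= bn i)%N.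
Proof.
by rewrite /idx /bn; case: (i < N)%N => //; case: (e i).
Qed.

Lemma psi_phiD p q : psi (phi (p + q)) = psi (phi p) + psi (phi q).
Proof. by rewrite !rmorphD. Qed.
Lemma psi_phiB p q : psi (phi (p - q)) = psi (phi p) - psi (phi q).
Proof. by rewrite !rmorphB. Qed.
Lemma psi_phiM p q : psi (phi (p * q)) = psi (phi p) * psi (phi q).
Proof. by rewrite !rmorphM. Qed.

Definition residue (r : R) : R := phi ((psi r)@_0%MM)%:MP.

Lemma residueD x y : residue (x + y) = residue x + residue y.
Proof. by rewrite /residue (rmorphD psi) mcoeffD mpolyCD rmorphD. Qed.
Lemma residueM x y : residue (x * y) = residue x * residue y.
Proof. by rewrite /residue (rmorphM psi) (rmorphM (mcoeff 0%MM)) mpolyCM rmorphM. Qed.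
Lemma residueC c : residue (phi c%:MP) = phi c%:MP.
Proof. by rewrite /residue psi_phiC mcoeffC eqxx mulr1. Qed.
Lemma residue_cell i r c : in_block N M i r c -> residue (cell k N M r c) = 0.
Proof.
move=> H; rewrite /residue (psi_cell _ H) mcoeffX; case: eqP; last by rewrite mpolyC0 rmorph0.
have colm0 : (0 < mdeg (colm N M i c))%N.
  rewrite /colm /cornerm; case: ifP => _; last by case: ifP; rewrite mdeg1.
  by case: (i) => [|j]; rewrite ?mdegD mdeg1.
case/and3P: H => _ ri ci /(congr1 mdeg); rewrite mdeg0.
have : r = i \/ r = i.+1 by lia.
case=> ->; first by rewrite cellm_lower; [lia|case/andP: ci].
by rewrite cellm_upper // mdegD; lia.
Qed.

Section Factors.
Variables (C : lmodType R) (iota : C -> P).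
Hypothesis semC : semidualizing C.
Hypothesis iotaD : forall c1 c2, iota (c1 + c2) = iota c1 + iota c2.
Hypothesis iotaZ : forall r c, iota (r *: c) = psi r * iota c.
Hypothesis iota_inj : forall c, iota c = 0 -> c = 0.
Hypothesis iota_functional : exists2 d0, d0 != 0 & forall c, exists r, psi r = d0 * iota c.
Hypothesis iota_monomial : forall c m, m \in msupp (iota c) -> exists c', iota c' = 'X_[m].

(** The factorization is applied to the socle element [ring_ypow e L]: among the monomials of the
    canonical module only [w_support e] pairs with it to a nonzero constant term. *)
Lemma canonical_factors (e : nat -> bool) : exists g, (exists c, iota c = 'X_[g]) /\
    forall a1, (exists c, iota c = 'X_[a1]) ->
    exists n, allowed (fun i => i < N)%N n /\ (a1 + w_support e = g + n)%MM.
Proof.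
have [I [b [cw [tau [D pair]]]]] := @tower_dual_all k N M L (leqnn _).
have bR i : exists r, psi r = b i by apply/tower_noE/(dual_b D).
have [b' eb] := choice bR.
pose Om := tower all L.
have OmP f : Om f <-> supported (fun i => i < N)%N f by apply: towerP.
have [tS tSP] := @choice_on _ _ Om (fun f s => psi (phi s) = tau f) 0
  (fun f Of => let: ex_intro s es := dual_tau D Of in ex_intro _ s (esym es)).
have ppI p q : psi (phi p) = psi (phi q) -> p = q.
  move=> epq; apply/eqP; rewrite -subr_eq0; apply/eqP/(@psi_phi_inj k N M).
  by rewrite psi_phiB epq subrr.
have sOm : sum_closed Om by case: (dual_C D).
have OmM r f : Om f -> Om (psi r * f) by apply: tower_mul.
have tD x y : Om x -> Om y -> tS (x + y) = tS x + tS y.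
  move=> Ox Oy; apply: ppI; apply: etrans (tSP _ (sOm.2 _ _ Ox Oy)) _.
  by rewrite (dual_tauD D Ox Oy) psi_phiD; congr (_ + _); apply: esym; apply: tSP.
have tZ s x : Om x -> tS (psi (phi s) * x) = s * tS x.
  move=> Ox; apply: ppI; apply: etrans (tSP _ (OmM _ _ Ox)) _.
  rewrite psi_phiM; apply: etrans (dual_tauZ D (ex_intro _ s erefl) Ox) _.
  by congr (_ * _); apply: esym; apply: tSP.
have expand_ring r : r = \sum_i phi (tS (psi r * cw i)) * b' i.
  apply: (@psi_inj k N M); rewrite rmorph_sum {1}(dual_ring D (r := psi r)); last first.
    by apply/tower_noE; exists r.
  by apply: eq_bigr => i _; rewrite rmorphM /= eb tSP //; apply/OmM/(dual_c D).
have expand_module x : Om x -> x = \sum_i psi (phi (tS (psi (b' i) * x))) * cw i.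
  move=> Ox; rewrite {1}(dual_module D Ox); apply: eq_bigr => i _.
  by rewrite tSP ?eb // -eb; apply: OmM.
have Om_mono f m : Om f -> m \in msupp f -> Om 'X_[m].
  by move=> /OmP Of /Of am; apply/OmP/supportedX.
have OmW eps : Om 'X_[w_support eps] by apply: tower_w_support.
have tW eps : tS (psi (ring_ypow e L) * 'X_[w_support eps]) =
    \prod_(i < L) (idx e i == idx eps i)%:R.
  apply: ppI; rewrite (tSP _ (OmM _ _ (OmW eps))).
  have [_ _ e1] := pair e eps; rewrite psi_ring_ypow -epow_w_support e1.
  by rewrite !rmorph_prod; apply: eq_bigr => i _; rewrite !rmorph_nat.
have nz0 : (tS (psi (ring_ypow e L) * 'X_[w_support e]))@_0%MM != 0.
  by rewrite tW big1 ?mcoeff1 ?eqxx ?oner_neq0 // => i _; rewrite eqxx.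
(* The elements that pair into the maximal ideal of the origin: an ideal containing the
   parameters. *)
pose V r := forall om, Om om -> (tS (psi r * om))@_0%MM = 0.
have VD x y : V x -> V y -> V (x + y).
  move=> Vx Vy om Oom; rewrite (rmorphD psi) mulrDl (tD _ _ (OmM x _ Oom) (OmM y _ Oom)).
  by rewrite mcoeffD Vx ?Vy ?addr0.
have VM r x : V x -> V (r * x).
  by move=> Vx om Oom; rewrite [r * x]mulrC (rmorphM psi) -mulrA; apply/Vx/OmM.
have Vp n : (n < d)%N -> V (parameter k N M n).
  move=> nd om Oom; rewrite -phi_var // (tZ _ _ Oom) [LHS]rmorphM /=.
  by rewrite -[n]/(nat_of_ord (Ordinal nd)) mvarE mcoeffX mnm1_eq0 mul0r.
pose a := ring_ypow e L.
have Vya i j : (i < L)%N -> (0 < j <= bn i)%N -> V (yR i j * a).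
  move=> iL jb; rewrite /a /ring_ypow (bigD1 (Ordinal iL)) //= mulrA mulrC; apply: (VM).
  exact: (@yR_mul_parameters V VD VM Vp i j _ iL jb (idx_range e i)).
(* The cells multiply [a] into [V], so every [r] acts on [a] modulo [V] through its constant
   term. *)
pose A r := V (r * a - residue r * a).
have V0 : V 0 by rewrite -(mul0r (parameter k N M 0)); apply: (VM); apply: Vp.
have Aall r : A r.
  apply: (@ladder_ring_ind k N M A) => {r}.
  - by move=> c; rewrite /A -phiC residueC subrr.
  - move=> x y Ax Ay; rewrite /A residueD.
    rewrite mul_diffD; exact: (VD _ _ Ax Ay).
  - move=> x y Ax Ay; rewrite /A residueM.
    rewrite mul_diffM; exact: (VD _ _ (VM _ _ Ay) (VM _ _ Ax)).
  move=> i r c H; rewrite /A (residue_cell H) mul0r subr0.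
  apply: (@cell_generators k N M (fun r => V (r * a)) _ _ Vya i _ _ H).
    by move=> x y Vx Vy; rewrite mulrDl; exact: (VD _ _ Vx Vy).
  by move=> n nd; rewrite mulrC; exact: (VM _ _ (Vp _ nd)).
have unique n : Om 'X_[n] -> (tS (psi a * 'X_[n]))@_0%MM != 0 -> n = w_support e.
  move=> On nz.
  have an : allowed (fun i => true && (i < N)%N) n by move/OmP: On; apply; rewrite msuppX inE.
  (* A monomial of the canonical module is a ring monomial [mu] times a generator; a nontrivial [mu]
     has residue 0 and multiplies [a] into [V]. *)
  pose eps := excess (fun=> true) n; pose mu := (n - w_support eps)%MM.
  have en : n = (mu + w_support eps)%MM by rewrite submK // w_support_le.
  have [r er] := allowed_image k (allowed_excess an); rewrite -/eps -/mu in er.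
  have [mu0|mu0] := eqVneq mu 0%MM; last first.
    have res0 : residue r = 0 by rewrite /residue er mcoeffX (negbTE mu0) mpolyC0 rmorph0.
    have Vra : V (r * a) by have := Aall r; rewrite /A res0 mul0r subr0.
    have e1 : psi (r * a) * 'X_[w_support eps] = psi a * 'X_[n].
      by rewrite (rmorphM psi) /= [psi r * _]mulrC -mulrA er -mpolyXD -en.
    by move: nz; rewrite -e1 (Vra _ (OmW eps)) eqxx.
  rewrite mu0 add0m in en; rewrite en in nz *.
  apply: eq_bigl => i; have iL := N_lt M (ltn_ord i).
  apply/eqP; apply: contraNT nz => ne; rewrite tW (bigD1 (Ordinal iL) isT) /=.
  have -> : (idx e i == idx eps i) = false.
    by rewrite /idx ltn_ord; case: (eps i) (e i) ne => [] [].
  by rewrite mul0r mcoeff0.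
have [g [Ig Hg]] := canonical_generator_factors (@noetherian_ladder k N M) (@psi_phiC k N M) sOm OmM (dual_c D)
  tD tZ expand_ring expand_module Om_mono semC iotaD iotaZ iota_inj iota_functional iota_monomial
  (OmW e) nz0 unique.
exists g; split=> // a1 /Hg[n [On en]]; exists n; split=> //.
by move/OmP: On; apply; rewrite msuppX inE.
Qed.
End Factors.
End CanonicalModule.

(** * Classification of the semidualizing modules *)

Section Classification.
Variables (k : fieldType) (N M : nat).
Local Notation L := (nblocks N M).
Local Notation d := (nvars N M).
Local Notation P := {mpoly k[d]}.
Local Notation R := (R2 k (ladder N M)).
Local Notation psi := (@psi k N M).
Local Notation no := (fun _ : nat => false).
Local Notation w_support := (@w_support N M).
Implicit Types m n : 'X_{1..d}.

Definition toric_weight (t : 'I_L * bool) m : int :=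
  (if t.2 then in1 m t.1 else in2 m t.1)%:Z + (lexp m t.1 + cexp m t.1)%:Z - (wexp m t.1)%:Z.

Lemma toric_weightD t m1 m2 : toric_weight t (m1 + m2) = toric_weight t m1 + toric_weight t m2.
Proof. by case: t => i [] /=; rewrite /toric_weight /= !expD; lia. Qed.

Lemma toric_weightP (f : P) : (exists r, psi r = f) <->
  forall m, m \in msupp f -> forall t, 0 <= toric_weight t m.
Proof.
rewrite -[exists r, _]/(toric_image f) toric_imageP; split=> H m mf.
  move=> [i b]; have [h1 h2] := H m mf i (ltn_ord i).
  by case: b; rewrite /toric_weight /=; lia.
move=> i iL; have := H m mf (Ordinal iL, true); have := H m mf (Ordinal iL, false).
by rewrite /toric_weight /=; lia.
Qed.

Lemma exp_inj m n : xexp m = xexp n -> (forall i, (i < L)%N -> wexp m i = wexp n i) ->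
  (forall i, (i < L)%N -> lexp m i = lexp n i) -> (forall i, (i < L)%N -> cexp m i = cexp n i) -> m = n.
Proof.
move=> ex ew el ec.
have e : 'X_[m] = 'X_[n] :> P.
  rewrite !toric_productE /toric_product ex; congr (_ * _).
  by apply: eq_bigr => i _; rewrite ew ?el ?ec.
by have := msuppX k m; rewrite e msuppX => -[].
Qed.

Lemma eq_w_support (e f : nat -> bool) : (forall i, (i < N)%N -> e i = f i) ->
  w_support e = w_support f.
Proof. by move=> ef; apply: eq_bigl => i; apply: ef. Qed.

Lemma w_support0 (e : nat -> bool) : (forall i, (i < N)%N -> e i = false) -> w_support e = 0%MM.
Proof. by move=> e0; rewrite /w_support big_pred0 // => i; apply: e0. Qed.

Lemma in_w_support (e : nat -> bool) i : (i < L)%N -> (forall j, j.+1 = i -> e j = false) ->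
  in1 (w_support e) i = 0%N /\ in2 (w_support e) i = 0%N.
Proof.
have [ex ew el _] := @w_support_exp N M e.
case: i => [|j] jL ej /=; first by rewrite ex.
by rewrite ew ?el ?ej ?andbF // ltnW.
Qed.

(** Ignoring the [w i] gives every [w_support e] degree 0, and [corner_degree0] shows that these are
    the only monomials of degree 0 in the canonical module. *)
Definition corner_degree m : nat := (xexp m + \sum_(i < L) (lexp m i + cexp m i))%N.

Lemma corner_degreeD m n : corner_degree (m + n) = (corner_degree m + corner_degree n)%N.
Proof.
rewrite /corner_degree xexpD addnACA -big_split; congr (_ + _)%N.
by apply: eq_bigr => i _; rewrite lexpD cexpD addnACA.
Qed.

Lemma corner_degree_w e : corner_degree (w_support e) = 0%N.
Proof.
have [ex _ el ec] := @w_support_exp N M e; rewrite /corner_degree ex big1 // => i _.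
by rewrite el ?ec.
Qed.

Lemma corner_degree0 n : allowed (fun i => i < N)%N n -> corner_degree n = 0%N ->
  exists c, n = w_support c.
Proof.
move=> an /eqP; rewrite addn_eq0 sum_nat_eq0 => /andP[/eqP x0 /forallP lc0].
have [l0 c0] : (forall i, (i < L)%N -> lexp n i = 0%N) /\ (forall i, (i < L)%N -> cexp n i = 0%N).
  by split=> i iL; have := lc0 (Ordinal iL); rewrite /= addn_eq0 => /andP[/eqP ? /eqP ?].
exists (fun i => wexp n i == 1%N).
have [ex ew el ec] := @w_support_exp N M (fun i => wexp n i == 1%N).
apply: exp_inj => [|i iL|i iL|i iL]; rewrite ?ex ?ew ?el ?ec ?l0 ?c0 //.
have [_] := an i iL; rewrite l0 // c0 // !addn0.
have -> : in2 n i = 0%N by case: i iL => [|i] iL //=; rewrite l0 // ltnW.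
by case: (i < N)%N; case: (wexp n i) => [|[|?]].
Qed.

Section Ideal.
Variables (C : lmodType R) (iota : C -> P).
Hypothesis semC : semidualizing C.
Hypothesis iotaD : forall c1 c2, iota (c1 + c2) = iota c1 + iota c2.
Hypothesis iotaZ : forall r c, iota (r *: c) = psi r * iota c.
Hypothesis iota_inj : forall c, iota c = 0 -> c = 0.
Hypothesis iota_functional : exists2 d0, d0 != 0 & forall c, exists r, psi r = d0 * iota c.
Hypothesis iota_monomial : forall c m, m \in msupp (iota c) -> exists c', iota c' = 'X_[m].

Definition in_ideal m := exists c, iota c = 'X_[m].

(** Writing [g e] for the generators attached to the monomials [w_support e] of the
    canonical module, all [g e] have the same degree, so each is [g 0] times a
    squarefree monomial in the [w i]; [J] collects the [w i] that occur. *)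
Lemma ideal_monomials : exists g0 (J : nat -> bool), forall m,
  in_ideal m <-> exists2 h, allowed (fun i => J i && (i < N)%N) h & m = (g0 + h)%MM.
Proof.
have [g gP] := choice (canonical_factors semC iotaD iotaZ iota_inj iota_functional iota_monomial).
have gI e : in_ideal (g e) by case: (gP e).
have gF e m : in_ideal m -> exists n, allowed (fun i => i < N)%N n /\ (m + w_support e = g e + n)%MM.
  by case: (gP e) => _; apply.
(* The factorization for [e] is tested on the generator [g f]. By symmetry all degrees agree, so the
   complementary factor is again a [w_support]. *)
have deg_le e f : (corner_degree (g e) <= corner_degree (g f))%N.
  have [n [_ /(congr1 corner_degree)]] := gF e _ (gI f).
  by rewrite !corner_degreeD corner_degree_w; lia.
have rel e f : exists c, (g f + w_support e = g e + w_support c)%MM.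
  have [n [an en]] := gF e _ (gI f).
  have [|c ec] := corner_degree0 an; last by exists c; rewrite -ec.
  have := congr1 corner_degree en; rewrite !corner_degreeD corner_degree_w.
  by have := deg_le e f; have := deg_le f e; lia.
pose g0 := g no; have w0 : w_support no = 0%MM by apply: w_support0.
have gS e : exists c, g e = (g0 + w_support c)%MM.
  by have [c ec] := rel no e; exists c; rewrite -ec w0 addm0.
have [S gE] := choice gS.
have wS e i : (i < N)%N -> wexp (w_support e) i = e i.
  move=> iN; have [_ ew _ _] := @w_support_exp N M e.
  by rewrite ew ?iN // N_lt.
(* All terms are 0 or 1. Taking [no] for [f] gives [S e <= e], and if both [S f] and [e] contain [i]
   then so does [S e]: below [N], [S e] is the intersection of [e] with the union [J] of all
   [S f]. *)
have relS (e f : nat -> bool) i : (i < N)%N -> exists c : bool, (S f i + e i = S e i + c)%N.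
  move=> iN; have [c] := rel e f; rewrite !gE => /(congr1 (fun m => wexp m i)).
  by rewrite !wexpD !wS // => ec; exists (c i); lia.
have S0 i : (i < N)%N -> S no i = false.
  move=> iN; have := congr1 (fun m => wexp m i) (gE no).
  by rewrite wexpD wS // -/g0; case: (S no i) => //; lia.
have Sle (e : nat -> bool) i : (i < N)%N -> S e i -> e i.
  by move=> iN; have [c] := relS e no i iN; rewrite S0 //; case: (S e i) (e i) c => [] [] [].
pose J i := `[< exists f, S f i >].
have SJ (e : nat -> bool) i : (i < N)%N -> e i -> J i -> S e i.
  move=> iN ei /asboolP[f Sf]; have [c] := relS e f i iN.
  by rewrite Sf ei; case: (S e i) c => [] [].
exists g0, J => m; split=> [Im|[h ah ->]].
  have [n [an en]] := gF no _ Im; rewrite w0 addm0 -/g0 in en; exists n => // i iL.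
  have [h1 h2] := an i iL.
  have [iN|iN] := ltnP i N; last by rewrite andbF; move: h1 h2; rewrite ltnNge iN.
  case Ji: (J i) => /=; first by move: h1 h2; rewrite iN.
  (* For [i] outside [J] the generator attached to the singleton of [i] is still [g0], so [n] times
     [w i] satisfies the inequalities with slack one; hence [n] satisfies those at [i] without
     slack. *)
  pose e (j : nat) : bool := (j == i)%N; have [n' [an' en']] := gF e _ Im.
  have Se : w_support (S e) = 0%MM.
    apply: w_support0 => j jN; apply/negbTE/negP => Sj.
    have /eqP ji := Sle _ _ jN Sj; move: Ji; rewrite -ji.
    by move/asboolP; apply; exists e.
  have {en'} n'E : n' = (n + w_support e)%MM.
    move: en'; rewrite en (gE e) Se addm0 => en'.
    apply/mnmP => t; have /mnmP/(_ t) := en'; rewrite !mnmDE; lia.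
  have [_ ew el ec] := @w_support_exp N M e.
  have [h3 h4] := an' i iL; move: h3 h4.
  rewrite n'E !expD el // ec // ew // iN /e /= eqxx -/e.
  have [|-> ->] := @in_w_support e i iL; first by move=> j; rewrite /e; lia.
  lia.
set eps := excess J h.
have Seps : w_support (S eps) = w_support eps.
  apply: eq_w_support => i iN; apply/idP/idP => [|ei]; first exact: Sle.
  by apply: SJ => //; case/and3P: ei.
have [c ec] := gI eps; have [r er] := allowed_image k (allowed_excess ah).
exists (r *: c); rewrite iotaZ ec er gE Seps -mpolyXD; congr 'X_[_].
rewrite addmA [(_ - _ + _)%MM]addmC -addmA submK //; exact: w_support_le.
Qed.

End Ideal.

End Classification.

(** * Isomorphism classes of the tower modules *)

Section Isomorphisms.
Variables (k : fieldType) (N M : nat).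
Local Notation L := (nblocks N M).
Local Notation d := (nvars N M).
Local Notation P := {mpoly k[d]}.
Local Notation R := (R2 k (ladder N M)).
Local Notation psi := (@psi k N M).
Local Notation tower := (@tower k N M).
Local Notation no := (fun _ : nat => false).
Local Notation um := (um N M).
Local Notation tower_module := (@tower_module k N M).
Local Notation tower_submod := (@tower_submod k N M).
Implicit Types m n : 'X_{1..d}.

Lemma lmod_iso_of_bij (C C' : lmodType R) (f : C -> C') : linear f -> injective f ->
  (forall y, exists x, f x = y) -> lmod_iso C C'.
Proof.
move=> lf fI fS; have [g gP] := choice fS.
by exists (mk_linear lf), g => x /=; [apply: fI|]; rewrite gP.
Qed.

Lemma lmod_iso_sym (C C' : lmodType R) : lmod_iso C C' -> lmod_iso C' C.
Proof.
move=> [f [g fK gK]]; apply: (@lmod_iso_of_bij _ _ g).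
- by move=> a x y; apply: (can_inj fK); rewrite linearP !gK.
- exact: can_inj gK.
by move=> y; exists (f y).
Qed.

Lemma lmod_iso_trans (C1 C2 C3 : lmodType R) : lmod_iso C1 C2 -> lmod_iso C2 C3 -> lmod_iso C1 C3.
Proof.
move=> [f [f' fK f'K]] [g [g' gK g'K]]; apply: (@lmod_iso_of_bij _ _ (g \o f)).
- by move=> a x y /=; rewrite !linearP.
- by apply: inj_comp; [apply: can_inj gK|apply: can_inj fK].
by move=> y; exists (f' (g' y)); rewrite /= f'K g'K.
Qed.

Lemma lmod_iso_refl (C : lmodType R) : lmod_iso C C.
Proof. by apply: (@lmod_iso_of_bij _ _ id) => // y; exists y. Qed.

(** Division by ['X_[g0]] carries the monomial ideal onto a tower module. Letting [J'] vary beyond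
    [N] accommodates the representatives [bit_set] used for counting. *)
Theorem semidualizing_classification (C : lmodType R) : semidualizing C ->
  exists J : nat -> bool, forall J' : nat -> bool, (forall i, (i < N)%N -> J' i = J i) ->
  lmod_iso C (tower_module J').
Proof.
move=> semC; have [Q [fgC endC faithC extC]] := semidualizing_reduction_data semC.
have [iota [iotaD iotaZ iota_inj iota_functional iota_monomial]] :=
  monomial_presentation (@psi_inj k N M) (@noetherian_ladder k N M) (@toric_weightD N M)
    (@toric_weightP k N M) fgC endC faithC extC.
have [g0 [J gJ]] := ideal_monomials semC iotaD iotaZ iota_inj iota_functional iota_monomial.
exists J => J' JJ'.
have allowedJ h : allowed (fun i => J i && (i < N)%N) h -> allowed (fun i => J' i && (i < N)%N) h.
  move=> ah i iL; have := ah i iL; have [iN|iN] := ltnP i N; last by rewrite !andbF.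
  by rewrite JJ'.
have allowedJ' h : allowed (fun i => J' i && (i < N)%N) h -> allowed (fun i => J i && (i < N)%N) h.
  move=> ah i iL; have := ah i iL; have [iN|iN] := ltnP i N; last by rewrite !andbF.
  by rewrite JJ'.
have X0 : 'X_[g0] != 0 :> P by rewrite -msize_poly_eq0 msizeX.
have [T0 TD] := @tower_sum_closed k N M J'.
have Fex c : exists f, tower J' L f /\ iota c = 'X_[g0] * f.
  have mono m : m \in msupp (iota c) -> exists f, tower J' L f /\ 'X_[m] = 'X_[g0] * f.
    move=> mc; have [c' ec'] := iota_monomial c m mc.
    have /gJ[h ah ->] : in_ideal iota m by exists c'.
    exists 'X_[h]; split; last by rewrite mpolyXD.
    by apply/towerP/supportedX/allowedJ.
  apply: (@sum_of_monomials k N M (fun u => exists f, tower J' L f /\ u = 'X_[g0] * f)) mono.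
    split=> [|u v [f [Tf ->]] [f' [Tf' ->]]]; first by exists 0; rewrite mulr0.
    by exists (f + f'); rewrite mulrDr; split=> //; apply: TD.
  move=> a u [f [Tf ->]]; exists (a%:MP * f); split; last by rewrite mulrCA.
  by rewrite -psi_phiC; apply: tower_mul.
have [F FP] := choice Fex.
have TF c : tower J' L (F c) by case: (FP c).
have FE c : iota c = 'X_[g0] * F c by case: (FP c).
apply: (@lmod_iso_of_bij C (tower_module J') (fun c => to_submodule (tower_submod J') (TF c))).
- move=> a x y; apply: val_inj; apply: (mulfI X0).
  rewrite -[val _]/(F _) -[val _]/(psi a * F x + F y) -FE iotaD iotaZ !FE.
  by rewrite mulrDr mulrCA.
- move=> x y /(congr1 val) /= e; apply/eqP; rewrite -subr_eq0; apply/eqP/iota_inj.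
  by rewrite -scaleN1r iotaD iotaZ rmorphN1 mulN1r !FE e subrr.
move=> y; have Ty := submodule_prop y.
suff [c ec] : exists c, iota c = 'X_[g0] * val y.
  by exists c; apply: val_inj; apply: (mulfI X0); rewrite -FE -ec.
have supp := (towerP _ _).1 Ty.
apply: (@sum_of_monomials k N M (fun f => exists c, iota c = 'X_[g0] * f) (val y)).
- split=> [|u v [c ec] [c' ec']].
    exists 0; rewrite mulr0; apply: (addrI (iota 0)); by rewrite -iotaD !addr0.
  by exists (c + c'); rewrite iotaD ec ec' mulrDr.
- by move=> a u [c ec]; exists (@phi k N M a%:MP *: c); rewrite iotaZ ec mulrCA; congr (_ * (_ * _)); exact: psi_phiC.
move=> m /supp /allowedJ' am.
have [c ec] : in_ideal iota (g0 + m)%MM by apply/gJ; exists m.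
by exists c; rewrite ec mpolyXD.
Qed.

(** A monomial that multiplies every tower module into the ring, which serves to recognize
    homomorphisms as multiplications. *)
Definition all_ones : 'X_{1..d} := [multinom 1%N | i < d].

Lemma allowed_all_ones K m : allowed K m -> allowed no (m + all_ones).
Proof.
have e1 i : wexp all_ones i = 1%N by rewrite /wexp mnmE.
have e2 i : lexp all_ones i = 1%N by rewrite /lexp mnmE.
have e3 i : in1 all_ones i = 1%N by case: i => [|i]; rewrite /in1 /wexp /xexp mnmE.
have e4 i : in2 all_ones i = 1%N by case: i => [|i]; rewrite /in2 /lexp /xexp mnmE.
move=> am i iL; have [h1 h2] := am i iL; rewrite !expD e1 e2 e3 e4.
by case: (K i) h1 h2; lia.
Qed.

Lemma coeff0_unit (f g : P) : g * f = 1 -> f@_0%MM != 0.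
Proof.
move=> /(congr1 (mcoeff 0%MM)); rewrite (rmorphM (mcoeff 0%MM)) mcoeff1 eqxx /=.
by apply: contra_eq_neq => ->; rewrite mulr0 eq_sym oner_neq0.
Qed.

Lemma coeff_mulX m (f : P) : ('X_[m] * f)@_m = f@_0%MM.
Proof. by rewrite mulrC -[X in _@_X]addm0 mcoeffMX. Qed.

(** An isomorphism is multiplication by the image [f] of 1, a unit of [P], so [f] has a nonzero
    constant term. The monomial [w i] of the source therefore occurs in its own image. *)
Lemma tower_module_iso_sub (J J' : nat -> bool) : lmod_iso (tower_module J) (tower_module J') ->
  forall i, (i < N)%N -> J i -> J' i.
Proof.
move=> [th [th' thK th'K]] i iN Ji.
have T1 K : tower K L 1.
  by rewrite -(rmorph1 psi); apply/towerP/supportedW/supported_psi.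
have D0 : 'X_[all_ones] != 0 :> P by rewrite -msize_poly_eq0 msizeX.
have ones : toric_image (k := k) 'X_[all_ones].
  rewrite -[all_ones]add0m; apply/allowed_image/(@allowed_all_ones no).
  by move=> j jL; rewrite /wexp mnm0E.
have [s es] := ones.
pose one_ K : tower_module K := to_submodule (tower_submod K) (T1 K).
pose f : P := val (th (one_ J)).
have thE (h : tower_module J) : val (th h) = val h * f.
  apply: (mulfI D0); have [r er] : toric_image ('X_[all_ones] * val h).
    apply/toric_imageP => m.
    move=> /msuppM_le/allpairsP[[m1 m2] /= [m1D m2h ->]].
    move: m1D; rewrite msuppX inE => /eqP ->; rewrite addmC.
    exact: allowed_all_ones ((towerP _ _).1 (submodule_prop h) _ m2h).
  have e : s *: h = r *: one_ J.
    by apply: val_inj; rewrite -[LHS]/(psi s * val h) -[RHS]/(psi r * 1) er es mulr1.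
  have thZ (a : R) x : th (a *: x) = a *: th x by exact: linearZ.
  transitivity (val (s *: th h)); first by rewrite -es.
  by rewrite -thZ e thZ -[LHS]/(psi r * f) er mulrA.
have gf : val (th' (one_ J')) * f = 1 by rewrite -thE th'K.
have f0 : f@_0%MM != 0 := coeff0_unit gf.
have Tw : tower J L 'X_[um i.+1].
  apply/towerP/supportedX => t tL; have := allowed_w iN tL.
  by case: (eqVneq t i) => [->|_]; [rewrite iN Ji|case: (J t && _); rewrite ?addn0; lia].
pose w : tower_module J := to_submodule (tower_submod J) Tw.
have := (towerP J' _).1 (submodule_prop (th w)) (um i.+1).
rewrite mcoeff_msupp thE (coeff_mulX (um i.+1) f) => /(_ f0)/(_ i (N_lt M iN))[h _].
have iL := N_lt M iN; have id := w_lt iL.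
move: h; rewrite !um_expE // eqxx; case: (J' i) => //=; lia.
Qed.

Lemma tower_module_iso_eq (J J' : nat -> bool) : lmod_iso (tower_module J) (tower_module J') ->
  forall i, (i < N)%N -> J i = J' i.
Proof.
move=> iso i iN; apply/idP/idP; first exact: tower_module_iso_sub.
exact: (tower_module_iso_sub (lmod_iso_sym iso)).
Qed.

End Isomorphisms.

Definition bit_set N (A : {set 'I_N}) (i : nat) : bool := [exists o in A, o == i :> nat].

Lemma bit_setE N (A : {set 'I_N}) (o : 'I_N) : bit_set A o = (o \in A).
Proof.
apply/existsP/idP => [[o' /andP[oA /eqP e]]|oA]; last by exists o; rewrite oA eqxx.
by rewrite -(val_inj e).
Qed.

Lemma card_S0_ladder (k : fieldType) (N M : nat) : has_card (@S0 (R2 k (ladder N M))) (2 ^ N).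
Proof.
have cN : (2 ^ N)%N = #|{set 'I_N}| by rewrite -cardsT -powersetT card_powerset cardsT card_ord.
pose R := R2 k (ladder N M).
pose cls (t : 'I_(2 ^ N)) : lmodType R -> Prop :=
  lmod_iso (@tower_module k N M (bit_set (enum_val (cast_ord cN t)))).
exists cls => [t t' e|K].
  have iso : cls t (@tower_module k N M (bit_set (enum_val (cast_ord cN t')))).
    by rewrite e; apply: lmod_iso_refl.
  apply: (@cast_ord_inj _ _ cN); apply: enum_val_inj.
  apply/setP => o; rewrite -!bit_setE; exact: (tower_module_iso_eq iso).
split=> [[C semC ->]|[t <-]]; last first.
  by exists (@tower_module k N M (bit_set (enum_val (cast_ord cN t)))) => //; apply: tower_module_semidualizing.
have [J HJ] := semidualizing_classification semC.
pose A := [set o : 'I_N | J o]%SET.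
have iso : lmod_iso C (@tower_module k N M (bit_set A)).
  by apply: HJ => i iN; have := bit_setE A (Ordinal iN); rewrite inE.
exists (cast_ord (esym cN) (enum_rank A)); rewrite /cls cast_ordKV enum_rankK.
apply/funext => C'; apply/propext; split; first exact: lmod_iso_trans iso.
exact/lmod_iso_trans/lmod_iso_sym.
Qed.

Lemma ladder_inj N : injective (ladder N).
Proof. by move=> M M' /(congr1 nrows) []; lia. Qed.

Theorem corollary3p13 (k : fieldType) (N : nat) :
  infinite_set [set Y : grid |
    is_ladder Y /\ has_card (@S0 (R2 k Y)) (2 ^ N)]%classic.
Proof.
move=> fin; have := infinite_nat; apply.
(* Finiteness would pass to the preimage under [ladder N], which is all of [nat]. *)
apply: sub_finite_set (finite_preimage _ fin).
  by move=> M _ /=; split; [apply: ladder_is_ladder|apply: card_S0_ladder].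
by move=> M M' _ _; apply: ladder_inj.
Qed.
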